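(* There exists a spacelike Zoll cylinder, admitting a parabolic atlas with parameter $k>1$, that is not $C^2$-conformal to any finite cover of de Sitter space and whose conformal boundary is not $C^2$.
   Context: Conventions: Lorentzian surfaces have signature $(+,-)$; $v$ is spacelike if $g(v,v)>0$, lightlike if $g(v,v)=0$, $v\neq 0$. A cylinder is a surface diffeomorphic to $S^1\times\mathbb R$, $S^1=\mathbb R/2\pi\mathbb Z$. A spacelike Zoll cylinder is a Lorentzian cylinder all of whose (maximal) spacelike geodesics are simply closed and have the same length. De Sitter space is $(S^1\times\mathbb R,\cosh^2(t)d\varphi^2-dt^2)$; finite covers are its connected finite coverings (including itself) with the pulled-back metric. Two Lorentzian surfaces are $C^n$-conformal if there is a $C^n$-diffeomorphism between them mapping lightlike geodesics to lightlike geodesics up to parametrization. A spacelike Zoll cylinder is globally hyperbolic and admits a smooth conformal embedding $F$ into the flat cylinder $(S^1\times\mathbb R,d\varphi^2-dt^2)$; its conformal boundary is the topological boundary of $F(C)$ in $S^1\times\mathbb R$. Parabolic atlas: let $(C,g)$ be a Lorentzian cylinder with an atlas $\mathcal A=\{(U_i,\phi_i);\ i\in\mathbb Z/2k\mathbb Z\}$, $k\ge1$, and transition functions $\Phi_{ij}=\phi_j\circ\phi_i^{-1}$. Put $H^+=\{(x,y)\in\mathbb R^2: y>0\}$, $H^-=\{(x,y)\in\mathbb R^2:y<0\}$. $\mathcal A$ is a parabolic atlas (with parameters $k$ and $\tau\in\mathbb R$) if: (i) $\phi_i(U_i)=\mathbb R^2$ for all $i$; (ii) the transition functions are $\Phi_{2i,2i+1}:H^+\to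 H^+$, $(x,y)\mapsto(-x+\frac2y,y)$ for all $i$; $\Phi_{2i-1,2i}:H^-\to H^-$, $(x,y)\mapsto(-x+\frac2y,y)$ for $i\ne0$; and $\Phi_{2k-1,0}:H^-\to H^-$, $(x,y)\mapsto(-x+\frac2y+\tau,y)$ (the charts are glued only along these half-planes; when $k=1$, $U_0$ and $U_1$ are glued along both half-planes); (iii) for all $i$, $(\phi_i^{-1})^*g=y^2dx^2+2dx\,dy+f_i(y)dy^2$ with $f_i$ a smooth function on $\mathbb R$ satisfying $1-y^2f_i(y)>0$ for all $y\in\mathbb R$. *)

(* Defs.v *)
From Stdlib Require Import Reals ZArith Arith.
From Coquelicot Require Import Coquelicot.
Open Scope R_scope.

Definition pt : Type := (R * R)%type.

(* The two coordinate directions are indexed by [bool]: [false] is the first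
   coordinate, [true] the second. *)
Definition comp (k : bool) (p : pt) : R := if k then snd p else fst p.

Definition sum2 (h : bool -> R) : R := h false + h true.

Definition partial (i : bool) (f : R -> R -> R) (x y : R) : R :=
  if i then Derive (fun z => f x z) y else Derive (fun z => f z y) x.

Definition component (Phi : pt -> pt) (k : bool) (x y : R) : R :=
  comp k (Phi (x, y)).

(* [ex_diff_n f n x y]: the partial derivatives of [f] up to order [n] exist
   and are continuous at [(x, y)].  Required at all points of an open set, this
   is the usual notion of a [C^n] function there. *)
Definition Cn_at (n : nat) (Phi : pt -> pt) (p : pt) : Prop :=
  forall k, ex_diff_n (component Phi k) n (fst p) (snd p).

(* The cylinder [R/PZ x R], [P = circ > 0], is handled through its universal
   cover [R^2]: a point is a class of [same_pt], a function is a function of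
   the plane that is [P]-periodic in the first variable, a subset is a
   saturated subset of the plane, and curves and maps are given by lifts.
   The metric is [gE dx^2 + 2 gF dx dy + gG dy^2]. *)
Record cyl : Type := Cyl {
  circ : R;
  gE : R -> R -> R;
  gF : R -> R -> R;
  gG : R -> R -> R }.

Definition coef (C : cyl) (i j : bool) : R -> R -> R :=
  match i, j with
  | false, false => gE C
  | true, true => gG C
  | _, _ => gF C
  end.

Definition gdet (C : cyl) (x y : R) : R :=
  gE C x y * gG C x y - gF C x y ^ 2.

(* In dimension two, a metric has signature (+,-) iff its determinant is
   negative. *)
Definition lorentzian_cylinder (C : cyl) : Prop :=
  0 < circ C /\
  (forall i j n x y, ex_diff_n (coef C i j) n x y) /\
  (forall i j x y, coef C i j (x + circ C) y = coef C i j x y) /\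
  (forall x y, gdet C x y < 0).

Definition same_pt (C : cyl) (p q : pt) : Prop :=
  exists z : Z, q = (fst p + IZR z * circ C, snd p).

Definition saturated (C : cyl) (U : pt -> Prop) : Prop :=
  forall p q, same_pt C p q -> U p -> U q.

Definition flat_cylinder : cyl :=
  Cyl (2 * PI) (fun _ _ => 1) (fun _ _ => 0) (fun _ _ => - 1).

(* The [m]-fold connected covering of de Sitter space, [m >= 1].  The finite
   index subgroups of the deck group [2 PI Z] of the universal cover are the
   [2 PI m Z], so these are all the connected finite coverings. *)
Definition de_sitter_cover (m : nat) : cyl :=
  Cyl (2 * PI * INR m) (fun _ t => cosh t ^ 2) (fun _ _ => 0) (fun _ _ => - 1).

Definition inv_coef (C : cyl) (i j : bool) (x y : R) : R :=
  match i, j with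
  | false, false => gG C x y / gdet C x y
  | true, true => gE C x y / gdet C x y
  | _, _ => - gF C x y / gdet C x y
  end.

Definition christoffel (C : cyl) (k i j : bool) (x y : R) : R :=
  sum2 (fun l => inv_coef C k l x y *
    (/ 2 * (partial i (coef C j l) x y + partial j (coef C i l) x y
            - partial l (coef C i j) x y))).

Definition coord (c : R -> pt) (k : bool) (s : R) : R := comp k (c s).

(* g(c'(s), c'(s)) *)
Definition speed2 (C : cyl) (c : R -> pt) (s : R) : R :=
  sum2 (fun i => sum2 (fun j =>
    coef C i j (fst (c s)) (snd (c s)) *
    Derive (coord c i) s * Derive (coord c j) s)).

Definition in_itv (a b : Rbar) (s : R) : Prop := Rbar_lt a s /\ Rbar_lt s b.

(* Only the values of [c] on the open interval [(a, b)] matter. *)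
Definition geodesic (C : cyl) (a b : Rbar) (c : R -> pt) : Prop :=
  Rbar_lt a b /\
  forall s, in_itv a b s -> forall k,
    ex_derive (coord c k) s /\
    ex_derive (Derive (coord c k)) s /\
    Derive (Derive (coord c k)) s
    + sum2 (fun i => sum2 (fun j =>
        christoffel C k i j (fst (c s)) (snd (c s)) *
        Derive (coord c i) s * Derive (coord c j) s)) = 0.

Definition maximal_geodesic (C : cyl) (a b : Rbar) (c : R -> pt) : Prop :=
  geodesic C a b c /\
  forall (a' b' : Rbar) (c' : R -> pt),
    geodesic C a' b' c' -> Rbar_le a' a -> Rbar_le b b' ->
    (forall s, in_itv a b s -> c' s = c s) ->
    a' = a /\ b' = b.

Definition spacelike (C : cyl) (a b : Rbar) (c : R -> pt) : Prop :=
  forall s, in_itv a b s -> 0 < speed2 C c s.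

Definition lightlike (C : cyl) (a b : Rbar) (c : R -> pt) : Prop :=
  forall s, in_itv a b s ->
    speed2 C c s = 0 /\ exists k, Derive (coord c k) s <> 0.

Definition lightlike_geodesic (C : cyl) (a b : Rbar) (c : R -> pt) : Prop :=
  geodesic C a b c /\ lightlike C a b c.

Definition simply_closed (C : cyl) (c : R -> pt) (T : R) : Prop :=
  0 < T /\
  (forall s, same_pt C (c s) (c (s + T))) /\
  (forall s s', 0 <= s < T -> 0 <= s' < T ->
     same_pt C (c s) (c s') -> s = s').

Definition spacelike_zoll_cylinder (C : cyl) : Prop :=
  lorentzian_cylinder C /\
  exists L : R,
    forall (a b : Rbar) (c : R -> pt),
      maximal_geodesic C a b c -> spacelike C a b c ->
      a = m_infty /\ b = p_infty /\
      exists T, simply_closed C c T /\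
        is_RInt (fun s => sqrt (speed2 C c s)) 0 T L.

(* [Phi] is a lift to the plane of a [C^n] map of cylinders [C -> D]; every
   continuous map of cylinders has such a lift. *)
Definition cyl_map (n : nat) (C D : cyl) (Phi : pt -> pt) : Prop :=
  (forall p, Cn_at n Phi p) /\
  (forall p q, same_pt C p q -> same_pt D (Phi p) (Phi q)).

Definition cyl_diffeo (n : nat) (C D : cyl) (Phi : pt -> pt) : Prop :=
  cyl_map n C D Phi /\
  exists Psi, cyl_map n D C Psi /\
    (forall p, same_pt C (Psi (Phi p)) p) /\
    (forall q, same_pt D (Phi (Psi q)) q).

(* Orientation reversing changes of parameter need not be considered, since
   [s |-> c (- s)] is a geodesic whenever [c] is. *)
Definition reparametrization (a b a' b' : Rbar) (h : R -> R) : Prop :=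
  (forall s, in_itv a b s -> in_itv a' b' (h s)) /\
  (forall s r, in_itv a b s -> in_itv a b r -> s < r -> h s < h r) /\
  (forall s', in_itv a' b' s' -> exists s, in_itv a b s /\ h s = s').

Definition conformal (n : nat) (C D : cyl) : Prop :=
  exists Phi, cyl_diffeo n C D Phi /\
    forall (a b : Rbar) (c : R -> pt), lightlike_geodesic C a b c ->
      exists (a' b' : Rbar) (c' : R -> pt) (h : R -> R),
        lightlike_geodesic D a' b' c' /\
        reparametrization a b a' b' h /\
        (forall s, in_itv a b s -> Phi (c s) = c' (h s)).

(* Coefficients of the pullback metric [Phi^* g_D]. *)
Definition pullback (D : cyl) (Phi : pt -> pt) (i j : bool) (x y : R) : R :=
  sum2 (fun k => sum2 (fun l =>
    coef D k l (fst (Phi (x, y))) (snd (Phi (x, y))) *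
    partial i (component Phi k) x y * partial j (component Phi l) x y)).

(* Conformality makes [F] an immersion; an injective immersion between
   surfaces is open, hence an embedding. *)
Definition conformal_embedding (C D : cyl) (F : pt -> pt) : Prop :=
  (forall n, cyl_map n C D F) /\
  (forall p q, same_pt D (F p) (F q) -> same_pt C p q) /\
  (forall x y, exists lambda, 0 < lambda /\
     forall i j, pullback D F i j x y = lambda * coef C i j x y).

Definition cyl_image (D : cyl) (F : pt -> pt) (q : pt) : Prop :=
  exists p, same_pt D (F p) q.

Definition frontier (S : pt -> Prop) (q : pt) : Prop :=
  ~ locally q S /\ ~ locally q (fun r => ~ S r).

(* The boundary of a saturated set is the preimage of the boundary of its
   projection, the projection of the universal cover being a local
   homeomorphism. *)
Definition conformal_boundary (F : pt -> pt) : pt -> Prop :=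
  frontier (cyl_image flat_cylinder F).

(* One-dimensional [C^n] submanifold: locally a regular level set. *)
Definition Cn_curve (n : nat) (S : pt -> Prop) : Prop :=
  forall p, S p -> exists h : R -> R -> R,
    (exists i, partial i h (fst p) (snd p) <> 0) /\
    locally p (fun q => ex_diff_n h n (fst q) (snd q) /\
                        (S q <-> h (fst q) (snd q) = 0)).

(* A smooth chart [phi : U -> R^2] with [phi(U) = R^2]; [psi] is a lift of
   [phi^-1] to the universal cover. *)
Definition full_chart (C : cyl) (U : pt -> Prop) (phi psi : pt -> pt) : Prop :=
  open U /\ saturated C U /\
  (forall n p, U p -> Cn_at n phi p) /\
  (forall p q, U p -> same_pt C p q -> phi q = phi p) /\
  (forall n q, Cn_at n psi q) /\
  (forall q, U (psi q)) /\
  (forall q, phi (psi q) = q) /\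
  (forall p, U p -> same_pt C (psi (phi p)) p).

(* The gluing prescribed between the charts [0, ..., 2k-1].  All the maps
   involved are involutions. *)
Inductive glued (k : nat) (tau : R) : nat -> nat -> pt -> pt -> Prop :=
| glued_pos i x y : (i < k)%nat -> 0 < y ->
    glued k tau (2 * i) (2 * i + 1) (x, y) (- x + 2 / y, y)
| glued_neg i x y : (1 <= i < k)%nat -> y < 0 ->
    glued k tau (2 * i - 1) (2 * i) (x, y) (- x + 2 / y, y)
| glued_last x y : y < 0 ->
    glued k tau (2 * k - 1) 0 (x, y) (- x + 2 / y + tau, y).

Definition transition (k : nat) (tau : R) (i j : nat) (q r : pt) : Prop :=
  (i = j /\ q = r) \/ glued k tau i j q r \/ glued k tau j i r q.

(* The third clause says that [transition k tau i j] is the graph of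
   [phi_j o phi_i^-1] on its natural domain [phi_i (U_i /\ U_j)]. *)
Definition parabolic_atlas (C : cyl) (k : nat) (tau : R) : Prop :=
  (1 <= k)%nat /\
  exists (U : nat -> pt -> Prop) (phi psi : nat -> pt -> pt)
         (f : nat -> R -> R),
    (forall i, (i < 2 * k)%nat -> full_chart C (U i) (phi i) (psi i)) /\
    (forall p, exists i, (i < 2 * k)%nat /\ U i p) /\
    (forall i j, (i < 2 * k)%nat -> (j < 2 * k)%nat -> forall q r,
       (U j (psi i q) /\ phi j (psi i q) = r) <-> transition k tau i j q r) /\
    (forall i, (i < 2 * k)%nat ->
       (forall n y, ex_derive_n (f i) n y) /\
       (forall y, 1 - y ^ 2 * f i y > 0) /\
       (forall x y,
          pullback C (psi i) false false x y = y ^ 2 /\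
          pullback C (psi i) false true x y = 1 /\
          pullback C (psi i) true true x y = f i y)).

(* Main.v *)
(** Cut the double covering of de Sitter space along the leaves where its parabolic
    Killing field becomes lightlike into four half-planes, on which the norm of that
    field is a coordinate [y > 0] or [y < 0].  A metric of parabolic type is given on
    each of them by [s (y) = sqrt (1 - y^2 f (y))], and a unit spacelike geodesic of
    Killing momentum [C] satisfies [y = C sin theta], [d sigma = s d theta].  All
    spacelike geodesics are therefore closed of length [4 PI] if the four functions
    [s], evaluated at a common [|y|], add up to [4].  We take [1 + eta] and [1 - eta]
    on the half-planes [y > 0] and [1] on those with [y < 0], with [eta] supported in
    [y >= 1].  In the null coordinates [tan al], [tan be] the boundary [y = + oo] of
    the two perturbed half-planes is [tan al - tan be = - 1 / 2] and
    [tan al - tan be = 1 / 2]: together they form a curve of class [C^1] whose second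
    derivative jumps at the point where they meet.  A conformal map acts on each null
    coordinate separately, so it cannot remove this jump, whereas the boundary of de
    Sitter space is smooth. *)
Require Import Defs.
From Stdlib Require Import Reals ZArith Lra Lia FunctionalExtensionality.
From Coquelicot Require Import Coquelicot.
Open Scope R_scope.

(** * Smooth functions of two variables *)

(** The metric is written on a single global chart [(al, t)]. The sign [e] of the perturbation
    changes only at [cos al = 0], where [y = 0], below the support [y >= 1]; hence everything is
    smooth. The profile [eta = e y^2 bump 2 (y - 1) / 4] is chosen because [eta / y^2] has the
    elementary primitive [e bump 0 (y - 1) / 4]. It turns the de Sitter relation
    [tan al - tan be = 2 / y] into [2 / y - e bump 0 (y - 1) / 2], and the limit 1 of [bump 0]
    yields the two boundary constants. Spacelike geodesics are integrated by conserved quantities: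
    each one lies on an explicit curve defined for all times. Both negative claims go through a pair
    [(f, g)] of C^2 functions, [f] depending on [al] only and [g] constant on the other null leaves;
    the upper boundary is then [(f (al), G (Xb e al))], with [G] the restriction of [g] to a
    transversal. For a C^2 function vanishing on the boundary, the second-order conditions from the
    two sides of the corner differ only by the jump of [Xb''], multiplied by [G' <> 0]; so its
    differential is zero there. This excludes any regular equation, in particular the affine one
    satisfied by the boundary of de Sitter space. *)

Definition Cn_on (n : nat) (D : R -> R -> Prop) (f : R -> R -> R) : Prop :=
  forall x y, D x y -> ex_diff_n f n x y.

Definition open2 (D : R -> R -> Prop) : Prop :=
  forall x y, D x y -> locally_2d D x y.

Lemma open2_total : open2 (fun _ _ => True).
Proof. intros x y _; apply locally_2d_forall; auto. Qed.

Lemma Cn_on_continuity n D f x y : Cn_on n D f -> D x y -> continuity_2d_pt f x y.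
Proof.
  intros H Hd. specialize (H x y Hd). destruct n; simpl in H; tauto.
Qed.

Lemma Cn_on_le m n D f : (m <= n)%nat -> Cn_on n D f -> Cn_on m D f.
Proof. intros Hmn H x y Hd. apply (ex_diff_n_m n m Hmn); auto. Qed.

Lemma Cn_on_S n D f : Cn_on (S n) D f -> Cn_on n D f.
Proof. apply Cn_on_le; lia. Qed.

Lemma Cn_on_partial1 n D f :
  Cn_on (S n) D f -> Cn_on n D (fun x y => Derive (fun z => f z y) x).
Proof. intros H x y Hd; destruct (H x y Hd) as [_ [_ [_ [H1 _]]]]; exact H1. Qed.

Lemma Cn_on_partial2 n D f :
  Cn_on (S n) D f -> Cn_on n D (fun x y => Derive (fun z => f x z) y).
Proof. intros H x y Hd; destruct (H x y Hd) as [_ [_ [_ [_ H1]]]]; exact H1. Qed.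

Lemma Cn_on_is_derive1 n D f x y : Cn_on (S n) D f -> D x y ->
  is_derive (fun z => f z y) x (Derive (fun z => f z y) x).
Proof.
  intros H Hd; destruct (H x y Hd) as [_ [H1 _]]; now apply Derive_correct.
Qed.

Lemma Cn_on_is_derive2 n D f x y : Cn_on (S n) D f -> D x y ->
  is_derive (fun z => f x z) y (Derive (fun z => f x z) y).
Proof.
  intros H Hd; destruct (H x y Hd) as [_ [_ [H1 _]]]; now apply Derive_correct.
Qed.

Lemma Cn_on_ext n D f g : open2 D ->
  (forall x y, D x y -> f x y = g x y) -> Cn_on n D f -> Cn_on n D g.
Proof.
  intros Ho He H x y Hd. apply ex_diff_n_ext_loc with f; [|now apply H].
  apply locally_2d_impl with D; [|now apply Ho].
  apply locally_2d_forall; auto.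
Qed.

(** Partial derivatives are supplied in closed form and only afterwards identified with [Derive];
    this makes the closure properties below inductions on [n]. *)
Lemma Cn_on_intro n D f fx fy : open2 D ->
  (forall x y, D x y -> continuity_2d_pt f x y) ->
  (forall x y, D x y -> is_derive (fun z => f z y) x (fx x y)) ->
  (forall x y, D x y -> is_derive (fun z => f x z) y (fy x y)) ->
  Cn_on n D fx -> Cn_on n D fy -> Cn_on (S n) D f.
Proof.
  intros Ho Hc H1 H2 C1 C2.
  assert (E1 : Cn_on n D (fun x y => Derive (fun z => f z y) x)).
  { apply Cn_on_ext with fx; auto.
    intros x y Hd; symmetry; apply is_derive_unique; auto. }
  assert (E2 : Cn_on n D (fun x y => Derive (fun z => f x z) y)).
  { apply Cn_on_ext with fy; auto.
    intros x y Hd; symmetry; apply is_derive_unique; auto. }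
  intros x y Hd; simpl; repeat split; auto.
  - exists (fx x y); auto.
  - exists (fy x y); auto.
Qed.

Lemma Cn_on_glue n D f :
  (forall x y, D x y -> exists D' g, open2 D' /\ D' x y /\ Cn_on n D' g /\
     (forall u v, D' u v -> g u v = f u v)) -> Cn_on n D f.
Proof.
  intros H x y Hd; destruct (H x y Hd) as [D' [g [Ho [Hd' [Hg He]]]]].
  apply (Cn_on_ext n D' g f); auto.
Qed.

Lemma is_derive_cst (c x : R) : is_derive (fun _ : R => c) x 0.
Proof. apply (is_derive_const (K := R_AbsRing) (V := R_NormedModule)). Qed.

Lemma is_derive_continuous (f : R -> R) (x l : R) : is_derive f x l -> continuous f x.
Proof.
  intros H. apply (ex_derive_continuous (K := R_AbsRing) (V := R_NormedModule)). now exists l.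
Qed.

Ltac derive_value H :=
  match type of H with is_derive ?f ?x ?l =>
    replace (Derive (fun z : R => f z) x) with l by (symmetry; now apply is_derive_unique)
  end.

Lemma Cn_on_const n D c : open2 D -> Cn_on n D (fun _ _ => c).
Proof.
  intros Ho; revert c; induction n; intros c.
  - intros x y _; split; auto. apply continuity_2d_pt_const.
  - apply Cn_on_intro with (fun _ _ => 0) (fun _ _ => 0); auto; intros.
    + apply continuity_2d_pt_const.
    + apply is_derive_cst.
    + apply is_derive_cst.
Qed.

Lemma Cn_on_fst n D : open2 D -> Cn_on n D (fun x _ => x).
Proof.
  intros Ho; destruct n.
  - intros x y _; split; auto. apply continuity_2d_pt_id1.
  - apply Cn_on_intro with (fun _ _ => 1) (fun _ _ => 0); auto; intros;
      try apply continuity_2d_pt_id1; try (now apply Cn_on_const);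
      auto_derive; auto.
Qed.

Lemma Cn_on_snd n D : open2 D -> Cn_on n D (fun _ y => y).
Proof.
  intros Ho; destruct n.
  - intros x y _; split; auto. apply continuity_2d_pt_id2.
  - apply Cn_on_intro with (fun _ _ => 0) (fun _ _ => 1); auto; intros;
      try apply continuity_2d_pt_id2; try (now apply Cn_on_const);
      auto_derive; auto.
Qed.

Lemma Cn_on_plus n D f g : open2 D ->
  Cn_on n D f -> Cn_on n D g -> Cn_on n D (fun x y => f x y + g x y).
Proof.
  intros Ho; revert f g; induction n; intros f g Hf Hg.
  - intros x y Hd; split; auto.
    apply continuity_2d_pt_plus; eapply Cn_on_continuity; eauto.
  - apply Cn_on_intro with
      (fun x y => Derive (fun z => f z y) x + Derive (fun z => g z y) x)
      (fun x y => Derive (fun z => f x z) y + Derive (fun z => g x z) y); auto.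
    + intros x y Hd; apply continuity_2d_pt_plus; eapply Cn_on_continuity; eauto.
    + intros x y Hd. apply (is_derive_plus (fun z => f z y) (fun z => g z y));
        eapply Cn_on_is_derive1; eauto.
    + intros x y Hd. apply (is_derive_plus (fun z => f x z) (fun z => g x z));
        eapply Cn_on_is_derive2; eauto.
    + apply IHn; apply Cn_on_partial1; auto.
    + apply IHn; apply Cn_on_partial2; auto.
Qed.

Lemma Cn_on_mult n D f g : open2 D ->
  Cn_on n D f -> Cn_on n D g -> Cn_on n D (fun x y => f x y * g x y).
Proof.
  intros Ho; revert f g; induction n; intros f g Hf Hg.
  - intros x y Hd; split; auto.
    apply continuity_2d_pt_mult; eapply Cn_on_continuity; eauto.
  - apply Cn_on_intro with
      (fun x y => Derive (fun z => f z y) x * g x y + f x y * Derive (fun z => g z y) x)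
      (fun x y => Derive (fun z => f x z) y * g x y + f x y * Derive (fun z => g x z) y); auto.
    + intros x y Hd; apply continuity_2d_pt_mult; eapply Cn_on_continuity; eauto.
    + intros x y Hd.
      apply (is_derive_mult (fun z => f z y) (fun z => g z y));
        [eapply Cn_on_is_derive1; eauto | eapply Cn_on_is_derive1; eauto
        | intros; apply Rmult_comm].
    + intros x y Hd.
      apply (is_derive_mult (fun z => f x z) (fun z => g x z));
        [eapply Cn_on_is_derive2; eauto | eapply Cn_on_is_derive2; eauto
        | intros; apply Rmult_comm].
    + apply Cn_on_plus; auto; apply IHn;
        auto using Cn_on_partial1, Cn_on_S.
    + apply Cn_on_plus; auto; apply IHn;
        auto using Cn_on_partial2, Cn_on_S.
Qed.

Lemma Cn_on_opp n D f : open2 D -> Cn_on n D f -> Cn_on n D (fun x y => - f x y).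
Proof.
  intros Ho H. apply Cn_on_ext with (fun x y => (-1) * f x y); auto.
  - intros; ring.
  - apply Cn_on_mult; auto. now apply Cn_on_const.
Qed.

Lemma Cn_on_minus n D f g : open2 D ->
  Cn_on n D f -> Cn_on n D g -> Cn_on n D (fun x y => f x y - g x y).
Proof. intros Ho Hf Hg; apply Cn_on_plus; auto; now apply Cn_on_opp. Qed.

Lemma Cn_on_pow n D f k : open2 D -> Cn_on n D f -> Cn_on n D (fun x y => f x y ^ k).
Proof.
  intros Ho H; induction k; simpl.
  - now apply Cn_on_const.
  - now apply Cn_on_mult.
Qed.

Lemma is_derive_eq (f : R -> R) (x l l' : R) : is_derive f x l -> l = l' -> is_derive f x l'.
Proof. now intros H <-. Qed.

Lemma is_derive_continuity_pt (h : R -> R) x l : is_derive h x l -> continuity_pt h x.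
Proof.
  intros H. apply derivable_continuous_pt. exists l. now apply is_derive_Reals.
Qed.

Lemma Cn_on_chain0 D f (h h' : R -> R) :
  (forall x y, D x y -> is_derive h (f x y) (h' (f x y))) ->
  Cn_on 0 D f -> Cn_on 0 D (fun x y => h (f x y)).
Proof.
  intros Hh Hf x y Hd; split; auto.
  apply continuity_1d_2d_pt_comp.
  - eapply is_derive_continuity_pt; now apply Hh.
  - eapply Cn_on_continuity; eauto.
Qed.

(** Inductive step for an elementary [h]: it suffices that [h'] composed with [f] is already known
    to be C^n, as when [h'] is a rational expression in [h] itself or in the variable. *)
Lemma Cn_on_chain n D f (h h' : R -> R) : open2 D ->
  (forall x y, D x y -> is_derive h (f x y) (h' (f x y))) ->
  Cn_on (S n) D f -> Cn_on n D (fun x y => h' (f x y)) ->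
  Cn_on (S n) D (fun x y => h (f x y)).
Proof.
  intros Ho Hh Hf Hh'.
  apply Cn_on_intro with
    (fun x y => Derive (fun z => f z y) x * h' (f x y))
    (fun x y => Derive (fun z => f x z) y * h' (f x y)); auto.
  - intros x y Hd. apply continuity_1d_2d_pt_comp.
    + eapply is_derive_continuity_pt; now apply Hh.
    + eapply Cn_on_continuity; eauto.
  - intros x y Hd. apply (is_derive_comp h (fun z => f z y)); auto.
    eapply Cn_on_is_derive1; eauto.
  - intros x y Hd. apply (is_derive_comp h (fun z => f x z)); auto.
    eapply Cn_on_is_derive2; eauto.
  - apply Cn_on_mult; auto using Cn_on_partial1.
  - apply Cn_on_mult; auto using Cn_on_partial2.
Qed.

Lemma Cn_on_inv n D f : open2 D -> (forall x y, D x y -> f x y <> 0) ->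
  Cn_on n D f -> Cn_on n D (fun x y => / f x y).
Proof.
  intros Ho Hn; assert (Hd : forall x y, D x y ->
    is_derive Rinv (f x y) ((fun z => - (/ z * / z)) (f x y))).
  { intros x y Hd. auto_derive; auto. field; auto. }
  induction n; intros Hf.
  - now apply (Cn_on_chain0 D f _ _ Hd).
  - apply (Cn_on_chain n D f _ _ Ho Hd Hf).
    apply Cn_on_opp; auto; apply Cn_on_mult; auto using Cn_on_S.
Qed.

Lemma Cn_on_div n D f g : open2 D -> (forall x y, D x y -> g x y <> 0) ->
  Cn_on n D f -> Cn_on n D g -> Cn_on n D (fun x y => f x y / g x y).
Proof. intros; apply Cn_on_mult; auto; now apply Cn_on_inv. Qed.

Lemma Cn_on_cos_sin n D f : open2 D -> Cn_on n D f ->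
  Cn_on n D (fun x y => cos (f x y)) /\ Cn_on n D (fun x y => sin (f x y)).
Proof.
  intros Ho.
  assert (Hc : forall x y, D x y -> is_derive cos (f x y) ((fun z => - sin z) (f x y))).
  { intros. auto_derive; auto. ring. }
  assert (Hs : forall x y, D x y -> is_derive sin (f x y) (cos (f x y))).
  { intros. auto_derive; auto. ring. }
  induction n; intros Hf.
  - split; [now apply (Cn_on_chain0 D f _ _ Hc) | now apply (Cn_on_chain0 D f _ _ Hs)].
  - destruct (IHn (Cn_on_S _ _ _ Hf)) as [I1 I2]; split.
    + apply (Cn_on_chain n D f _ _ Ho Hc Hf). now apply Cn_on_opp.
    + now apply (Cn_on_chain n D f _ _ Ho Hs Hf).
Qed.

Lemma Cn_on_cos n D f : open2 D -> Cn_on n D f -> Cn_on n D (fun x y => cos (f x y)).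
Proof. intros; now apply Cn_on_cos_sin. Qed.

Lemma Cn_on_sin n D f : open2 D -> Cn_on n D f -> Cn_on n D (fun x y => sin (f x y)).
Proof. intros; now apply Cn_on_cos_sin. Qed.

Lemma Cn_on_exp n D f : open2 D -> Cn_on n D f -> Cn_on n D (fun x y => exp (f x y)).
Proof.
  intros Ho; assert (Hd : forall x y, D x y -> is_derive exp (f x y) (exp (f x y))).
  { intros x y Hd. auto_derive; auto. ring. }
  induction n; intros Hf.
  - now apply (Cn_on_chain0 D f _ _ Hd).
  - apply (Cn_on_chain n D f _ _ Ho Hd Hf); auto using Cn_on_S.
Qed.

Lemma Cn_on_atan n D f : open2 D -> Cn_on n D f -> Cn_on n D (fun x y => atan (f x y)).
Proof.
  intros Ho; assert (Hd : forall x y, D x y ->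
    is_derive atan (f x y) ((fun z => / (1 + z ^ 2)) (f x y))).
  { intros x y Hd. replace (f x y ^ 2) with (Rsqr (f x y)) by (unfold Rsqr; ring).
    apply is_derive_atan. }
  destruct n; intros Hf.
  - now apply (Cn_on_chain0 D f _ _ Hd).
  - apply (Cn_on_chain n D f _ _ Ho Hd Hf).
    apply Cn_on_inv; auto.
    + intros x y _; generalize (pow2_ge_0 (f x y)); lra.
    + apply Cn_on_plus; auto; [now apply Cn_on_const|].
      apply Cn_on_pow; auto using Cn_on_S.
Qed.

Lemma Cn_on_sqrt n D f : open2 D -> (forall x y, D x y -> 0 < f x y) ->
  Cn_on n D f -> Cn_on n D (fun x y => sqrt (f x y)).
Proof.
  intros Ho Hp; assert (Hd : forall x y, D x y ->
    is_derive sqrt (f x y) ((fun z => / (2 * sqrt z)) (f x y))).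
  { intros x y Hd. auto_derive; auto. generalize (sqrt_lt_R0 _ (Hp x y Hd)).
    intros; field; lra. }
  induction n; intros Hf.
  - now apply (Cn_on_chain0 D f _ _ Hd).
  - apply (Cn_on_chain n D f _ _ Ho Hd Hf).
    apply Cn_on_inv; auto.
    + intros x y Hdd; generalize (sqrt_lt_R0 _ (Hp x y Hdd)); lra.
    + apply Cn_on_mult; auto; [now apply Cn_on_const|auto using Cn_on_S].
Qed.

(** One partial derivative existing nearby and continuous at the point, together with the mere
    existence of the other, gives total differentiability. *)
Lemma Cn_on_differentiable n D f x y : open2 D -> Cn_on (S n) D f -> D x y ->
  differentiable_pt_lim f x y (Derive (fun z => f z y) x) (Derive (fun z => f x z) y).
Proof.
  intros Ho Hf Hd. apply filterdiff_differentiable_pt_lim.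
  apply (is_derive_filterdiff f x y (fun u v => Derive (fun z => f z v) u)).
  - apply locally_2d_locally with (P := fun u v => is_derive (fun z => f z v) u (Derive (fun z => f z v) u)). apply locally_2d_impl with D; [|now apply Ho].
    apply locally_2d_forall; intros u v Hd'. simpl.
    eapply Cn_on_is_derive1; eauto.
  - eapply Cn_on_is_derive2; eauto.
  - apply (proj1 (continuity_2d_pt_filterlim (fun u v => Derive (fun z => f z v) u) x y)).
    apply (Cn_on_continuity n D (fun u v => Derive (fun z => f z v) u)); auto.
    now apply Cn_on_partial1.
Qed.

Lemma Cn_on_curve n D f (u v : R -> R) s u' v' : open2 D -> Cn_on (S n) D f ->
  D (u s) (v s) -> is_derive u s u' -> is_derive v s v' ->
  is_derive (fun s => f (u s) (v s)) s
    (Derive (fun z => f z (v s)) (u s) * u' + Derive (fun z => f (u s) z) (v s) * v').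
Proof.
  intros Ho Hf Hd Hu Hv. apply is_derive_Reals.
  apply derivable_pt_lim_comp_2d.
  - eapply Cn_on_differentiable; eauto.
  - now apply is_derive_Reals.
  - now apply is_derive_Reals.
Qed.

Lemma Cn_on_ex_derive_n n (f : R -> R) :
  Cn_on n (fun _ _ => True) (fun _ y => f y) -> forall y, ex_derive_n f n y.
Proof.
  intros H.
  assert (G : forall k g, Cn_on k (fun _ _ => True) (fun _ y => g y) ->
    forall j, (j <= k)%nat -> forall y, ex_derive_n g j y).
  { clear. induction k; intros g Hg j Hj y.
    - replace j with 0%nat by lia. exact I.
    - destruct j as [|[|j]]; [exact I| |].
      + exists (Derive g y). now apply (Cn_on_is_derive2 k _ _ 0 y Hg).
      + assert (Hd := IHk (Derive g) (Cn_on_partial2 _ _ _ Hg) (S j) ltac:(lia) y).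
        simpl in Hd |- *.
        apply ex_derive_ext with (2 := Hd).
        intros t. change (Derive_n (Derive_n g 1) j t = Derive_n g (S j) t).
        rewrite Derive_n_comp.
        replace (j + 1)%nat with (S j) by lia. reflexivity. }
  intros y; now apply (G n f H n).
Qed.

(** * The perturbation *)

(** The family is closed under differentiation, which gives smoothness at 0 by one induction for all
    [k] at once. In particular the derivative of [bump 0] is [bump 2], whence the exponent 2 in the
    perturbation. *)
Definition bump (k : nat) (x : R) : R :=
  if Rlt_dec 0 x then exp (- / x) * (/ x) ^ k else 0.

Lemma bump_pos k x : 0 < x -> bump k x = exp (- / x) * (/ x) ^ k.
Proof. intros H; unfold bump; destruct (Rlt_dec 0 x); auto; lra. Qed.

Lemma bump_neg k x : x <= 0 -> bump k x = 0.
Proof. intros H; unfold bump; destruct (Rlt_dec 0 x); auto; lra. Qed.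

Lemma bump_ge0 k x : 0 <= bump k x.
Proof.
  destruct (Rlt_le_dec 0 x) as [H|H].
  - rewrite bump_pos; auto. apply Rmult_le_pos; [left; apply exp_pos|].
    apply pow_le. left. now apply Rinv_0_lt_compat.
  - rewrite bump_neg; auto; lra.
Qed.

(** Raise [z / n <= exp (z / n)] to the power [n]. With [z = 1 / x] it measures the flatness of
    [bump] at 0. *)
Lemma pow_mul_exp_opp_le n z : 0 < z -> z ^ n * exp (- z) <= INR n ^ n.
Proof.
  intros Hz. destruct n as [|n].
  - simpl. rewrite Rmult_1_l. rewrite <- exp_0. left. apply exp_increasing. lra.
  - assert (Hn : 0 < INR (S n)) by (apply lt_0_INR; lia).
    assert (H1 : (z / INR (S n)) ^ S n <= exp z).
    { replace (exp z) with (exp (z / INR (S n)) ^ S n).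
      - apply pow_incr. split.
        + apply Rlt_le, Rdiv_lt_0_compat; auto.
        + generalize (exp_ineq1_le (z / INR (S n))). lra.
      - rewrite <- Rpower_pow by apply exp_pos.
        unfold Rpower. rewrite ln_exp. f_equal. field. lra. }
    unfold Rdiv in H1. rewrite Rpow_mult_distr, pow_inv in H1.
    assert (H2 : 0 < INR (S n) ^ S n) by now apply pow_lt.
    rewrite exp_Ropp. apply Rmult_le_reg_r with (exp z); [apply exp_pos|].
    rewrite Rmult_assoc, Rinv_l, Rmult_1_r by (generalize (exp_pos z); lra).
    apply Rmult_le_reg_r with (/ INR (S n) ^ S n); [now apply Rinv_0_lt_compat|].
    replace (INR (S n) ^ S n * exp z * / INR (S n) ^ S n) with (exp z) by (field; lra).
    exact H1.
Qed.

Lemma is_derive_bump k x :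
  is_derive (bump k) x (- INR k * bump (k + 1) x + bump (k + 2) x).
Proof.
  destruct (Rtotal_order x 0) as [H|[H|H]].
  - rewrite !bump_neg by lra. replace (- INR k * 0 + 0) with 0 by ring.
    apply is_derive_ext_loc with (fun _ => 0).
    + exists (mkposreal (- x) ltac:(lra)). intros y Hy.
      unfold ball in Hy; simpl in Hy; unfold AbsRing_ball, abs, minus, plus, opp in Hy; simpl in Hy.
      symmetry; apply bump_neg. apply Rabs_def2 in Hy. lra.
    + apply is_derive_cst.
  - subst x. rewrite !bump_neg by lra. replace (- INR k * 0 + 0) with 0 by ring.
    apply is_derive_Reals. intros eps Heps.
    (* With [z = 1 / h], the difference quotient at 0 is [z^(k+2) exp (- z) h], hence at most
       [M h]. *)
    set (M := INR (k + 2) ^ (k + 2)).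
    assert (HM : 0 < M). { apply pow_lt. apply lt_0_INR. lia. }
    exists (mkposreal (eps / M) ltac:(apply Rdiv_lt_0_compat; lra)); simpl.
    intros h Hh Hd. rewrite Rplus_0_l, (bump_neg k 0), !Rminus_0_r by lra.
    destruct (Rlt_le_dec 0 h) as [Hp|Hn].
    + rewrite bump_pos by auto.
      assert (Hi : 0 < / h) by now apply Rinv_0_lt_compat.
      assert (Hb := pow_mul_exp_opp_le (k + 2) (/ h) Hi). fold M in Hb.
      replace (exp (- / h) * (/ h) ^ k / h) with ((/ h) ^ (k + 2) * exp (- / h) * h).
      2:{ rewrite pow_add. simpl. field. lra. }
      rewrite Rabs_pos_eq.
      2:{ apply Rmult_le_pos; [|lra]. apply Rmult_le_pos; [apply pow_le; lra | left; apply exp_pos]. }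
      rewrite Rabs_pos_eq in Hd by lra.
      apply Rle_lt_trans with (M * h); [now apply Rmult_le_compat_r; lra|].
      replace eps with (M * (eps / M)) by (field; lra).
      now apply Rmult_lt_compat_l.
    + rewrite bump_neg by auto. unfold Rdiv. rewrite Rmult_0_l, Rabs_R0. lra.
  - apply is_derive_ext_loc with (fun x => exp (- / x) * (/ x) ^ k).
    + exists (mkposreal x H). intros y Hy.
      unfold ball in Hy; simpl in Hy; unfold AbsRing_ball, abs, minus, plus, opp in Hy; simpl in Hy.
      symmetry; apply bump_pos. apply Rabs_def2 in Hy. lra.
    + rewrite !bump_pos by auto. auto_derive.
      * repeat split; auto; lra.
      * rewrite !pow_add. destruct k; simpl; field; lra.
Qed.

Lemma Cn_on_bump n D k f : open2 D -> Cn_on n D f -> Cn_on n D (fun x y => bump k (f x y)).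
Proof.
  intros Ho Hf; revert k.
  assert (Hd : forall k x y, D x y -> is_derive (bump k) (f x y)
     ((fun z => - INR k * bump (k + 1) z + bump (k + 2) z) (f x y))).
  { intros; apply is_derive_bump. }
  induction n; intros k.
  - now apply (Cn_on_chain0 D f _ _ (Hd k)).
  - apply (Cn_on_chain n D f _ _ Ho (Hd k) Hf).
    apply Cn_on_plus; auto using Cn_on_S. apply Cn_on_mult; auto using Cn_on_S.
    now apply Cn_on_const.
Qed.

Lemma bump0_le1 x : bump 0 x <= 1.
Proof.
  destruct (Rlt_le_dec 0 x) as [H|H].
  - rewrite bump_pos by auto. simpl. rewrite Rmult_1_r, <- exp_0. left.
    apply exp_increasing. apply Rinv_0_lt_compat in H. lra.
  - rewrite bump_neg; auto; lra.
Qed.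

Lemma bump0_lower x : 0 < x -> 1 - / x <= bump 0 x.
Proof.
  intros H. rewrite bump_pos by auto. simpl.
  generalize (exp_ineq1_le (- / x)). lra.
Qed.

(** After division by 4 this gives [|eta| <= 1/2], so the functions [s = 1 + eta] and [1 - eta] stay
    above 1/2. With [z = 1 / (y - 1)] the product is [(1 + z)^2 exp (- z)]. *)
Lemma sq_mul_bump2_bound y : 0 <= y ^ 2 * bump 2 (y - 1) <= 2.
Proof.
  split; [apply Rmult_le_pos; [apply pow2_ge_0|apply bump_ge0]|].
  destruct (Rlt_le_dec 0 (y - 1)) as [H|H]; [|rewrite bump_neg by auto; lra].
  rewrite bump_pos by auto.
  set (z := / (y - 1)).
  assert (Hz : 0 < z) by now apply Rinv_0_lt_compat.
  replace (y ^ 2 * (exp (- z) * z ^ 2)) with ((1 + z) ^ 2 * / exp z).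
  2:{ rewrite exp_Ropp. replace y with (1 + / z) by (unfold z; field; lra).
      field; split; [generalize (exp_pos z); lra | lra]. }
  (* The cubic is sharp enough: [2 (1 + z/3)^3 - (1 + z)^2 = (z - 3)^2 (2 z + 3) / 27]. *)
  assert (He : (1 + z / 3) ^ 3 <= exp z).
  { replace (exp z) with (exp (z / 3) ^ 3).
    - apply pow_incr. generalize (exp_ineq1_le (z / 3)). lra.
    - simpl. rewrite Rmult_1_r, <- !exp_plus. f_equal. lra. }
  assert (Hp := exp_pos z).
  apply Rmult_le_reg_r with (exp z); auto.
  rewrite Rmult_assoc, Rinv_l, Rmult_1_r by lra.
  assert (0 <= (z - 3) ^ 2 * (2 * z + 3)) by (apply Rmult_le_pos; [apply pow2_ge_0|lra]).
  nra.
Qed.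

(* With [y = 2 p q], the two half-planes on which [y > 0] are distinguished by
   the sign of [p]; they carry opposite perturbations. *)
Definition twist (k : nat) (p y : R) : R :=
  if Rlt_dec 0 p then bump k (y - 1) else - bump k (y - 1).

Lemma twist_pos k p y : 0 < p -> twist k p y = bump k (y - 1).
Proof. intros; unfold twist; destruct (Rlt_dec 0 p); auto; lra. Qed.

Lemma twist_neg k p y : p <= 0 -> twist k p y = - bump k (y - 1).
Proof. intros; unfold twist; destruct (Rlt_dec 0 p); auto; lra. Qed.

Lemma twist_small k p y : y <= 1 -> twist k p y = 0.
Proof.
  intros; unfold twist; destruct (Rlt_dec 0 p); rewrite bump_neg by lra; lra.
Qed.

(** At [p = 0] both sides fall in the negative branch of [twist], and the identity survives because
    both vanish. *)
Lemma twist_opp k p y : (p = 0 -> y <= 1) -> twist k (- p) y = - twist k p y.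
Proof.
  intros H. destruct (Rtotal_order p 0) as [L|[L|L]].
  - rewrite twist_pos, twist_neg by lra. ring.
  - rewrite !twist_small by auto. ring.
  - now rewrite twist_neg, twist_pos by lra.
Qed.

Lemma twist_scale k c p y : 0 < c -> twist k (c * p) y = twist k p y.
Proof.
  intros. destruct (Rlt_le_dec 0 p).
  - rewrite !twist_pos; auto; nra.
  - rewrite !twist_neg; auto; nra.
Qed.

Lemma twist2_bound p y : Rabs (y ^ 2 * twist 2 p y) <= 2.
Proof.
  assert (H := sq_mul_bump2_bound y). apply Rabs_le. split.
  - destruct (Rlt_le_dec 0 p); [rewrite twist_pos | rewrite twist_neg]; auto; lra.
  - destruct (Rlt_le_dec 0 p); [rewrite twist_pos | rewrite twist_neg]; auto; lra.
Qed.

Lemma twist0_bound p y : Rabs (twist 0 p y) <= 1.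
Proof.
  assert (H1 := bump_ge0 0 (y - 1)). assert (H2 := bump0_le1 (y - 1)).
  apply Rabs_le.
  destruct (Rlt_le_dec 0 p); [rewrite twist_pos | rewrite twist_neg]; auto; lra.
Qed.

Lemma open2_gt f :
  (forall x y, continuity_2d_pt f x y) -> open2 (fun x y => 0 < f x y).
Proof.
  intros H x y Hd. destruct (H x y (mkposreal _ Hd)) as [d Hd'].
  exists d. intros u v Hu Hv. specialize (Hd' u v Hu Hv). simpl in Hd'.
  apply Rabs_def2 in Hd'. lra.
Qed.

(** The discontinuity of [twist] at [f = 0] is invisible: near such a point [g < 1], so the function
    is locally zero. Elsewhere one branch is valid on a neighbourhood. *)
Lemma Cn_on_twist n k (f g : R -> R -> R) :
  (forall m, Cn_on m (fun _ _ => True) f) -> (forall m, Cn_on m (fun _ _ => True) g) ->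
  (forall x y, f x y = 0 -> g x y < 1) ->
  Cn_on n (fun _ _ => True) (fun x y => twist k (f x y) (g x y)).
Proof.
  intros Hf Hg Hfg.
  assert (Co := open2_total).
  assert (Cf : forall x y, continuity_2d_pt f x y).
  { intros; now apply (Cn_on_continuity 0 _ f x y (Hf 0%nat)). }
  assert (Cg : forall x y, continuity_2d_pt g x y).
  { intros; now apply (Cn_on_continuity 0 _ g x y (Hg 0%nat)). }
  assert (Hb : forall m, Cn_on m (fun _ _ => True) (fun x y => bump k (g x y - 1))).
  { intros m. apply Cn_on_bump; auto. apply Cn_on_minus; auto. now apply Cn_on_const. }
  apply Cn_on_glue. intros x y _.
  destruct (Rtotal_order (f x y) 0) as [H|[H|H]].
  - exists (fun u v => 0 < - f u v), (fun u v => - bump k (g u v - 1)).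
    assert (Ho : open2 (fun u v => 0 < - f u v)).
    { apply open2_gt; auto. intros; now apply continuity_2d_pt_opp. }
    repeat split; auto; [lra| |].
    + apply Cn_on_opp; auto. intros a b _; apply Hb; auto.
    + intros u v Huv. rewrite twist_neg; auto; lra.
  - exists (fun u v => 0 < 1 - g u v), (fun _ _ => 0).
    assert (Ho : open2 (fun u v => 0 < 1 - g u v)).
    { apply open2_gt; auto. intros; apply continuity_2d_pt_minus; auto.
      apply continuity_2d_pt_const. }
    repeat split; auto.
    + generalize (Hfg x y H); lra.
    + now apply Cn_on_const.
    + intros u v Huv. rewrite twist_small; auto; lra.
  - exists (fun u v => 0 < f u v), (fun u v => bump k (g u v - 1)).
    assert (Ho : open2 (fun u v => 0 < f u v)) by (apply open2_gt; auto).
    repeat split; auto.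
    + intros a b _; apply Hb; auto.
    + intros u v Huv. rewrite twist_pos; auto; lra.
Qed.

Lemma is_derive_twist k (f g : R -> R) x g' :
  continuous f x -> is_derive g x g' -> (f x = 0 -> g x < 1) ->
  is_derive (fun x => twist k (f x) (g x)) x
    (g' * (- INR k * twist (k + 1) (f x) (g x) + twist (k + 2) (f x) (g x))).
Proof.
  intros Cf Hg Hfg.
  assert (Cg : continuous g x).
  { apply (ex_derive_continuous (K := R_AbsRing) (V := R_NormedModule)). now exists g'. }
  assert (Hb : is_derive (fun x => bump k (g x - 1)) x
     (g' * (- INR k * bump (k + 1) (g x - 1) + bump (k + 2) (g x - 1)))).
  { apply (is_derive_comp (bump k) (fun x => g x - 1)).
    - apply is_derive_bump.
    - replace g' with (g' - 0) by ring.
      apply (is_derive_minus g (fun _ => 1)); auto.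
      apply is_derive_cst. }
  destruct (Rtotal_order (f x) 0) as [H|[H|H]].
  - rewrite !twist_neg by lra.
    apply is_derive_ext_loc with (fun x => - bump k (g x - 1)).
    + assert (L : locally x (fun y => f y < 0)).
      { apply (Cf (fun z => z < 0)). now apply open_lt. }
      revert L; apply filter_imp; intros y Hy. rewrite twist_neg; auto; lra.
    + match goal with |- is_derive _ _ ?l => replace l with
        (- (g' * (- INR k * bump (k + 1) (g x - 1) + bump (k + 2) (g x - 1)))) by ring end.
      now apply (is_derive_opp (fun x => bump k (g x - 1))).
  - specialize (Hfg H). rewrite !twist_small by lra.
    apply is_derive_ext_loc with (fun _ => 0).
    + assert (L : locally x (fun y => g y < 1)).
      { apply (Cg (fun z => z < 1)). now apply open_lt. }
      revert L; apply filter_imp; intros y Hy. rewrite twist_small; auto; lra.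
    + replace (g' * (- INR k * 0 + 0)) with 0 by ring.
      apply is_derive_cst.
  - rewrite !twist_pos by lra.
    apply is_derive_ext_loc with (fun x => bump k (g x - 1)); auto.
    assert (L : locally x (fun y => 0 < f y)).
    { apply (Cf (fun z => 0 < z)). now apply open_gt. }
    revert L; apply filter_imp; intros y Hy. rewrite twist_pos; auto; lra.
Qed.

(** * The cylinder and its geodesic equations *)

(* On the leaves [al = const] of one null foliation the second coordinate [t] is
   chosen so that de Sitter space is [4 (t^2 + 1) dal^2 + 4 dal dt] and the
   parabolic Killing field has norm [2 cos al (qf al t)]. *)
Definition qf (al t : R) : R := t * cos al + sin al.
(** In de Sitter space the second null coordinate is [be = al - PI / 2 + atan t], and
    [rf / qf = - tan be]. *)
Definition rf (al t : R) : R := cos al - t * sin al.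
Definition Kf (al t : R) : R := twist 2 (cos al) (2 * cos al * qf al t).
(* [s = 1 + eta], where [1 - s^2 = y^2 f y] in the charts of the atlas. *)
Definition sf (al t : R) : R := 1 + cos al ^ 2 * qf al t ^ 2 * Kf al t.
Definition kf (al t : R) : R := cos al * rf al t - qf al t * sin al.
(** [Ef] and [Ff] are the coefficients of the parabolic normal form rewritten in [(al, t)];
    expressed through [qf] and [Kf] they extend smoothly across [cos al = 0]. *)
Definition Ef (al t : R) : R := 4 * (t ^ 2 + 1 + qf al t ^ 2 * Kf al t * kf al t).
Definition Ff (al t : R) : R := 2 * sf al t.

Definition zoll_cyl : cyl := Cyl (2 * PI) Ef Ff (fun _ _ => 0).

Lemma sincos1 x : sin x ^ 2 + cos x ^ 2 = 1.
Proof. generalize (sin2_cos2 x); unfold Rsqr; intros; nra. Qed.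

Lemma qf_rf al t : qf al t * sin al + rf al t * cos al = 1.
Proof. unfold qf, rf. generalize (sincos1 al). nra. Qed.

Lemma sf_lower al t : / 2 <= sf al t.
Proof.
  unfold sf, Kf. assert (H := twist2_bound (cos al) (2 * cos al * qf al t)).
  apply Rabs_le_between in H. nra.
Qed.

Lemma sf_pos al t : 0 < sf al t.
Proof. generalize (sf_lower al t). lra. Qed.

Lemma Ff_pos al t : 0 < Ff al t.
Proof. unfold Ff; generalize (sf_pos al t); lra. Qed.

Ltac smooth := repeat first
  [ assumption | apply open2_total | apply Cn_on_plus | apply Cn_on_minus | apply Cn_on_mult
  | apply Cn_on_opp | apply Cn_on_pow | apply Cn_on_cos | apply Cn_on_sin
  | apply Cn_on_const | apply Cn_on_fst | apply Cn_on_snd ].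

Lemma Cn_on_qf n D : open2 D -> Cn_on n D qf.
Proof. intros. unfold qf. smooth. Qed.

Lemma Cn_on_rf n D : open2 D -> Cn_on n D rf.
Proof. intros. unfold rf. smooth. Qed.

Lemma Cn_on_twist_pq k n : Cn_on n (fun _ _ => True)
  (fun al t => twist k (cos al) (2 * cos al * qf al t)).
Proof.
  apply (Cn_on_twist n k (fun al _ => cos al) (fun al t => 2 * cos al * qf al t)).
  - intros; smooth.
  - intros. apply Cn_on_mult; [smooth|smooth|]. apply Cn_on_qf, open2_total.
  - intros x y H. rewrite H. lra.
Qed.

Lemma Cn_on_Kf n : Cn_on n (fun _ _ => True) Kf.
Proof. apply Cn_on_twist_pq. Qed.

Lemma Cn_on_Ef n : Cn_on n (fun _ _ => True) Ef.
Proof.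
  unfold Ef, kf. assert (H := Cn_on_Kf n).
  assert (Hq := Cn_on_qf n _ open2_total).
  assert (Hr := Cn_on_rf n _ open2_total).
  smooth.
Qed.

Lemma Cn_on_sf n : Cn_on n (fun _ _ => True) sf.
Proof.
  unfold sf. assert (H := Cn_on_Kf n).
  assert (Hq := Cn_on_qf n _ open2_total).
  smooth.
Qed.

Lemma Cn_on_Ff n : Cn_on n (fun _ _ => True) Ff.
Proof. unfold Ff. assert (H := Cn_on_sf n). smooth. Qed.

Lemma sin_cos_period al : sin (al + 2 * PI) = sin al /\ cos (al + 2 * PI) = cos al.
Proof.
  split.
  - replace (al + 2 * PI) with (al + 2 * INR 1 * PI) by (simpl; ring). apply sin_period.
  - replace (al + 2 * PI) with (al + 2 * INR 1 * PI) by (simpl; ring). apply cos_period.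
Qed.

Lemma zoll_cyl_lorentzian : lorentzian_cylinder zoll_cyl.
Proof.
  assert (Hpi := PI_RGT_0). repeat split.
  - simpl; lra.
  - intros [] [] n x y; simpl.
    + apply (Cn_on_const n _ 0 open2_total x y I).
    + apply (Cn_on_Ff n x y I).
    + apply (Cn_on_Ff n x y I).
    + apply (Cn_on_Ef n x y I).
  - intros i j x y. destruct (sin_cos_period x) as [Hs Hc].
    destruct i, j; simpl; auto;
      unfold Ff, Ef, sf, kf, Kf, rf, qf; now rewrite Hs, Hc.
  - intros x y. unfold gdet; simpl. generalize (Ff_pos x y). nra.
Qed.

Definition K1f (al t : R) : R :=
  - 2 * twist 3 (cos al) (2 * cos al * qf al t) + twist 4 (cos al) (2 * cos al * qf al t).

(* The partial derivatives of [cos x * qf x t] are [kf x t] and [cos x ^ 2]. *)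
Lemma is_derive_Kf (u v : R -> R) s u' v' : is_derive u s u' -> is_derive v s v' ->
  is_derive (fun s => Kf (u s) (v s)) s
    (2 * (kf (u s) (v s) * u' + cos (u s) ^ 2 * v') * K1f (u s) (v s)).
Proof.
  intros Hu Hv. unfold Kf, K1f.
  assert (Hy : is_derive (fun s => 2 * cos (u s) * qf (u s) (v s)) s
    (2 * (kf (u s) (v s) * u' + cos (u s) ^ 2 * v'))).
  { unfold qf, kf, rf, qf.
    auto_derive; [repeat split; first [now exists u' | now exists v' | exact I] |].
    replace (Derive (fun x => u x) s) with u' by (symmetry; now apply is_derive_unique).
    replace (Derive (fun x => v x) s) with v' by (symmetry; now apply is_derive_unique).
    ring. }
  assert (Hc : continuous (fun s => cos (u s)) s).
  { apply continuous_comp; [|apply continuous_cos].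
    apply (ex_derive_continuous (K := R_AbsRing) (V := R_NormedModule)). now exists u'. }
  assert (H := is_derive_twist 2 (fun s => cos (u s)) (fun s => 2 * cos (u s) * qf (u s) (v s)) s _ Hc Hy).
  eapply is_derive_eq; [apply H | simpl; ring].
  intros H0; rewrite H0; lra.
Qed.

(** The terms with the derivative [K1f] of the perturbation cancel, so the equation for [al]
    involves only [Kf] itself. *)
Lemma christoffel_combination al t :
  Derive (fun a => Ff a t) al - Derive (fun t => Ef al t) t / 2 =
  4 * (qf al t ^ 2 * Kf al t * cos al * sin al - t).
Proof.
  assert (Ia : is_derive (fun a : R => a) al 1) by (auto_derive; auto).
  assert (It : is_derive (fun a : R => a) t 1) by (auto_derive; auto).
  assert (Ca : is_derive (fun _ : R => al) t 0)
    by apply is_derive_cst.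
  assert (Ct : is_derive (fun _ : R => t) al 0)
    by apply is_derive_cst.
  assert (Ka := is_derive_Kf _ _ al _ _ Ia Ct).
  assert (Kt := is_derive_Kf _ _ t _ _ Ca It). simpl in Ka, Kt.
  erewrite (is_derive_unique (fun a => Ff a t)).
  2:{ unfold Ff, sf, qf. auto_derive.
      - repeat split; auto. eexists; apply Ka.
      - reflexivity. }
  erewrite (is_derive_unique (fun t => Ef al t)).
  2:{ unfold Ef, kf, rf, qf. auto_derive.
      - repeat split; auto. eexists; apply Kt.
      - reflexivity. }
  replace (Derive (fun x => Kf x t) al) with
    (2 * (kf al t * 1 + cos al ^ 2 * 0) * K1f al t) by (symmetry; now apply is_derive_unique).
  replace (Derive (fun x => Kf al x) t) with
    (2 * (kf al t * 0 + cos al ^ 2 * 1) * K1f al t) by (symmetry; now apply is_derive_unique).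
  unfold kf, qf, rf. simpl. field.
Qed.

(** Since the [dt^2] coefficient is zero, the only nonzero symbol with upper index [al] is the one
    with both lower indices [al]. *)
Lemma christoffel_fst (vel : bool -> R) x y :
  sum2 (fun i => sum2 (fun j => christoffel zoll_cyl false i j x y * vel i * vel j)) =
  4 * (qf x y ^ 2 * Kf x y * cos x * sin x - y) / Ff x y * vel false ^ 2.
Proof.
  rewrite <- christoffel_combination.
  assert (HF := Ff_pos x y).
  unfold sum2, christoffel, inv_coef, gdet, partial, sum2; simpl.
  rewrite !Derive_const. field. lra.
Qed.

Lemma christoffel_snd (vel : bool -> R) x y :
  sum2 (fun i => sum2 (fun j => christoffel zoll_cyl true i j x y * vel i * vel j)) =
  (Derive (fun z => Ef z y) x / 2 * vel false ^ 2
   + Derive (fun z => Ef x z) y * vel false * vel true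
   + Derive (fun z => Ff x z) y * vel true ^ 2) / Ff x y
  - Ef x y / Ff x y ^ 2 * (4 * (qf x y ^ 2 * Kf x y * cos x * sin x - y)) * vel false ^ 2.
Proof.
  rewrite <- christoffel_combination.
  assert (HF := Ff_pos x y).
  unfold sum2, christoffel, inv_coef, gdet, partial, sum2; simpl.
  rewrite !Derive_const. field. lra.
Qed.

Lemma zoll_speed2 c s : speed2 zoll_cyl c s =
  Ef (fst (c s)) (snd (c s)) * Derive (coord c false) s ^ 2
  + 2 * Ff (fst (c s)) (snd (c s)) * Derive (coord c false) s * Derive (coord c true) s.
Proof. unfold speed2, sum2; simpl. ring. Qed.

Lemma is_derive_zoll_speed2 c s a1 a2 t2 :
  ex_derive (coord c false) s -> ex_derive (coord c true) s ->
  Derive (coord c false) s = a1 ->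
  is_derive (Derive (coord c false)) s a2 -> is_derive (Derive (coord c true)) s t2 ->
  let x := fst (c s) in let y := snd (c s) in let t1 := Derive (coord c true) s in
  is_derive (speed2 zoll_cyl c) s
    ((Derive (fun z => Ef z y) x * a1 + Derive (fun z => Ef x z) y * t1) * a1 ^ 2
     + 2 * Ef x y * a1 * a2
     + 2 * (Derive (fun z => Ff z y) x * a1 + Derive (fun z => Ff x z) y * t1) * a1 * t1
     + 2 * Ff x y * (a2 * t1 + a1 * t2)).
Proof.
  intros Ha Ht Hda Ha2 Ht2 x y t1. subst a1.
  apply Derive_correct in Ha; apply Derive_correct in Ht.
  assert (HE := Cn_on_curve 0 _ Ef (coord c false) (coord c true) s _ _
    open2_total (Cn_on_Ef 1) I Ha Ht).
  assert (HF := Cn_on_curve 0 _ Ff (coord c false) (coord c true) s _ _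
    open2_total (Cn_on_Ff 1) I Ha Ht).
  apply is_derive_ext with (fun s =>
    Ef (coord c false s) (coord c true s) * Derive (coord c false) s ^ 2
    + 2 * Ff (coord c false s) (coord c true s)
      * Derive (coord c false) s * Derive (coord c true) s).
  { intros u; rewrite zoll_speed2; reflexivity. }
  set (Es := fun s => Ef (coord c false s) (coord c true s)) in *.
  set (Fs := fun s => Ff (coord c false s) (coord c true s)) in *.
  change (is_derive (fun s => Es s * Derive (coord c false) s ^ 2
    + 2 * Fs s * Derive (coord c false) s * Derive (coord c true) s) s
    ((Derive (fun z => Ef z y) x * Derive (coord c false) s + Derive (fun z => Ef x z) y * t1) * Derive (coord c false) s ^ 2
     + 2 * Es s * Derive (coord c false) s * a2
     + 2 * (Derive (fun z => Ff z y) x * Derive (coord c false) s + Derive (fun z => Ff x z) y * t1) * Derive (coord c false) s * t1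
     + 2 * Fs s * (a2 * t1 + Derive (coord c false) s * t2))).
  set (fa := Derive (coord c false)) in *. set (ft := Derive (coord c true)) in *.
  auto_derive.
  - repeat split; eexists; eassumption.
  - replace (Derive (fun x => Es x) s) with
      (Derive (fun z => Ef z y) x * fa s + Derive (fun z => Ef x z) y * ft s)
      by (symmetry; apply is_derive_unique; exact HE).
    replace (Derive (fun x => Fs x) s) with
      (Derive (fun z => Ff z y) x * fa s + Derive (fun z => Ff x z) y * ft s)
      by (symmetry; apply is_derive_unique; exact HF).
    replace (Derive (fun x => fa x) s) with a2 by (symmetry; apply is_derive_unique; exact Ha2).
    replace (Derive (fun x => ft x) s) with t2 by (symmetry; apply is_derive_unique; exact Ht2).
    unfold t1. ring.
Qed.

Lemma is_derive_zero_const (f : R -> R) (a b : Rbar) :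
  (forall s, in_itv a b s -> is_derive f s 0) ->
  forall s r, in_itv a b s -> in_itv a b r -> f s = f r.
Proof.
  intros H. assert (G : forall s r, in_itv a b s -> in_itv a b r -> s < r -> f s = f r).
  { intros s r [Hs1 Hs2] [Hr1 Hr2] Hsr. apply (eq_is_derive f s r); auto.
    intros t [Ht1 Ht2]. apply H. split.
    - apply Rbar_lt_le_trans with s; auto.
    - apply Rbar_le_lt_trans with r; auto. }
  intros s r Hs Hr. destruct (Rtotal_order s r) as [L|[L|L]]; auto.
  - now subst.
  - symmetry; auto.
Qed.

Lemma in_itv_between a b s r t : in_itv a b s -> in_itv a b r -> s <= t <= r -> in_itv a b t.
Proof.
  intros [Hs1 Hs2] [Hr1 Hr2] [Ht1 Ht2]. split.
  - apply Rbar_lt_le_trans with s; auto.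
  - apply Rbar_le_lt_trans with r; auto.
Qed.

Lemma nonvanishing_sign (f : R -> R) (a b : Rbar) :
  (forall s, in_itv a b s -> continuity_pt f s) ->
  (forall s, in_itv a b s -> f s <> 0) ->
  forall s r, in_itv a b s -> in_itv a b r -> 0 < f s * f r.
Proof.
  intros Hc Hn.
  assert (G : forall g s r, (forall t, in_itv a b t -> continuity_pt g t) ->
    (forall t, in_itv a b t -> g t <> 0) -> in_itv a b s -> in_itv a b r ->
    s < r -> g s < 0 -> g r < 0).
  { intros g s r Gc Gn Hs Hr Hsr Hlt. destruct (Rtotal_order (g r) 0) as [L|[L|L]]; auto.
    - now elim (Gn r Hr).
    - destruct (Ranalysis5.IVT_interv g s r) as [z [Hz1 Hz2]]; auto.
      + intros t Ht. apply Gc. apply in_itv_between with s r; auto.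
      + elim (Gn z); auto. apply in_itv_between with s r; auto. }
  assert (G2 : forall s r, in_itv a b s -> in_itv a b r -> s < r -> 0 < f s * f r).
  { intros s r Hs Hr Hsr. destruct (Rtotal_order (f s) 0) as [L|[L|L]].
    - generalize (G f s r Hc Hn Hs Hr Hsr L). nra.
    - now elim (Hn s Hs).
    - assert (H := G (fun x => - f x) s r). cbv beta in H.
      enough (- f r < 0) by nra. apply H; auto; try lra.
      + intros t Ht. now apply continuity_pt_opp, Hc.
      + intros t Ht; generalize (Hn t Ht); lra. }
  intros s r Hs Hr. destruct (Rtotal_order s r) as [L|[L|L]]; auto.
  - subst. generalize (Hn r Hr). nra.
  - rewrite Rmult_comm; auto.
Qed.

(* [v] is the speed, with the sign of [al'], and [n = v / (2 al')]: energy
   conservation makes the geodesic equation a first-order system in [(al, t, n)]. *)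
Lemma spacelike_geodesic_system a b c :
  geodesic zoll_cyl a b c -> spacelike zoll_cyl a b c ->
  exists (v : R) (n : R -> R), v <> 0 /\
    forall s, in_itv a b s ->
      let x := fst (c s) in let y := snd (c s) in
      0 < n s /\
      is_derive (fun s => fst (c s)) s (v / (2 * n s)) /\
      is_derive (fun s => snd (c s)) s (v / (2 * sf x y) * (n s - Ef x y / (4 * n s))) /\
      is_derive n s (- (v / sf x y) * (y - qf x y ^ 2 * Kf x y * cos x * sin x)).
Proof.
  intros [Hab Hg] Hsp.
  assert (Hz : forall s, in_itv a b s -> is_derive (speed2 zoll_cyl c) s 0).
  { intros s Hs. destruct (Hg s Hs false) as [A1 [A2 A3]]. destruct (Hg s Hs true) as [T1 [T2 T3]].
    apply Derive_correct in A2. apply Derive_correct in T2.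
    assert (HF := Ff_pos (fst (c s)) (snd (c s))).
    assert (HC := christoffel_combination (fst (c s)) (snd (c s))).
    rewrite (christoffel_fst (fun i => Derive (coord c i) s)) in A3.
    rewrite (christoffel_snd (fun i => Derive (coord c i) s)) in T3.
    assert (H := is_derive_zoll_speed2 c s _ _ _ A1 T1 eq_refl A2 T2). simpl in H.
    apply (is_derive_eq _ _ _ _ H).
    rewrite <- HC in A3, T3.
    replace (Derive (Derive (coord c false)) s) with
      (- ((Derive (fun a0 : R => Ff a0 (snd (c s))) (fst (c s)) -
       Derive (fun t : R => Ef (fst (c s)) t) (snd (c s)) / 2) /
      Ff (fst (c s)) (snd (c s)) * Derive (coord c false) s ^ 2)) by lra.
    match type of T3 with _ + ?r = 0 => replace (Derive (Derive (coord c true)) s) with (- r) by lra end.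
    field. lra. }
  assert (Hconst := is_derive_zero_const _ a b Hz).
  (* If [al'] vanished, the velocity would be tangent to a leaf [al = const], which is null. *)
  assert (Hne : forall s, in_itv a b s -> Derive (coord c false) s <> 0).
  { intros s Hs H0. generalize (Hsp s Hs). rewrite zoll_speed2, H0. nra. }
  assert (Hcont : forall s, in_itv a b s -> continuity_pt (Derive (coord c false)) s).
  { intros s Hs. destruct (Hg s Hs false) as [_ [A2 _]]. apply Derive_correct in A2.
    eapply is_derive_continuity_pt; eauto. }
  assert (Hsign := nonvanishing_sign _ a b Hcont Hne).
  assert (Hs0 : exists s0, in_itv a b s0).
  { destruct a as [a| |], b as [b| |]; simpl in Hab; try easy.
    - exists ((a + b) / 2); split; simpl; lra.
    - exists (a + 1); split; simpl; auto; lra.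
    - exists (b - 1); split; simpl; auto; lra.
    - exists 0; split; simpl; auto. }
  destruct Hs0 as [s0 Hs0].
  set (e := speed2 zoll_cyl c s0). assert (He : 0 < e) by now apply Hsp.
  set (a0 := Derive (coord c false) s0).
  assert (Hv : exists v, v ^ 2 = e /\ 0 < v * a0).
  { assert (Hq := sqrt_lt_R0 e He). assert (Hq2 := sqrt_sqrt e (Rlt_le _ _ He)).
    assert (Ha0 : a0 <> 0) by now apply Hne.
    destruct (Rtotal_order a0 0) as [L|[L|L]]; [|contradiction|].
    - exists (- sqrt e). split; nra.
    - exists (sqrt e). split; nra. }
  destruct Hv as [v [Hv1 Hv2]].
  exists v, (fun s => v / (2 * Derive (coord c false) s)).
  assert (Hv0 : v <> 0) by nra.
  split; auto.
  intros s Hs x y.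
  assert (Has := Hne s Hs). assert (Hsg := Hsign s s0 Hs Hs0). fold a0 in Hsg.
  assert (Hva : 0 < v * Derive (coord c false) s).
  { assert (0 < a0 ^ 2) by nra.
    assert (0 < (v * Derive (coord c false) s) * (a0 ^ 2)) by nra. nra. }
  set (be := Derive (coord c false) s) in *.
  destruct (Hg s Hs false) as [A1 [A2 A3]]. destruct (Hg s Hs true) as [T1 [T2 T3]].
  assert (HF := Ff_pos x y). assert (Hsf := sf_pos x y).
  refine (conj _ (conj _ (conj _ _))).
  - replace (v / (2 * be)) with ((v * be) / (2 * be ^ 2)) by (field; auto).
    apply Rdiv_lt_0_compat; nra.
  - replace (v / (2 * (v / (2 * be)))) with be by (field; auto).
    apply Derive_correct in A1; exact A1.
  - apply Derive_correct in T1.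
    assert (Hsp2 : Ef x y * be ^ 2 + 2 * Ff x y * be * Derive (coord c true) s = v ^ 2).
    { rewrite Hv1. unfold e. rewrite <- (Hconst s s0 Hs Hs0), zoll_speed2. reflexivity. }
    unfold Ff in Hsp2.
    replace (v / (2 * sf x y) * (v / (2 * be) - Ef x y / (4 * (v / (2 * be)))))
      with (Derive (coord c true) s).
    + exact T1.
    + apply Rmult_eq_reg_l with (4 * sf x y * be).
      * replace (4 * sf x y * be * (v / (2 * sf x y) * (v / (2 * be) - Ef x y / (4 * (v / (2 * be))))))
          with (v ^ 2 - Ef x y * be ^ 2) by (field; repeat split; auto; lra).
        lra.
      * assert (0 < sf x y) by auto. apply Rmult_integral_contrapositive; split; auto; lra.
  - apply Derive_correct in A2. rewrite (christoffel_fst (fun i => Derive (coord c i) s)) in A3.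
    fold x y be in A3. unfold Ff in A3.
    set (fa := Derive (coord c false)) in *.
    auto_derive.
    + repeat split; [eexists; eassumption | fold be; lra].
    + replace (Derive (fun x => fa x) s) with (Derive fa s) by reflexivity.
      fold be.
      replace (Derive fa s) with (- (4 * (qf x y ^ 2 * Kf x y * cos x * sin x - y) / (2 * sf x y) * be ^ 2)) by lra.
      field. split; auto; lra.
Qed.

(* When the first coordinate moves, conservation of energy replaces the geodesic
   equation for the second one. *)
Lemma geodesic_of_energy (al tt be : R -> R) (e : R) :
  (forall s, be s <> 0) ->
  (forall s, is_derive al s (be s)) ->
  (forall s, is_derive be s
     (2 * be s ^ 2 / sf (al s) (tt s)
      * (tt s - qf (al s) (tt s) ^ 2 * Kf (al s) (tt s) * cos (al s) * sin (al s)))) ->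
  (forall s, is_derive tt s
     ((e / be s - Ef (al s) (tt s) * be s) / (2 * Ff (al s) (tt s)))) ->
  geodesic zoll_cyl m_infty p_infty (fun s => (al s, tt s)) /\
  forall s, speed2 zoll_cyl (fun s => (al s, tt s)) s = e.
Proof.
  intros Hbe Ha Hb Ht.
  set (c := fun s => (al s, tt s)).
  set (ft := fun s => (e / be s - Ef (al s) (tt s) * be s) / (2 * Ff (al s) (tt s))) in *.
  assert (Da : forall s, Derive (coord c false) s = be s).
  { intros s. apply is_derive_unique. apply Ha. }
  assert (Dt : forall s, Derive (coord c true) s = ft s).
  { intros s. apply is_derive_unique. apply Ht. }
  assert (Hsp : forall s, speed2 zoll_cyl c s = e).
  { intros s. rewrite zoll_speed2, Da, Dt. unfold c, ft; simpl.
    generalize (Ff_pos (al s) (tt s)) (Hbe s); intros; field; split; auto; lra. }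
  split; auto. split; [exact I|].
  intros s _.
  assert (A2 : is_derive (Derive (coord c false)) s
     (2 * be s ^ 2 / sf (al s) (tt s)
      * (tt s - qf (al s) (tt s) ^ 2 * Kf (al s) (tt s) * cos (al s) * sin (al s)))).
  { apply is_derive_ext with be; [intros; now rewrite Da|apply Hb]. }
  assert (HE := Cn_on_curve 0 _ Ef al tt s _ _ open2_total (Cn_on_Ef 1) I (Ha s) (Ht s)).
  assert (HF := Cn_on_curve 0 _ Ff al tt s _ _ open2_total (Cn_on_Ff 1) I (Ha s) (Ht s)).
  assert (T2 : ex_derive (Derive (coord c true)) s).
  { apply ex_derive_ext with ft; [intros; now rewrite Dt|].
    unfold ft. generalize (Ff_pos (al s) (tt s)); intros HFp.
    set (Es := fun s => Ef (al s) (tt s)) in *. set (Fs := fun s => Ff (al s) (tt s)) in *.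
    change (ex_derive (fun s => (e / be s - Es s * be s) / (2 * Fs s)) s).
    change (0 < Fs s) in HFp. specialize (Hb s). specialize (Hbe s).
    auto_derive. repeat split; first [eexists; eassumption | assumption | lra]. }
  assert (Ea : ex_derive (coord c false) s) by (exists (be s); apply Ha).
  assert (Et : ex_derive (coord c true) s) by (exists (ft s); apply Ht).
  assert (Hsf := sf_pos (al s) (tt s)).
  intros [].
  - split; auto. split; auto.
    assert (H := is_derive_zoll_speed2 c s _ _ _ Ea Et (Da s) A2 (Derive_correct _ _ T2)).
    assert (H0 : is_derive (speed2 zoll_cyl c) s 0).
    { apply is_derive_ext with (fun _ => e); [intros; now rewrite Hsp|].
      apply is_derive_cst. }
    apply is_derive_unique in H. apply is_derive_unique in H0. rewrite H0 in H. clear H0.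
    rewrite (christoffel_snd (fun i => Derive (coord c i) s)).
    assert (HC := christoffel_combination (al s) (tt s)).
    rewrite Da. cbv zeta in H. change (fst (c s)) with (al s) in *. change (snd (c s)) with (tt s) in *.
    set (T := Derive (Derive (coord c true)) s) in *. set (t1 := Derive (coord c true) s) in *.
    rewrite <- HC.
    replace (tt s - qf (al s) (tt s) ^ 2 * Kf (al s) (tt s) * cos (al s) * sin (al s))
      with (- (4 * (qf (al s) (tt s) ^ 2 * Kf (al s) (tt s) * cos (al s) * sin (al s) - tt s)) / 4) in H
      by field.
    rewrite <- HC in H.
    generalize (Hbe s); intros Hbs.
    unfold Ff in *.
    set (Fa := Derive (fun a => 2 * sf a (tt s)) (al s)) in *.
    set (Ft := Derive (fun z => 2 * sf (al s) z) (tt s)) in *.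
    set (Ea' := Derive (fun z => Ef z (tt s)) (al s)) in *.
    set (Et' := Derive (fun z => Ef (al s) z) (tt s)) in *.
    set (S := sf (al s) (tt s)) in *. set (E := Ef (al s) (tt s)) in *.
    set (b := be s) in *.
    (* The derivative of the energy, which is zero, equals [2 Ff al'] times the second geodesic
       equation once the first one is substituted; here [2 Ff al'] is [4 * S * b]. *)
    apply Rmult_eq_reg_l with (4 * S * b).
    2:{ apply Rmult_integral_contrapositive; split; auto; lra. }
    rewrite Rmult_0_r. match type of H with _ = ?r => transitivity r; [|symmetry; exact H] end.
    clear H. field. lra.
  - split; auto. split; [eexists; apply A2|].
    rewrite (christoffel_fst (fun i => Derive (coord c i) s)), Da.
    rewrite (is_derive_unique _ _ _ A2). unfold Ff; simpl. field. lra.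
Qed.

(** * Polar angles and inverse primitives *)

(* The argument in (-PI, PI) of the vector (X, Y), outside the half-line
   [Y = 0, X <= 0]. *)
Definition harg (X Y : R) : R := 2 * atan (Y / (sqrt (X ^ 2 + Y ^ 2) + X)).

Lemma norm_plus_pos X Y : (Y = 0 -> 0 < X) -> 0 < sqrt (X ^ 2 + Y ^ 2) + X.
Proof.
  intros H. destruct (Req_dec Y 0) as [E|E].
  - specialize (H E). generalize (sqrt_pos (X ^ 2 + Y ^ 2)). lra.
  - assert (Rabs X < sqrt (X ^ 2 + Y ^ 2)).
    { rewrite <- sqrt_Rsqr_abs. apply sqrt_lt_1.
      - apply Rle_0_sqr.
      - nra.
      - unfold Rsqr. assert (0 < Y ^ 2) by nra. nra. }
    generalize (Rle_abs (- X)). rewrite Rabs_Ropp. lra.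
Qed.

Lemma norm_sq_pos X Y : (Y = 0 -> 0 < X) -> 0 < X ^ 2 + Y ^ 2.
Proof. intros H. destruct (Req_dec Y 0); [specialize (H H0)|]; nra. Qed.

Lemma cos_sin_harg X Y : (Y = 0 -> 0 < X) ->
  cos (harg X Y) = X / sqrt (X ^ 2 + Y ^ 2) /\ sin (harg X Y) = Y / sqrt (X ^ 2 + Y ^ 2).
Proof.
  intros H. assert (Hp := norm_plus_pos X Y H). assert (Hs := norm_sq_pos X Y H).
  unfold harg. set (N := sqrt (X ^ 2 + Y ^ 2)) in *.
  assert (HN : 0 < N) by now apply sqrt_lt_R0.
  assert (HN2 : N * N = X ^ 2 + Y ^ 2) by (apply sqrt_sqrt; lra).
  set (u := Y / (N + X)).
  assert (Hu : 1 + u ^ 2 = 2 * N / (N + X)).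
  { unfold u. apply Rmult_eq_reg_r with ((N + X) ^ 2); [|apply pow_nonzero; lra].
    field_simplify; [|lra|lra]. nra. }
  assert (Hu0 : 0 < 1 + u ^ 2) by nra.
  rewrite cos_2a, sin_2a, cos_atan, sin_atan.
  unfold Rsqr. replace (1 + u * u) with (1 + u ^ 2) by ring.
  assert (Hr : sqrt (1 + u ^ 2) * sqrt (1 + u ^ 2) = 1 + u ^ 2) by (apply sqrt_sqrt; lra).
  assert (Hr0 : 0 < sqrt (1 + u ^ 2)) by now apply sqrt_lt_R0.
  set (r := sqrt (1 + u ^ 2)) in *.
  split.
  - replace (1 / r * (1 / r) - u / r * (u / r)) with ((1 - u ^ 2) / (r * r)) by (field; lra).
    rewrite Hr. replace (1 - u ^ 2) with (2 - (1 + u ^ 2)) by ring. rewrite Hu. field. lra.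
  - replace (2 * (u / r) * (1 / r)) with (2 * u / (r * r)) by (field; lra).
    rewrite Hr, Hu. unfold u. field. lra.
Qed.

Lemma harg_scale c X Y : 0 < c -> harg (c * X) (c * Y) = harg X Y.
Proof.
  intros H. unfold harg. f_equal. f_equal.
  replace ((c * X) ^ 2 + (c * Y) ^ 2) with (c * c * (X ^ 2 + Y ^ 2)) by ring.
  rewrite sqrt_mult by nra. rewrite sqrt_square by lra.
  rewrite <- Rmult_plus_distr_l. unfold Rdiv. rewrite Rinv_mult.
  rewrite (Rmult_comm c Y), Rmult_assoc, <- (Rmult_assoc c).
  rewrite Rinv_r by lra. now rewrite Rmult_1_l.
Qed.

Lemma is_derive_harg (X Y : R -> R) s X' Y' : (Y s = 0 -> 0 < X s) ->
  is_derive X s X' -> is_derive Y s Y' ->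
  is_derive (fun s => harg (X s) (Y s)) s ((X s * Y' - Y s * X') / (X s ^ 2 + Y s ^ 2)).
Proof.
  intros H HX HY. assert (Hp := norm_plus_pos _ _ H). assert (Hs := norm_sq_pos _ _ H).
  unfold harg.
  auto_derive.
  - replace (X s * (X s * 1) + Y s * (Y s * 1)) with (X s ^ 2 + Y s ^ 2) by ring.
    repeat split; try (eexists; eassumption); lra.
  - replace (Derive (fun x => X x) s) with X' by (symmetry; now apply is_derive_unique).
    replace (Derive (fun x => Y x) s) with Y' by (symmetry; now apply is_derive_unique).
    replace (X s * (X s * 1) + Y s * (Y s * 1)) with (X s ^ 2 + Y s ^ 2) by ring.
    assert (HN2 : sqrt (X s ^ 2 + Y s ^ 2) * sqrt (X s ^ 2 + Y s ^ 2) = X s ^ 2 + Y s ^ 2) by (apply sqrt_sqrt; lra).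
    assert (HN : 0 < sqrt (X s ^ 2 + Y s ^ 2)) by now apply sqrt_lt_R0.
    set (N := sqrt (X s ^ 2 + Y s ^ 2)) in *. clearbody N.
    set (x := X s) in *. set (y := Y s) in *. clearbody x y.
    unfold Rsqr.
    assert (E : 1 + y * / (N + x) * (y * / (N + x) * 1) = 2 * N / (N + x)).
    { apply Rmult_eq_reg_r with ((N + x) ^ 2); [|apply pow_nonzero; lra].
      field_simplify; [|lra|lra]. nra. }
    rewrite E. replace (x ^ 2 + y ^ 2) with (N * N).
    apply Rminus_diag_uniq.
    match goal with |- ?l = 0 =>
      replace l with ((N * N - (x ^ 2 + y ^ 2)) * Y' / (N ^ 2 * (N + x))) by (field; lra) end.
    rewrite HN2. unfold Rdiv. ring.
Qed.

Lemma Cn_on_harg n D X Y : open2 D -> (forall x y, D x y -> Y x y = 0 -> 0 < X x y) ->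
  Cn_on n D X -> Cn_on n D Y -> Cn_on n D (fun x y => harg (X x y) (Y x y)).
Proof.
  intros Ho H HX HY. unfold harg.
  assert (Hs : Cn_on n D (fun x y => sqrt (X x y ^ 2 + Y x y ^ 2))).
  { apply Cn_on_sqrt; auto; [|smooth]. intros x y Hd; apply norm_sq_pos; auto. }
  apply Cn_on_mult; [auto|now apply Cn_on_const|]. apply Cn_on_atan; auto.
  apply Cn_on_div; auto; [|smooth].
  intros x y Hd. generalize (norm_plus_pos (X x y) (Y x y) (H x y Hd)). lra.
Qed.

Lemma cos_sin_eq_mod a b : cos a = cos b -> sin a = sin b ->
  exists z : Z, b = a + IZR z * (2 * PI).
Proof.
  intros Hc Hs.
  assert (H : cos (b - a) = 1).
  { rewrite cos_minus, Hc, Hs. generalize (sin2_cos2 b). unfold Rsqr. lra. }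
  replace (b - a) with (2 * ((b - a) / 2)) in H by field.
  rewrite cos_2a_sin in H.
  assert (H0 : sin ((b - a) / 2) = 0) by nra.
  destruct (sin_eq_0_0 _ H0) as [z Hz]. exists z. lra.
Qed.

Lemma increment_lower (f f' : R -> R) lo : (forall x, is_derive f x (f' x)) ->
  (forall x, lo <= f' x) -> forall x y, x <= y -> lo * (y - x) <= f y - f x.
Proof.
  intros Hf Hlo x y Hxy.
  destruct (MVT_gen f x y f') as [c [_ Hc]].
  - intros; apply Hf.
  - intros; eapply is_derive_continuity_pt; apply Hf.
  - rewrite Hc. apply Rmult_le_compat_r; [lra|apply Hlo].
Qed.

(** The positive lower bound makes the primitive a bijection of the whole line. This is what makes
    the model geodesics complete: they solve [Th' = 1 / S (Th)] for all times. *)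
Lemma inverse_primitive (S : R -> R) lo : 0 < lo ->
  (forall x, continuous S x) -> (forall x, lo <= S x) ->
  exists Sig Th : R -> R,
    (forall x, is_derive Sig x (S x)) /\ (forall y, Sig (Th y) = y) /\
    (forall x, Th (Sig x) = x) /\ (forall y, is_derive Th y (/ S (Th y))).
Proof.
  intros Hlo Hc HS. set (Sig := fun x => RInt S 0 x).
  assert (Hd : forall x, is_derive Sig x (S x)).
  { intros x. apply (is_derive_RInt S Sig 0 x); auto.
    apply filter_forall. intros y. apply (RInt_correct S 0 y).
    apply (ex_RInt_continuous S). intros; auto. }
  assert (Hinc := increment_lower Sig S lo Hd HS).
  assert (Hsurj : forall y, {x | Sig x = y}).
  { intros y. set (b := (Rabs y + Rabs (Sig 0)) / lo + 1).
    assert (Hb : 0 < b).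
    { assert (0 <= (Rabs y + Rabs (Sig 0)) / lo).
      { apply Rdiv_le_0_compat; auto. generalize (Rabs_pos y) (Rabs_pos (Sig 0)); lra. }
      unfold b; lra. }
    assert (Hlb : lo * b = Rabs y + Rabs (Sig 0) + lo) by (unfold b; field; lra).
    destruct (Ranalysis5.IVT_interv (fun x => Sig x - y) (- b) b) as [z [_ Hz]].
    - intros x _. apply continuity_pt_minus.
      + eapply is_derive_continuity_pt; apply Hd.
      + apply continuity_pt_const. now intros u v.
    - lra.
    - assert (H := Hinc (- b) 0 ltac:(lra)).
      generalize (Rle_abs (Sig 0)) (Rle_abs (- y)). rewrite Rabs_Ropp. nra.
    - assert (H := Hinc 0 b ltac:(lra)).
      generalize (Rle_abs (- Sig 0)) (Rle_abs y). rewrite Rabs_Ropp. nra.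
    - exists z. lra. }
  set (Th := fun y => proj1_sig (Hsurj y)).
  assert (HT : forall y, Sig (Th y) = y) by (intros y; exact (proj2_sig (Hsurj y))).
  assert (HT2 : forall x, Th (Sig x) = x).
  { intros x. destruct (Rtotal_order (Th (Sig x)) x) as [L|[L|L]]; auto.
    - assert (H := Hinc _ _ (Rlt_le _ _ L)). rewrite HT in H. nra.
    - assert (H := Hinc _ _ (Rlt_le _ _ L)). rewrite HT in H. nra. }
  exists Sig, Th. refine (conj Hd (conj HT (conj HT2 _))).
  intros y. apply is_derive_Reals. intros eps Heps.
  assert (H1 := proj1 (is_derive_Reals _ _ _) (Hd (Th y))).
  set (l := S (Th y)) in *. assert (Hl : lo <= l) by apply HS.
  (* With [k] the increment of [Th], [k / h - 1 / l = - (h / k - l) (k / h) / l] and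
     [|k / h| <= 1 / lo]; the tolerance is chosen to absorb both factors. *)
  destruct (H1 (eps * lo * l)) as [d Hdd].
  { apply Rmult_lt_0_compat; [nra|lra]. }
  exists (mkposreal (d * lo) ltac:(apply Rmult_lt_0_compat; [apply cond_pos|lra])). simpl.
  intros h Hh Hhd.
  set (k := Th (y + h) - Th y).
  assert (Hk : Sig (Th y + k) - Sig (Th y) = h).
  { unfold k. replace (Th y + (Th (y + h) - Th y)) with (Th (y + h)) by ring.
    rewrite !HT. ring. }
  assert (Hk0 : k <> 0).
  { intros E. rewrite E, Rplus_0_r in Hk. lra. }
  assert (Hkh : lo * Rabs k <= Rabs h).
  { destruct (Rle_dec 0 k) as [P|P].
    - assert (H := Hinc (Th y) (Th y + k) ltac:(lra)). rewrite Hk in H.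
      rewrite Rabs_pos_eq by auto. generalize (Rle_abs h). nra.
    - assert (H := Hinc (Th y + k) (Th y) ltac:(lra)).
      rewrite Rabs_left by lra. generalize (Rle_abs (- h)). rewrite Rabs_Ropp. nra. }
  assert (Hkd : Rabs k < d).
  { apply Rmult_lt_reg_l with lo; auto. apply Rle_lt_trans with (1 := Hkh).
    rewrite Rmult_comm. exact Hhd. }
  specialize (Hdd k Hk0 Hkd). rewrite Hk in Hdd.
  fold k.
  replace (k / h - / l) with (- (h / k - l) * (k / h) * / l) by (field; repeat split; auto; lra).
  rewrite !Rabs_mult, Rabs_Ropp.
  assert (Hhp : 0 < Rabs h) by now apply Rabs_pos_lt.
  assert (Hkq : Rabs (k / h) <= / lo).
  { unfold Rdiv. rewrite Rabs_mult, Rabs_inv.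
    apply Rmult_le_reg_l with lo; auto. rewrite Rinv_r by lra.
    apply Rmult_le_reg_r with (Rabs h); auto.
    rewrite Rmult_1_l. replace (lo * (Rabs k * / Rabs h) * Rabs h) with (lo * Rabs k) by (field; lra).
    exact Hkh. }
  assert (Hil : 0 < / l) by (apply Rinv_0_lt_compat; lra).
  rewrite (Rabs_pos_eq (/ l)) by lra.
  assert (Hilo : 0 < / lo) by now apply Rinv_0_lt_compat.
  apply Rle_lt_trans with (Rabs (h / k - l) * / lo * / l).
  - apply Rmult_le_compat_r; [lra|]. apply Rmult_le_compat_l; [apply Rabs_pos|auto].
  - apply Rmult_lt_reg_r with (lo * l); [apply Rmult_lt_0_compat; lra|].
    replace (Rabs (h / k - l) * / lo * / l * (lo * l)) with (Rabs (h / k - l)) by (field; lra).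
    replace (eps * (lo * l)) with (eps * lo * l) by ring. exact Hdd.
Qed.

(** * Spacelike geodesics *)

(* The geodesics of Killing momentum [C] are parametrized by an angle [th] with
   [2 cos al (qf al t) = C sin (2 th)].  The vector [(C cos th, w2)] points in the
   direction [al], and [mm - Jm] is the second constant of motion; the suffix [m]
   marks the values of [Kf], [sf], [n] and of the coordinates along this curve. *)
Definition Km (C th : R) : R := twist 2 (cos th) (2 * C * cos th * sin th).
Definition Sm (C th : R) : R := 1 + C ^ 2 * cos th ^ 2 * sin th ^ 2 * Km C th.
Definition dJm (C th : R) : R := C ^ 2 * sin th ^ 2 * Km C th.
Definition Jm (C th : R) : R := RInt (dJm C) 0 th.
Definition mm (C M th : R) : R := M + Jm C th.
Definition w2 (C M th : R) : R := sin th + mm C M th * cos th.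
Definition nm (C M th : R) : R := (C ^ 2 * cos th ^ 2 + w2 C M th ^ 2) / C.
Definition Xm (C M th : R) : R := C * cos th ^ 2 + sin th * w2 C M th.
Definition Ym (C M th : R) : R := cos th * w2 C M th - C * cos th * sin th.
Definition alm (C M th : R) : R := th + harg (Xm C M th) (Ym C M th).
Definition tm (C M th : R) : R :=
  C * cos th * sin th - (cos th - mm C M th * sin th) * w2 C M th / C.

Lemma ex_derive_Km C th : ex_derive (Km C) th.
Proof.
  eexists. unfold Km.
  apply (is_derive_twist 2 cos (fun th => 2 * C * cos th * sin th) th
    (2 * C * (cos th * cos th - sin th * sin th))).
  - apply continuous_cos.
  - auto_derive; auto. ring.
  - intros E; rewrite E; lra.
Qed.

Lemma continuous_dJm C th : continuous (dJm C) th.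
Proof.
  apply (ex_derive_continuous (K := R_AbsRing) (V := R_NormedModule)).
  assert (H := ex_derive_Km C th). unfold dJm. auto_derive. auto.
Qed.

Lemma is_derive_Jm C th : is_derive (Jm C) th (dJm C th).
Proof.
  apply (is_derive_RInt (dJm C) (Jm C) 0 th).
  - apply filter_forall. intros y. apply (RInt_correct (dJm C) 0 y).
    apply (ex_RInt_continuous (dJm C)). intros; apply continuous_dJm.
  - apply continuous_dJm.
Qed.

Lemma Sm_lower C th : / 2 <= Sm C th.
Proof.
  unfold Sm, Km. assert (H := twist2_bound (cos th) (2 * C * cos th * sin th)).
  apply Rabs_le_between in H. nra.
Qed.

Lemma continuous_Sm C th : continuous (Sm C) th.
Proof.
  apply (ex_derive_continuous (K := R_AbsRing) (V := R_NormedModule)).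
  assert (H := ex_derive_Km C th). unfold Sm. auto_derive. auto.
Qed.

Lemma cos_sin_shift_PI x : cos (x + PI) = - cos x /\ sin (x + PI) = - sin x.
Proof. split; [apply neg_cos | apply neg_sin]. Qed.

(** A half-turn keeps [y = 2 C cos th sin th] and reverses the sign of [cos th]: the geodesic is
    then in the other half-plane with the same [y], which carries the opposite perturbation. *)
Lemma Km_shift C th : Km C (th + PI) = - Km C th.
Proof.
  unfold Km. destruct (cos_sin_shift_PI th) as [-> ->].
  replace (2 * C * - cos th * - sin th) with (2 * C * cos th * sin th) by ring.
  apply twist_opp. intros E; rewrite E; lra.
Qed.

Lemma derivative_zero_const (f : R -> R) : (forall x, is_derive f x 0) -> forall x y, f x = f y.
Proof.
  intros H x y. apply (is_derive_zero_const f m_infty p_infty); try easy; auto.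
Qed.

Lemma is_derive_shift (f : R -> R) c x l : is_derive f (x + c) l ->
  is_derive (fun x => f (x + c)) x l.
Proof.
  intros H. apply is_derive_eq with (1 * l); [|ring].
  apply (is_derive_comp f (fun x => x + c)); auto. auto_derive; auto.
Qed.

(** The integrand changes sign under a half-turn, so [Jm (th + PI) + Jm th] is constant; applying
    this twice gives period [2 PI]. It is the condition for the second constant of motion to produce
    a closed curve. *)
Lemma Jm_shift C th : Jm C (th + 2 * PI) = Jm C th.
Proof.
  assert (H : forall x, Jm C (x + PI) + Jm C x = Jm C (0 + PI) + Jm C 0).
  { intros x. apply (derivative_zero_const (fun x => Jm C (x + PI) + Jm C x)).
    intros y. apply is_derive_eq with (dJm C (y + PI) + dJm C y).
    - apply (is_derive_plus (fun x => Jm C (x + PI)) (Jm C)); [|apply is_derive_Jm].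
      apply is_derive_shift, is_derive_Jm.
    - unfold dJm. rewrite Km_shift. destruct (cos_sin_shift_PI y) as [_ ->]. ring. }
  replace (th + 2 * PI) with (th + PI + PI) by ring.
  generalize (H th) (H (th + PI)). lra.
Qed.

(** This is the sum condition on the four functions [s], in the form [Sm C (th + PI) + Sm C th = 2],
    after integration. *)
Lemma primitive_Sm_full_turn C (Sig : R -> R) th :
  (forall x, is_derive Sig x (2 * Sm C x)) -> Sig (th + 2 * PI) = Sig th + 4 * PI.
Proof.
  intros Hd.
  assert (H : forall x, Sig (x + PI) + Sig x - 4 * x = Sig (0 + PI) + Sig 0 - 4 * 0).
  { intros x. apply (derivative_zero_const (fun x => Sig (x + PI) + Sig x - 4 * x)).
    intros y. apply is_derive_eq with (2 * Sm C (y + PI) + 2 * Sm C y - 4).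
    - apply (is_derive_minus (fun x => Sig (x + PI) + Sig x) (fun x => 4 * x)).
      + apply (is_derive_plus (fun x => Sig (x + PI)) Sig); auto.
        apply is_derive_shift; auto.
      + auto_derive; auto. ring.
    - unfold Sm. rewrite Km_shift. destruct (cos_sin_shift_PI y) as [-> ->]. ring. }
  replace (th + 2 * PI) with (th + PI + PI) by ring.
  generalize (H th) (H (th + PI)). lra.
Qed.

Lemma alm_shift C M th : alm C M (th + 2 * PI) = alm C M th + 2 * PI.
Proof.
  unfold alm, Xm, Ym, w2, mm. rewrite Jm_shift.
  destruct (sin_cos_period th) as [-> ->]. ring.
Qed.

Lemma tm_shift C M th : tm C M (th + 2 * PI) = tm C M th.
Proof.
  unfold tm, w2, mm. rewrite Jm_shift. now destruct (sin_cos_period th) as [-> ->].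
Qed.

(** [(Xm, Ym)] is the vector [(C cos th, w2)] rotated by [- th]. As it never meets the slit of
    [harg], [alm] is a smooth lift of the argument that stays within [PI] of [th] and advances with
    it. *)
Lemma Xm_pos C M th : 0 < C -> Ym C M th = 0 -> 0 < Xm C M th.
Proof.
  intros HC. unfold Ym, Xm, w2. generalize (sincos1 th); intros H1 H.
  destruct (Req_dec (cos th) 0) as [E|E].
  - rewrite E in *. nra.
  - assert (E2 : sin th + mm C M th * cos th = C * sin th).
    { apply Rmult_eq_reg_l with (cos th); auto. lra. }
    rewrite E2. nra.
Qed.

Lemma Xm_Ym_norm C M th : Xm C M th ^ 2 + Ym C M th ^ 2 = C ^ 2 * cos th ^ 2 + w2 C M th ^ 2.
Proof.
  unfold Xm, Ym. generalize (sincos1 th). intros H.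
  replace (C ^ 2 * cos th ^ 2 + w2 C M th ^ 2) with
    ((C ^ 2 * cos th ^ 2 + w2 C M th ^ 2) * (sin th ^ 2 + cos th ^ 2)) by (rewrite H; ring).
  ring.
Qed.

Lemma nm_pos C M th : 0 < C -> 0 < nm C M th.
Proof.
  intros HC. unfold nm. rewrite <- Xm_Ym_norm. apply Rdiv_lt_0_compat; auto.
  apply norm_sq_pos. now apply Xm_pos.
Qed.

Definition Wm (C M th : R) : R := sqrt (C ^ 2 * cos th ^ 2 + w2 C M th ^ 2).

Lemma Wm_pos C M th : 0 < C -> 0 < Wm C M th.
Proof.
  intros HC. apply sqrt_lt_R0. rewrite <- Xm_Ym_norm. apply norm_sq_pos. now apply Xm_pos.
Qed.

Lemma Wm_sq C M th : 0 < C -> Wm C M th ^ 2 = C * nm C M th.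
Proof.
  intros HC. unfold Wm, nm. rewrite <- Rsqr_pow2, Rsqr_sqrt.
  - field. lra.
  - nra.
Qed.

Lemma cos_sin_alm C M th : 0 < C ->
  cos (alm C M th) = C * cos th / Wm C M th /\ sin (alm C M th) = w2 C M th / Wm C M th.
Proof.
  intros HC. destruct (cos_sin_harg _ _ (Xm_pos C M th HC)) as [Hc Hs].
  assert (HW := Wm_pos C M th HC).
  rewrite Xm_Ym_norm in Hc, Hs. fold (Wm C M th) in Hc, Hs.
  unfold alm. rewrite cos_plus, sin_plus, Hc, Hs. unfold Xm, Ym.
  generalize (sincos1 th); intros H1.
  split.
  - replace (C * cos th / Wm C M th) with (C * cos th * (sin th ^ 2 + cos th ^ 2) / Wm C M th)
      by (rewrite H1; field; lra). field. lra.
  - replace (w2 C M th / Wm C M th) with (w2 C M th * (sin th ^ 2 + cos th ^ 2) / Wm C M th)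
      by (rewrite H1; field; lra). field. lra.
Qed.

(** [w2] and [Lm] are [qf] and [rf] evaluated at the pair [(th, mm C M th)]. *)
Definition Lm (C M th : R) : R := cos th - mm C M th * sin th.

Lemma cos_Lm C M th : cos th * Lm C M th = 1 - sin th * w2 C M th.
Proof. unfold Lm, w2. generalize (sincos1 th). intros. nra. Qed.

Lemma qf_alm C M th : 0 < C -> qf (alm C M th) (tm C M th) = sin th * Wm C M th.
Proof.
  intros HC. unfold qf. destruct (cos_sin_alm C M th HC) as [-> ->].
  assert (HW := Wm_pos C M th HC). assert (HW2 := Wm_sq C M th HC).
  assert (HL := cos_Lm C M th).
  apply Rmult_eq_reg_r with (Wm C M th); [|lra].
  replace (sin th * Wm C M th * Wm C M th) with (sin th * Wm C M th ^ 2) by ring.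
  rewrite HW2. unfold tm, nm. fold (Lm C M th).
  replace ((C * cos th * sin th - Lm C M th * w2 C M th / C) * (C * cos th / Wm C M th) + w2 C M th / Wm C M th)
    with ((C ^ 2 * cos th ^ 2 * sin th - (cos th * Lm C M th) * w2 C M th + w2 C M th) / Wm C M th)
    by (field; lra).
  rewrite HL. field. lra.
Qed.

Lemma rf_alm C M th : 0 < C -> rf (alm C M th) (tm C M th) = Wm C M th * Lm C M th / C.
Proof.
  intros HC. unfold rf. destruct (cos_sin_alm C M th HC) as [-> ->].
  assert (HW := Wm_pos C M th HC). assert (HW2 := Wm_sq C M th HC).
  assert (HL := cos_Lm C M th).
  apply Rmult_eq_reg_r with (Wm C M th); [|lra].
  replace (Wm C M th * Lm C M th / C * Wm C M th) with (Wm C M th ^ 2 * Lm C M th / C) by (field; lra).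
  rewrite HW2. unfold tm, nm. fold (Lm C M th).
  replace ((C ^ 2 * cos th ^ 2 + w2 C M th ^ 2) / C) with (C * cos th ^ 2 + w2 C M th ^ 2 / C) by (field; lra).
  replace (C * (C * cos th ^ 2 + w2 C M th ^ 2 / C) * Lm C M th / C) with
    (C * cos th * (cos th * Lm C M th) + w2 C M th ^ 2 * Lm C M th / C) by (field; lra).
  rewrite HL. field. lra.
Qed.

Lemma Kf_alm C M th : 0 < C -> Kf (alm C M th) (tm C M th) = Km C th.
Proof.
  intros HC. unfold Kf. rewrite qf_alm by auto. destruct (cos_sin_alm C M th HC) as [-> _].
  assert (HW := Wm_pos C M th HC). unfold Km.
  replace (2 * (C * cos th / Wm C M th) * (sin th * Wm C M th)) with (2 * C * cos th * sin th)
    by (field; lra).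
  replace (C * cos th / Wm C M th) with (C / Wm C M th * cos th) by (field; lra).
  apply twist_scale. now apply Rdiv_lt_0_compat.
Qed.

Lemma sf_alm C M th : 0 < C -> sf (alm C M th) (tm C M th) = Sm C th.
Proof.
  intros HC. unfold sf. rewrite qf_alm, Kf_alm by auto.
  destruct (cos_sin_alm C M th HC) as [-> _].
  assert (HW := Wm_pos C M th HC). unfold Sm. field. lra.
Qed.

Lemma Ef_alm C M th : 0 < C -> Ef (alm C M th) (tm C M th) =
  4 * nm C M th * (C * sin th ^ 2 + Lm C M th ^ 2 / C
    + C * sin th ^ 2 * Km C th * (cos th * Lm C M th - sin th * w2 C M th)).
Proof.
  intros HC. unfold Ef, kf.
  assert (Ht : tm C M th ^ 2 + 1 = qf (alm C M th) (tm C M th) ^ 2 + rf (alm C M th) (tm C M th) ^ 2).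
  { unfold qf, rf. generalize (sincos1 (alm C M th)). intros H.
    replace (tm C M th ^ 2 + 1) with ((tm C M th ^ 2 + 1) * (sin (alm C M th) ^ 2 + cos (alm C M th) ^ 2))
      by (rewrite H; ring). ring. }
  rewrite Ht, qf_alm, rf_alm, Kf_alm by auto.
  destruct (cos_sin_alm C M th HC) as [-> ->].
  assert (HW := Wm_pos C M th HC). assert (HW2 := Wm_sq C M th HC).
  replace (nm C M th) with (Wm C M th ^ 2 / C) by (rewrite HW2; field; lra).
  field. lra.
Qed.

Lemma qKps_alm C M th : 0 < C ->
  qf (alm C M th) (tm C M th) ^ 2 * Kf (alm C M th) (tm C M th)
    * cos (alm C M th) * sin (alm C M th) = cos th * w2 C M th * dJm C th / C.
Proof.
  intros HC. rewrite qf_alm, Kf_alm by auto. destruct (cos_sin_alm C M th HC) as [-> ->].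
  assert (HW := Wm_pos C M th HC). unfold dJm. field. lra.
Qed.

Lemma is_derive_mm C M th : is_derive (mm C M) th (dJm C th).
Proof.
  apply is_derive_eq with (0 + dJm C th); [|ring].
  apply (is_derive_plus (fun _ => M) (Jm C)); [|apply is_derive_Jm].
  apply is_derive_cst.
Qed.

Lemma is_derive_w2 C M th : is_derive (w2 C M) th (Lm C M th + dJm C th * cos th).
Proof.
  assert (H := is_derive_mm C M th). unfold w2, Lm. auto_derive.
  - repeat split; eexists; eassumption.
  - replace (Derive (fun x => mm C M x) th) with (dJm C th)
      by (symmetry; now apply is_derive_unique). ring.
Qed.

Lemma is_derive_nm C M th : 0 < C -> is_derive (nm C M) th
  (- 2 * (tm C M th - cos th * w2 C M th * dJm C th / C)).
Proof.
  intros HC. assert (H := is_derive_w2 C M th). unfold nm. auto_derive.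
  - repeat split; try (eexists; eassumption).
  - replace (Derive (fun x => w2 C M x) th) with (Lm C M th + dJm C th * cos th)
      by (symmetry; now apply is_derive_unique).
    unfold tm. fold (Lm C M th). field. lra.
Qed.

Lemma is_derive_tm C M th : 0 < C -> is_derive (tm C M) th
  (nm C M th - Ef (alm C M th) (tm C M th) / (4 * nm C M th)).
Proof.
  intros HC. assert (H := is_derive_w2 C M th). assert (Hm := is_derive_mm C M th).
  rewrite Ef_alm by auto. assert (Hn := nm_pos C M th HC).
  unfold tm at 1. auto_derive.
  - repeat split; try (eexists; eassumption).
  - replace (Derive (fun x => w2 C M x) th) with (Lm C M th + dJm C th * cos th)
      by (symmetry; now apply is_derive_unique).
    replace (Derive (fun x => mm C M x) th) with (dJm C th)
      by (symmetry; now apply is_derive_unique).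
    match goal with |- _ = nm C M th - 4 * nm C M th * ?z / (4 * nm C M th) =>
      replace (4 * nm C M th * z / (4 * nm C M th)) with z by (field; lra) end.
    unfold nm, dJm, w2, Lm. field. lra.
Qed.

Lemma is_derive_alm C M th : 0 < C -> is_derive (alm C M) th (Sm C th / nm C M th).
Proof.
  intros HC. assert (H := is_derive_w2 C M th).
  assert (Hn := nm_pos C M th HC).
  set (w' := Lm C M th + dJm C th * cos th) in *.
  assert (HX : is_derive (Xm C M) th (- 2 * C * cos th * sin th + cos th * w2 C M th + sin th * w')).
  { unfold Xm. auto_derive.
    - repeat split; try (eexists; eassumption).
    - replace (Derive (fun x => w2 C M x) th) with w' by (symmetry; now apply is_derive_unique). ring. }
  assert (HY : is_derive (Ym C M) th (- sin th * w2 C M th + cos th * w' - C * (cos th ^ 2 - sin th ^ 2))).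
  { unfold Ym. auto_derive.
    - repeat split; try (eexists; eassumption).
    - replace (Derive (fun x => w2 C M x) th) with w' by (symmetry; now apply is_derive_unique). ring. }
  assert (HA := is_derive_harg _ _ th _ _ (Xm_pos C M th HC) HX HY).
  eapply is_derive_eq.
  { apply (is_derive_plus (fun x => x) (fun s => harg (Xm C M s) (Ym C M s)) th 1); [|exact HA].
    auto_derive; auto. }
  rewrite Xm_Ym_norm.
  replace (C ^ 2 * cos th ^ 2 + w2 C M th ^ 2) with (C * nm C M th) by (unfold nm; field; lra).
  unfold plus; simpl.
  apply Rmult_eq_reg_r with (C * nm C M th); [|nra].
  field_simplify; [|lra|lra].
  assert (HL := cos_Lm C M th). assert (H1 := sincos1 th).
  replace (C * nm C M th) with (C ^ 2 * cos th ^ 2 + w2 C M th ^ 2) by (unfold nm; field; lra).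
  assert (E : C * Sm C th = C * cos th * w' + C * sin th * w2 C M th).
  { unfold w', Sm. unfold dJm.
    replace (C * cos th * (Lm C M th + C ^ 2 * sin th ^ 2 * Km C th * cos th)) with
      (C * (cos th * Lm C M th) + C * (C ^ 2 * sin th ^ 2 * Km C th * cos th ^ 2)) by ring.
    rewrite HL. ring. }
  match goal with |- _ = ?r => replace r with (C * Sm C th) by ring end.
  rewrite E.
  replace (C * cos th * w' + C * sin th * w2 C M th) with
    ((C * cos th * w' + C * sin th * w2 C M th) * (sin th ^ 2 + cos th ^ 2)) by (rewrite H1; ring).
  replace (C ^ 2 * cos th ^ 2 + w2 C M th ^ 2) with
    ((C ^ 2 * cos th ^ 2 + w2 C M th ^ 2) * (sin th ^ 2 + cos th ^ 2)) by (rewrite H1; ring).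
  unfold Xm, Ym. ring.
Qed.

(* The spacelike geodesic with Killing momentum [C] and phase [M], traversed at
   speed [v]. *)
Lemma model_geodesic C M v (ph : R -> R) : 0 < C -> v <> 0 ->
  (forall s, is_derive ph s (v / (2 * Sm C (ph s)))) ->
  geodesic zoll_cyl m_infty p_infty (fun s => (alm C M (ph s), tm C M (ph s))) /\
  forall s, speed2 zoll_cyl (fun s => (alm C M (ph s), tm C M (ph s))) s = v ^ 2.
Proof.
  intros HC Hv Hp.
  apply (geodesic_of_energy (fun s => alm C M (ph s)) (fun s => tm C M (ph s))
    (fun s => v / (2 * nm C M (ph s))) (v ^ 2)).
  - intros s. generalize (nm_pos C M (ph s) HC). intros Hn. unfold Rdiv.
    apply Rmult_integral_contrapositive; split; auto. apply Rinv_neq_0_compat. lra.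
  - intros s. generalize (nm_pos C M (ph s) HC) (Sm_lower C (ph s)); intros Hn HS.
    eapply is_derive_eq.
    { apply (is_derive_comp (alm C M) ph); [now apply is_derive_alm|apply Hp]. }
    unfold scal; simpl; unfold mult; simpl. field. lra.
  - intros s. generalize (nm_pos C M (ph s) HC) (Sm_lower C (ph s)); intros Hn HS.
    rewrite qKps_alm, sf_alm by auto.
    assert (H : is_derive (fun s => nm C M (ph s)) s
      (v / (2 * Sm C (ph s)) * (- 2 * (tm C M (ph s) - cos (ph s) * w2 C M (ph s) * dJm C (ph s) / C)))).
    { apply (is_derive_comp (nm C M) ph); [now apply is_derive_nm|apply Hp]. }
    set (N := fun s => nm C M (ph s)) in *.
    change (is_derive (fun s => v / (2 * N s)) s
      (2 * (v / (2 * N s)) ^ 2 / Sm C (ph s) *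
       (tm C M (ph s) - cos (ph s) * w2 C M (ph s) * dJm C (ph s) / C))).
    change (0 < N s) in Hn.
    auto_derive.
    + repeat split; [eexists; eassumption | lra].
    + match type of H with is_derive _ _ ?l => replace (Derive (fun x => N x) s) with l
        by (symmetry; now apply is_derive_unique) end.
      field. lra.
  - intros s. generalize (nm_pos C M (ph s) HC) (Sm_lower C (ph s)); intros Hn HS.
    eapply is_derive_eq.
    { apply (is_derive_comp (tm C M) ph); [now apply is_derive_tm|apply Hp]. }
    unfold scal; simpl; unfold mult; simpl. unfold Ff. rewrite sf_alm by auto. field. lra.
Qed.

(** * Conserved quantities along an arbitrary spacelike geodesic *)

Lemma in_itv_nonempty a b : Rbar_lt a b -> exists s0, in_itv a b s0.
Proof.
  intros Hab. destruct a as [a| |], b as [b| |]; simpl in Hab; try easy.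
  - exists ((a + b) / 2); split; simpl; lra.
  - exists (a + 1); split; simpl; auto; lra.
  - exists (b - 1); split; simpl; auto; lra.
  - exists 0; split; simpl; auto.
Qed.

(* Noether's identity for the Killing momentum [n p^2 + q^2 / n], and the
   evolution of the phase [n p sin al - q r / n]. *)
Lemma momentum_identities c sn y K n v :
  sn ^ 2 = 1 - c ^ 2 -> n <> 0 ->
  let q := y * c + sn in let r := c - y * sn in let S := 1 + c ^ 2 * q ^ 2 * K in
  let x' := v / (2 * n) in
  let y' := v / (2 * S) * (n - 4 * (y ^ 2 + 1 + q ^ 2 * K * (c * r - q * sn)) / (4 * n)) in
  let n' := - (v / S) * (y - q ^ 2 * K * c * sn) in
  let q' := y' * c + r * x' in
  S <> 0 ->
  n' * c ^ 2 - 2 * n * c * sn * x' + 2 * q * q' / n - q ^ 2 * n' / n ^ 2 = 0 /\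
  n' * c * sn + n * (c ^ 2 - sn ^ 2) * x' + q * r * n' / n ^ 2
    - (q' * r + q * (- q * x' - y' * sn)) / n
  = v / (2 * S) * ((n * c ^ 2 + q ^ 2 / n) * q ^ 2 * K / n).
Proof.
  intros H Hn q r S x' y' n' q' HS.
  unfold q', n', y', x', S, r, q in *.
  assert (HS' : 1 + (c * (y * c + sn)) ^ 2 * K <> 0).
  { intros E; apply HS; rewrite <- E; ring. }
  split; (field_simplify_eq; [ring [H] | split; auto]).
Qed.

Lemma momentum_pos c sn y n : sn ^ 2 + c ^ 2 = 1 -> 0 < n ->
  0 < n * c ^ 2 + (y * c + sn) ^ 2 / n.
Proof.
  intros H Hn.
  assert (H1 : 0 <= n * c ^ 2) by (apply Rmult_le_pos; [lra|apply pow2_ge_0]).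
  assert (H2 : 0 <= (y * c + sn) ^ 2 / n) by (apply Rdiv_le_0_compat; [apply pow2_ge_0|auto]).
  destruct (Req_dec c 0) as [E|E].
  - assert (0 < (y * c + sn) ^ 2 / n); [|lra].
    apply Rdiv_lt_0_compat; auto. rewrite E in *. nra.
  - assert (0 < n * c ^ 2); [|lra]. apply Rmult_lt_0_compat; auto. nra.
Qed.

(** The momentum gives [C], the phase corrected by [Jm] gives [M], both having zero derivative. The
    position is then recovered algebraically from [C], [M] and the angle [th], so the geodesic is
    literally a piece of a model curve. *)
Lemma spacelike_geodesic_model a b c :
  geodesic zoll_cyl a b c -> spacelike zoll_cyl a b c ->
  exists (C M v : R) (th : R -> R), 0 < C /\ v <> 0 /\
    forall s, in_itv a b s ->
      c s = (alm C M (th s), tm C M (th s)) /\ is_derive th s (v / (2 * Sm C (th s))).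
Proof.
  intros Hg Hsp.
  destruct (in_itv_nonempty a b (proj1 Hg)) as [s0 Hs0].
  destruct (spacelike_geodesic_system a b c Hg Hsp) as [v [n [Hv Hsys]]].
  set (x := fun s => fst (c s)). set (y := fun s => snd (c s)).
  set (q := fun s => qf (x s) (y s)). set (r := fun s => rf (x s) (y s)).
  set (Cf := fun s => n s * cos (x s) ^ 2 + q s ^ 2 / n s).
  set (mf := fun s => n s * cos (x s) * sin (x s) - q s * r s / n s).
  assert (HCf0 : forall s, in_itv a b s -> 0 < Cf s).
  { intros s Hs. destruct (Hsys s Hs) as [Hn _]. apply momentum_pos; auto. apply sincos1. }
  assert (HD : forall s, in_itv a b s -> is_derive Cf s 0 /\
     is_derive mf s (v / (2 * sf (x s) (y s)) * (Cf s * q s ^ 2 * Kf (x s) (y s) / n s))).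
  { intros s Hs. destruct (Hsys s Hs) as [Hn [Hx [Hy Hn']]].
    fold x in Hx. fold y in Hy. cbv zeta in *. fold (x s) (y s) in *.
    assert (HS := sf_pos (x s) (y s)).
    destruct (momentum_identities (cos (x s)) (sin (x s)) (y s) (Kf (x s) (y s)) (n s) v) as [I1 I2].
    { generalize (sincos1 (x s)); lra. }
    { lra. }
    { fold (qf (x s) (y s)). fold (sf (x s) (y s)). lra. }
    fold (qf (x s) (y s)) in I1, I2. fold (rf (x s) (y s)) in I1, I2.
    fold (sf (x s) (y s)) in I1, I2. fold (kf (x s) (y s)) in I1, I2.
    fold (Ef (x s) (y s)) in I1, I2.
    set (x' := v / (2 * n s)) in *.
    set (y' := v / (2 * sf (x s) (y s)) * (n s - Ef (x s) (y s) / (4 * n s))) in *.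
    set (n' := - (v / sf (x s) (y s)) * (y s - qf (x s) (y s) ^ 2 * Kf (x s) (y s) * cos (x s) * sin (x s))) in *.
    assert (Ex : Derive (fun u => x u) s = x') by now apply is_derive_unique.
    assert (Ey : Derive (fun u => y u) s = y') by now apply is_derive_unique.
    assert (En : Derive (fun u => n u) s = n') by now apply is_derive_unique.
    split.
    - rewrite <- I1. unfold Cf, q, qf, rf. auto_derive.
      + repeat split; first [eexists; eassumption | lra].
      + rewrite Ex, Ey, En. unfold qf, rf. field. lra.
    - unfold Cf, q, r. rewrite <- I2. unfold mf, q, r, qf, rf. auto_derive.
      + repeat split; first [eexists; eassumption | lra].
      + rewrite Ex, Ey, En. field. lra. }
  assert (HCc := is_derive_zero_const Cf a b (fun s Hs => proj1 (HD s Hs))).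
  set (C := Cf s0). assert (HC : 0 < C) by now apply HCf0.
  assert (HCs : forall s, in_itv a b s -> Cf s = C) by (intros; now apply HCc).
  set (W := fun s => sqrt (C * n s)).
  assert (HW : forall s, in_itv a b s -> 0 < W s /\ W s * W s = C * n s).
  { intros s Hs. destruct (Hsys s Hs) as [Hn _]. unfold W. split.
    - apply sqrt_lt_R0. nra.
    - apply sqrt_sqrt. nra. }
  (* Conservation of the momentum says exactly [A^2 + B^2 = 1], and [A], [B] are to be [cos th],
     [sin th]. The pair [(X, Y)] below is the vector with angle [x - th], which avoids the slit of
     [harg]. *)
  set (A := fun s => W s * cos (x s) / C). set (B := fun s => q s / W s).
  set (X := fun s => A s * cos (x s) + B s * sin (x s)).
  set (Y := fun s => A s * sin (x s) - B s * cos (x s)).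
  (* This lift of the angle of [(A, B)] needs no choice of a branch. *)
  set (th := fun s => x s - harg (X s) (Y s)).
  assert (HAB : forall s, in_itv a b s -> A s ^ 2 + B s ^ 2 = 1).
  { intros s Hs. destruct (HW s Hs) as [W0 W2]. destruct (Hsys s Hs) as [Hn _].
    unfold A, B. assert (HE := HCs s Hs). unfold Cf in HE.
    replace ((W s * cos (x s) / C) ^ 2 + (q s / W s) ^ 2) with
      ((W s * W s) * cos (x s) ^ 2 / C ^ 2 + q s ^ 2 / (W s * W s)) by (field; lra).
    rewrite W2. replace (C * n s * cos (x s) ^ 2 / C ^ 2 + q s ^ 2 / (C * n s)) with
      ((n s * cos (x s) ^ 2 + q s ^ 2 / n s) / C) by (field; lra).
    rewrite HE. field. lra. }
  assert (HXY : forall s, in_itv a b s -> X s ^ 2 + Y s ^ 2 = 1).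
  { intros s Hs. unfold X, Y. rewrite <- (HAB s Hs).
    replace (A s ^ 2 + B s ^ 2) with ((A s ^ 2 + B s ^ 2) * (sin (x s) ^ 2 + cos (x s) ^ 2))
      by (rewrite sincos1; ring). ring. }
  assert (HXp : forall s, in_itv a b s -> Y s = 0 -> 0 < X s).
  { intros s Hs E. destruct (HW s Hs) as [W0 W2].
    assert (EA : A s = X s * cos (x s)).
    { replace (A s) with (A s * (sin (x s) ^ 2 + cos (x s) ^ 2)) by (rewrite sincos1; ring).
      unfold X. replace (A s * (sin (x s) ^ 2 + cos (x s) ^ 2)) with
        (A s * sin (x s) * sin (x s) + A s * cos (x s) ^ 2) by ring.
      replace (A s * sin (x s)) with (B s * cos (x s)) by (unfold Y in E; lra). ring. }
    destruct (Req_dec (cos (x s)) 0) as [E0|E0].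
    - assert (H1 := sincos1 (x s)).
      unfold X, A, B. rewrite E0. unfold q, qf. rewrite E0 in *.
      replace (W s * 0 / C * 0 + (y s * 0 + sin (x s)) / W s * sin (x s)) with
        (sin (x s) ^ 2 / W s) by (field; lra).
      apply Rdiv_lt_0_compat; nra.
    - assert (EX : X s = W s / C).
      { apply Rmult_eq_reg_r with (cos (x s)); auto. rewrite <- EA. unfold A. field. lra. }
      rewrite EX. now apply Rdiv_lt_0_compat. }
  assert (Hth : forall s, in_itv a b s -> cos (th s) = A s /\ sin (th s) = B s).
  { intros s Hs. destruct (cos_sin_harg _ _ (HXp s Hs)) as [Hc Hsn].
    rewrite (HXY s Hs), sqrt_1 in Hc, Hsn.
    unfold th. rewrite cos_minus, sin_minus, Hc, Hsn. unfold X, Y.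
    split.
    - transitivity (A s * (sin (x s) ^ 2 + cos (x s) ^ 2)); [field | rewrite sincos1; ring].
    - transitivity (B s * (sin (x s) ^ 2 + cos (x s) ^ 2)); [field | rewrite sincos1; ring]. }
  assert (HKm : forall s, in_itv a b s -> Km C (th s) = Kf (x s) (y s)).
  { intros s Hs. destruct (HW s Hs) as [W0 W2]. destruct (Hth s Hs) as [Ec Es].
    unfold Km, Kf. rewrite Ec, Es. unfold A, B.
    replace (2 * C * (W s * cos (x s) / C) * (q s / W s)) with (2 * cos (x s) * qf (x s) (y s))
      by (unfold q; field; lra).
    replace (W s * cos (x s) / C) with (W s / C * cos (x s)) by (field; lra).
    apply twist_scale. now apply Rdiv_lt_0_compat. }
  assert (HSm : forall s, in_itv a b s -> Sm C (th s) = sf (x s) (y s)).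
  { intros s Hs. destruct (HW s Hs) as [W0 W2]. destruct (Hth s Hs) as [Ec Es].
    unfold Sm, sf. rewrite HKm, Ec, Es by auto. unfold A, B. fold (q s). field. lra. }
  assert (Hth' : forall s, in_itv a b s -> is_derive th s (v / (2 * Sm C (th s)))).
  { intros s Hs. destruct (HW s Hs) as [W0 W2]. destruct (Hsys s Hs) as [Hn [Hx [Hy Hn']]].
    fold x in Hx. fold y in Hy. cbv zeta in *. fold (x s) (y s) in *.
    assert (HS := sf_pos (x s) (y s)). rewrite HSm by auto.
    set (x' := v / (2 * n s)) in *.
    set (y' := v / (2 * sf (x s) (y s)) * (n s - Ef (x s) (y s) / (4 * n s))) in *.
    set (n' := - (v / sf (x s) (y s)) * (y s - qf (x s) (y s) ^ 2 * Kf (x s) (y s) * cos (x s) * sin (x s))) in *.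
    assert (Ex : Derive (fun u => x u) s = x') by now apply is_derive_unique.
    assert (Ey : Derive (fun u => y u) s = y') by now apply is_derive_unique.
    assert (En : Derive (fun u => n u) s = n') by now apply is_derive_unique.
    set (w := v / (2 * sf (x s) (y s))).
    assert (HW' : is_derive W s (W s * n' / (2 * n s))).
    { unfold W. auto_derive.
      - repeat split; first [eexists; eassumption | nra].
      - rewrite En. fold (W s). replace (2 * n s) with (2 * (W s * W s) / C) by (rewrite W2; field; lra).
        field. lra. }
    assert (EW : Derive (fun u => W u) s = W s * n' / (2 * n s)) by now apply is_derive_unique.
    assert (HA' : is_derive A s (- w * B s)).
    { unfold A. auto_derive.
      - repeat split; first [eexists; eassumption | lra].
      - rewrite Ex, EW. unfold B, w, x', n', q.
        replace (qf (x s) (y s) / W s) with (qf (x s) (y s) * W s / (C * n s))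
          by (rewrite <- W2; field; lra).
        unfold sf in HS |- *. unfold qf in *. field. repeat split; lra. }
    assert (HB' : is_derive B s (w * A s)).
    { unfold B, q, qf. auto_derive.
      - repeat split; first [eexists; eassumption | lra].
      - rewrite Ex, Ey, EW. unfold A, w, x', n', y'.
        replace (W s * cos (x s) / C) with (n s * cos (x s) / W s)
          by (replace (n s) with (W s * W s / C) by (rewrite W2; field; lra); field; lra).
        unfold Ef, kf, rf. fold (qf (x s) (y s)).
        assert (H1 := sincos1 (x s)).
        assert (H2 : sin (x s) ^ 2 = 1 - cos (x s) ^ 2) by lra.
        unfold sf in HS |- *. unfold qf in *.
        apply Rmult_eq_reg_r with (W s); [|lra].
        field_simplify_eq.
        + ring [H2].
        + repeat split; lra. }
    assert (EA : Derive (fun u => A u) s = - w * B s) by now apply is_derive_unique.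
    assert (EB : Derive (fun u => B u) s = w * A s) by now apply is_derive_unique.
    assert (HX' : is_derive X s (- w * B s * cos (x s) - A s * sin (x s) * x' + w * A s * sin (x s) + B s * cos (x s) * x')).
    { unfold X. auto_derive.
      - repeat split; first [eexists; eassumption | lra].
      - rewrite Ex, EA, EB. ring. }
    assert (HY' : is_derive Y s (- w * B s * sin (x s) + A s * cos (x s) * x' - w * A s * cos (x s) + B s * sin (x s) * x')).
    { unfold Y. auto_derive.
      - repeat split; first [eexists; eassumption | lra].
      - rewrite Ex, EA, EB. ring. }
    eapply is_derive_eq.
    { apply (is_derive_minus x (fun s => harg (X s) (Y s))); [exact Hx|].
      apply (is_derive_harg X Y s _ _ (HXp s Hs) HX' HY'). }
    rewrite (HXY s Hs). unfold minus, plus, opp; simpl. fold w.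
    assert (H1 := sincos1 (x s)). assert (H2 := HAB s Hs).
    unfold X, Y.
    match goal with |- _ + - (?z / 1) = _ => replace z with
      ((x' - w) * (A s ^ 2 + B s ^ 2) * (sin (x s) ^ 2 + cos (x s) ^ 2)) by ring end.
    rewrite H1, H2. field. }
  assert (HM : forall s, in_itv a b s -> is_derive (fun s => mf s - Jm C (th s)) s 0).
  { intros s Hs. destruct (HW s Hs) as [W0 W2]. destruct (Hsys s Hs) as [Hn _].
    destruct (Hth s Hs) as [Ec Es]. assert (HS := sf_pos (x s) (y s)).
    eapply is_derive_eq.
    { apply (is_derive_minus mf (fun s => Jm C (th s))); [apply HD; auto|].
      apply (is_derive_comp (Jm C) th); [apply is_derive_Jm|now apply Hth']. }
    unfold minus, plus, opp, scal; simpl; unfold mult; simpl. unfold dJm.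
    rewrite HSm, HKm, HCs, Es by auto. unfold B.
    replace ((q s / W s) ^ 2) with (q s ^ 2 / (C * n s)) by (rewrite <- W2; field; lra).
    field. lra. }
  set (M := mf s0 - Jm C (th s0)).
  assert (HMs : forall s, in_itv a b s -> mf s = mm C M (th s)).
  { intros s Hs. assert (H := is_derive_zero_const _ a b HM s s0 Hs Hs0). simpl in H.
    unfold mm, M. lra. }
  exists C, M, v, th. refine (conj HC (conj Hv _)). intros s H.
  refine (conj _ (Hth' s H)).
  destruct (HW s H) as [W0 W2]. destruct (Hsys s H) as [Hn _].
  destruct (Hth s H) as [Ec Es].
  assert (Hw2 : w2 C M (th s) = W s * sin (x s)).
  { unfold w2. rewrite <- HMs, Ec, Es by auto. unfold mf, A, B.
    assert (HE := HCs s H). unfold Cf in HE.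
    assert (Hqr := qf_rf (x s) (y s)). fold (q s) (r s) in Hqr.
    apply Rmult_eq_reg_r with (C * W s); [|nra].
    replace ((q s / W s + (n s * cos (x s) * sin (x s) - q s * r s / n s) * (W s * cos (x s) / C)) * (C * W s))
      with (C * q s + (n s * cos (x s) * sin (x s) - q s * r s / n s) * cos (x s) * (W s * W s))
      by (field; lra).
    replace (W s * sin (x s) * (C * W s)) with (sin (x s) * C * (W s * W s)) by ring.
    rewrite W2. rewrite <- HE at 3.
    replace (C * q s) with (C * q s * (q s * sin (x s) + r s * cos (x s))) by (rewrite Hqr; ring).
    field. lra. }
  assert (HL : Lm C M (th s) = C * r s / W s).
  { unfold Lm. rewrite <- HMs, Ec, Es by auto. unfold mf, A, B.
    assert (HE := HCs s H). unfold Cf in HE.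
    assert (Hqr := qf_rf (x s) (y s)). fold (q s) (r s) in Hqr.
    apply Rmult_eq_reg_r with (C * W s); [|nra].
    replace ((W s * cos (x s) / C - (n s * cos (x s) * sin (x s) - q s * r s / n s) * (q s / W s)) * (C * W s))
      with (cos (x s) * (W s * W s) - C * (n s * cos (x s) * sin (x s) - q s * r s / n s) * q s)
      by (field; lra).
    replace (C * r s / W s * (C * W s)) with (C * r s * C) by (field; lra).
    rewrite W2. rewrite <- HE at 4.
    replace (cos (x s) * (C * n s)) with (C * n s * cos (x s) * (q s * sin (x s) + r s * cos (x s))) by (rewrite Hqr; ring).
    field. lra. }
  rewrite (surjective_pairing (c s)). f_equal.
  - unfold alm.
    replace (Xm C M (th s)) with (W s * X s).
    2:{ unfold Xm. rewrite Hw2, Ec, Es. unfold X, A. field. lra. }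
    replace (Ym C M (th s)) with (W s * Y s).
    2:{ unfold Ym. rewrite Hw2, Ec, Es. unfold Y, A. field. lra. }
    rewrite harg_scale by auto. unfold th. fold (x s). ring.
  - unfold tm. fold (Lm C M (th s)). rewrite Hw2, HL, Ec, Es. fold (y s).
    unfold A, B.
    replace (C * (W s * cos (x s) / C) * (q s / W s) - C * r s / W s * (W s * sin (x s)) / C)
      with (q s * cos (x s) - r s * sin (x s)) by (field; lra).
    unfold q, r, qf, rf.
    replace (y s) with (y s * (sin (x s) ^ 2 + cos (x s) ^ 2)) at 1 by (rewrite sincos1; ring).
    ring.
Qed.

(** * Closedness, completeness and common length *)

Lemma strictly_increasing_of_derive (f f' : R -> R) : (forall x, is_derive f x (f' x)) ->
  (forall x, 0 < f' x) -> forall x y, x < y -> f x < f y.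
Proof.
  intros Hf Hp x y Hxy. destruct (MVT_gen f x y f') as [c [_ Hc]].
  - intros; apply Hf.
  - intros; eapply is_derive_continuity_pt; apply Hf.
  - specialize (Hp c). nra.
Qed.

Lemma alm_increasing C M : 0 < C -> forall x y, x < y -> alm C M x < alm C M y.
Proof.
  intros HC. apply (strictly_increasing_of_derive _ (fun x => Sm C x / nm C M x)).
  - intros; now apply is_derive_alm.
  - intros x. apply Rdiv_lt_0_compat; [|now apply nm_pos]. generalize (Sm_lower C x); lra.
Qed.

Lemma IZR_eq_0_of_small z : Rabs (IZR z) < 1 -> z = 0%Z.
Proof.
  intros H. apply Rabs_def2 in H. destruct H as [H1 H2].
  apply lt_IZR in H1. replace (- (1)) with (IZR (-1)) in H2 by (simpl; lra). apply lt_IZR in H2. lia.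
Qed.

(** Over one period [th] changes by [2 PI] in absolute value, and so does [alm], which is strictly
    monotone; hence the curve cannot come back earlier, whatever [t] does. *)
Lemma model_simply_closed C M v (Sig ph : R -> R) lam : 0 < C -> v <> 0 ->
  (forall x, is_derive Sig x (2 * Sm C x)) ->
  (forall s, Sig (ph s) = v * s + lam) ->
  simply_closed zoll_cyl (fun s => (alm C M (ph s), tm C M (ph s))) (4 * PI / Rabs v).
Proof.
  intros HC Hv HS Hph. assert (Hpi := PI_RGT_0).
  assert (Hav : 0 < Rabs v) by now apply Rabs_pos_lt.
  assert (Hmono : forall x y, x < y -> Sig x < Sig y).
  { apply (strictly_increasing_of_derive Sig (fun x => 2 * Sm C x)); auto.
    intros x; generalize (Sm_lower C x); lra. }
  assert (Hinj : forall x y, Sig x = Sig y -> x = y).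
  { intros x y E. destruct (Rtotal_order x y) as [L|[L|L]]; auto.
    - apply Hmono in L; lra.
    - apply Hmono in L; lra. }
  assert (Hper := primitive_Sm_full_turn C Sig).
  set (T := 4 * PI / Rabs v).
  assert (HT : 0 < T) by (apply Rdiv_lt_0_compat; lra).
  assert (HvT : Rabs v * T = 4 * PI) by (unfold T; field; lra).
  split; [exact HT|split].
  - intros s. unfold same_pt. destruct (Rlt_le_dec 0 v) as [Hp|Hn].
    + rewrite Rabs_pos_eq in HvT by lra.
      assert (E : ph (s + T) = ph s + 2 * PI).
      { apply Hinj. rewrite Hper, !Hph by auto. lra. }
      exists 1%Z. rewrite E, alm_shift, tm_shift. simpl. f_equal. ring.
    + rewrite Rabs_left in HvT by lra.
      assert (E : ph s = ph (s + T) + 2 * PI).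
      { apply Hinj. rewrite Hper, !Hph by auto. lra. }
      exists (-1)%Z. rewrite E, alm_shift, tm_shift. simpl. f_equal. ring.
  - intros s s' Hs Hs' [z Hz]. simpl in Hz. injection Hz as Hz _.
    assert (Hlt : forall s s', 0 <= s < T -> 0 <= s' < T -> alm C M (ph s') < alm C M (ph s) + 2 * PI).
    { clear s s' Hs Hs' Hz. intros s s' Hs Hs'. rewrite <- alm_shift. apply alm_increasing; auto.
      destruct (Rlt_le_dec (ph s') (ph s + 2 * PI)) as [L|L]; auto. exfalso.
      assert (L2 : Sig (ph s + 2 * PI) <= Sig (ph s')).
      { destruct L as [L|L]; [apply Hmono in L; lra|rewrite L; lra]. }
      rewrite Hper, !Hph in L2 by auto.
      assert (H : v * (s' - s) < 4 * PI).
      { rewrite <- HvT. destruct (Rlt_le_dec 0 v).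
        - rewrite Rabs_pos_eq by lra. nra.
        - rewrite Rabs_left by lra. nra. }
      lra. }
    assert (L1 := Hlt s s' Hs Hs'). assert (L2 := Hlt s' s Hs' Hs).
    assert (z0 : z = 0%Z).
    { apply IZR_eq_0_of_small. apply Rabs_def1; nra. }
    subst z. rewrite Rmult_0_l, Rplus_0_r in Hz.
    assert (E : ph s = ph s').
    { destruct (Rtotal_order (ph s) (ph s')) as [L|[L|L]]; auto;
        apply (alm_increasing C M HC) in L; lra. }
    assert (Hs1 := Hph s). assert (Hs2 := Hph s'). rewrite <- E, Hs1 in Hs2.
    apply Rmult_eq_reg_l with v; auto. lra.
Qed.

Lemma zoll_cyl_zoll : spacelike_zoll_cylinder zoll_cyl.
Proof.
  split; [apply zoll_cyl_lorentzian|].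
  exists (4 * PI). intros a b c [Hg Hmax] Hsp.
  destruct (spacelike_geodesic_model a b c Hg Hsp) as [C [M [v [th [HC [Hv Hth]]]]]].
  destruct (inverse_primitive (fun x => 2 * Sm C x) 1) as [Sig [Th [HS [HST [HTS HT]]]]].
  { lra. }
  { intros x. apply (continuous_scal_r (K := R_AbsRing) (V := R_NormedModule) 2 (Sm C)).
    apply continuous_Sm. }
  { intros x; generalize (Sm_lower C x); lra. }
  destruct (in_itv_nonempty a b (proj1 Hg)) as [s0 Hs0].
  set (lam := Sig (th s0) - v * s0).
  assert (Hlam : forall s, in_itv a b s -> Sig (th s) - v * s = lam).
  { intros s Hs. apply (is_derive_zero_const (fun s => Sig (th s) - v * s) a b); auto.
    intros r Hr. destruct (Hth r Hr) as [_ Hd]. assert (Hp := Sm_lower C (th r)).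
    eapply is_derive_eq.
    { apply (is_derive_minus (fun s => Sig (th s)) (fun s => v * s)).
      - apply (is_derive_comp Sig th); [apply HS|apply Hd].
      - auto_derive; auto. }
    unfold minus, plus, opp, scal; simpl; unfold mult; simpl. field. lra. }
  set (ph := fun s => Th (v * s + lam)).
  assert (Hph : forall s, Sig (ph s) = v * s + lam) by (intros; apply HST).
  assert (Hphd : forall s, is_derive ph s (v / (2 * Sm C (ph s)))).
  { intros s. assert (Hp := Sm_lower C (ph s)). eapply is_derive_eq.
    { apply (is_derive_comp Th (fun s => v * s + lam)); [apply HT|].
      auto_derive; auto. }
    unfold scal; simpl; unfold mult; simpl. fold (ph s). field. lra. }
  destruct (model_geodesic C M v ph HC Hv Hphd) as [Hgeo Hspeed].
  set (g := fun s => (alm C M (ph s), tm C M (ph s))) in *.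
  assert (Heq : forall s, in_itv a b s -> g s = c s).
  { intros s Hs. destruct (Hth s Hs) as [Hc _]. rewrite Hc. unfold g, ph.
    replace (v * s + lam) with (Sig (th s)) by (rewrite <- (Hlam s Hs); ring).
    now rewrite HTS. }
  (* The model curve extends [c] to the whole line, so maximality forces the interval to be the line
     and [c] to be [g]. *)
  destruct (Hmax m_infty p_infty g Hgeo I) as [<- <-]; auto.
  { destruct b; simpl; auto. }
  assert (E : c = g).
  { apply functional_extensionality. intros s. symmetry. apply Heq. now split. }
  split; auto. split; auto. exists (4 * PI / Rabs v). rewrite E. split.
  - apply model_simply_closed with Sig lam; auto.
  - assert (Hav : 0 < Rabs v) by now apply Rabs_pos_lt.
    apply is_RInt_ext with (fun _ => Rabs v).
    + intros s _. rewrite Hspeed. rewrite <- sqrt_Rsqr_abs. f_equal. unfold Rsqr. ring.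
    + assert (Hi := is_RInt_const (V := R_NormedModule) 0 (4 * PI / Rabs v) (Rabs v)).
      match type of Hi with is_RInt _ _ _ ?l => replace l with (4 * PI) in Hi; [exact Hi|] end.
      unfold scal; simpl; unfold mult; simpl. field. lra.
Qed.

(** * The parabolic atlas *)

(* [e = 1, - 1] is the sign of the perturbation [eta = e y^2 bump 2 (y - 1) / 4];
   the derivative of [af e] is [- eta / y^2]. *)
Definition af (e y : R) : R := - e * bump 0 (y - 1) / 4.

Lemma is_derive_af e y : is_derive (af e) y (- e * bump 2 (y - 1) / 4).
Proof.
  assert (H : is_derive (fun y => bump 0 (y - 1)) y (bump 2 (y - 1))).
  { eapply is_derive_eq.
    { apply (is_derive_comp (bump 0) (fun y => y - 1)); [apply is_derive_bump|].
      auto_derive; auto. }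
    unfold scal; simpl; unfold mult; simpl. ring. }
  set (b := fun y => bump 0 (y - 1)) in *. unfold af.
  change (is_derive (fun y => - e * b y / 4) y (- e * bump 2 (y - 1) / 4)).
  auto_derive.
  - repeat split; eexists; eassumption.
  - replace (Derive (fun x => b x) y) with (bump 2 (y - 1)) by (symmetry; now apply is_derive_unique).
    field.
Qed.

Lemma af_small e y : y <= 1 -> af e y = 0.
Proof. intros H. unfold af. rewrite bump_neg by lra. field. Qed.

Lemma Cn_on_af n D e g : open2 D -> Cn_on n D g -> Cn_on n D (fun x y => af e (g x y)).
Proof.
  intros Ho Hg. unfold af.
  assert (H : Cn_on n D (fun x y => bump 0 (g x y - 1))) by (apply Cn_on_bump; auto; smooth).
  unfold Rdiv. smooth.
Qed.

(** The two kinds of charts straighten the Killing flow, which translates [tan al] and [rf / qf].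
    Since [tan al + rf / qf = 1 / (cos al qf) = 2 / y], passing from one kind to the other on the
    same sheet is [x |-> - x + 2 / y]; the shifts by [af] bring the metric to the prescribed normal
    form. *)
Definition phiA (e : R) (p : pt) : pt :=
  let y := 2 * cos (fst p) * qf (fst p) (snd p) in
  (sin (fst p) / cos (fst p) - af e y, y).

Definition phiB (e : R) (p : pt) : pt :=
  let y := 2 * cos (fst p) * qf (fst p) (snd p) in
  (rf (fst p) (snd p) / qf (fst p) (snd p) + af e y, y).

(* [off] is [0] when [e = 1] and [PI] when [e = - 1]. *)
Definition psiA (e off : R) (z : pt) : pt :=
  let u := fst z + af e (snd z) in (off + atan u, snd z * (1 + u ^ 2) / 2 - u).

(** [1 - om y / 2] and [y / 2] stand for [qf sin al] and [qf cos al], so [harg] returns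
    [off + PI / 2 - al] by a formula that is valid also where [cos al = 0]. *)
Definition psiB (e off : R) (z : pt) : pt :=
  let om := fst z - af e (snd z) in
  (off + PI / 2 - harg (1 - om * snd z / 2) (snd z / 2), snd z * (1 + om ^ 2) / 2 - om).

Definition sheet (e off : R) : Prop :=
  (e = 1 \/ e = - 1) /\ cos off = e /\ sin off = 0.

Lemma sheet_pos : sheet 1 0.
Proof. split; [left; auto|]. split; [apply cos_0|apply sin_0]. Qed.

Lemma sheet_neg : sheet (- 1) PI.
Proof. split; [right; auto|]. split; [apply cos_PI|apply sin_PI]. Qed.

Lemma twist_sheet e off k c y : sheet e off -> 0 < c -> twist k (e * c) y = e * bump k (y - 1).
Proof.
  intros [[-> | ->] _] Hc.
  - rewrite twist_pos by lra. ring.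
  - rewrite twist_neg by lra. ring.
Qed.

Lemma psiA_values e off z : sheet e off ->
  let u := fst z + af e (snd z) in let D := sqrt (1 + u ^ 2) in let p := psiA e off z in
  0 < D /\ D ^ 2 = 1 + u ^ 2 /\
  cos (fst p) = e / D /\ sin (fst p) = e * u / D /\
  qf (fst p) (snd p) = e * snd z * D / 2 /\
  rf (fst p) (snd p) = e * D * (1 - snd z * u / 2).
Proof.
  intros [He [Hc Hs]] u D p.
  assert (Hu : 0 < 1 + u ^ 2) by nra.
  assert (HD : 0 < D) by now apply sqrt_lt_R0.
  assert (HD2 : D ^ 2 = 1 + u ^ 2) by (unfold D; rewrite <- Rsqr_pow2; apply Rsqr_sqrt; lra).
  assert (Ec : cos (fst p) = e / D).
  { unfold p, psiA; simpl. fold u. rewrite cos_plus, Hc, Hs, cos_atan.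
    replace (1 + Rsqr u) with (1 + u ^ 2) by (unfold Rsqr; ring). fold D. field. lra. }
  assert (Es : sin (fst p) = e * u / D).
  { unfold p, psiA; simpl. fold u. rewrite sin_plus, Hc, Hs, sin_atan.
    replace (1 + Rsqr u) with (1 + u ^ 2) by (unfold Rsqr; ring). fold D. field. lra. }
  repeat split; auto; unfold qf, rf; rewrite Ec, Es; unfold p, psiA; cbn [fst snd]; fold u;
    apply Rmult_eq_reg_r with D; try lra.
  - replace (e * snd z * D / 2 * D) with (e * snd z * D ^ 2 / 2) by field.
    rewrite HD2. field. lra.
  - replace (e * D * (1 - snd z * u / 2) * D) with (e * D ^ 2 * (1 - snd z * u / 2)) by field.
    rewrite HD2. field. lra.
Qed.

Lemma psiB_values e off z : sheet e off ->
  let om := fst z - af e (snd z) in let v := 1 - om * snd z / 2 in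
  let N := sqrt (v ^ 2 + (snd z / 2) ^ 2) in let p := psiB e off z in
  0 < N /\ N ^ 2 = v ^ 2 + (snd z / 2) ^ 2 /\
  cos (fst p) = e * (snd z / 2) / N /\ sin (fst p) = e * v / N /\
  qf (fst p) (snd p) = e * N /\ rf (fst p) (snd p) = e * om * N.
Proof.
  intros [He [Hc Hs]] om v N p.
  assert (Hv : snd z / 2 = 0 -> 0 < v).
  { intros E. unfold v. replace (om * snd z / 2) with (om * (snd z / 2)) by field. rewrite E. lra. }
  assert (Hp := norm_sq_pos _ _ Hv).
  assert (HN : 0 < N) by now apply sqrt_lt_R0.
  assert (HN2 : N ^ 2 = v ^ 2 + (snd z / 2) ^ 2).
  { unfold N; rewrite <- Rsqr_pow2; apply Rsqr_sqrt; lra. }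
  destruct (cos_sin_harg _ _ Hv) as [Hch Hsh]. fold N in Hch, Hsh.
  assert (Ec : cos (fst p) = e * (snd z / 2) / N).
  { unfold p, psiB; cbn [fst snd]. fold om v. rewrite cos_minus, cos_plus, sin_plus, cos_PI2, sin_PI2, Hc, Hs, Hch, Hsh.
    field. lra. }
  assert (Es : sin (fst p) = e * v / N).
  { unfold p, psiB; cbn [fst snd]. fold om v. rewrite sin_minus, cos_plus, sin_plus, cos_PI2, sin_PI2, Hc, Hs, Hch, Hsh.
    field. lra. }
  repeat split; auto; unfold qf, rf; rewrite Ec, Es; unfold p, psiB; cbn [fst snd]; fold om;
    apply Rmult_eq_reg_r with N; try lra.
  - replace (e * N * N) with (e * N ^ 2) by ring. rewrite HN2. unfold v. field. lra.
  - replace (e * om * N * N) with (e * om * N ^ 2) by ring. rewrite HN2. unfold v. field. lra.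
Qed.

Lemma cos_sin_Zperiod x z : cos (x + IZR z * (2 * PI)) = cos x /\ sin (x + IZR z * (2 * PI)) = sin x.
Proof.
  assert (G : forall n y, cos (y + INR n * (2 * PI)) = cos y /\ sin (y + INR n * (2 * PI)) = sin y).
  { intros n y. replace (y + INR n * (2 * PI)) with (y + 2 * INR n * PI) by ring.
    now rewrite cos_period, sin_period. }
  destruct z as [|n|n].
  - rewrite Rmult_0_l, Rplus_0_r; auto.
  - rewrite <- positive_nat_Z, <- INR_IZR_INZ. apply G.
  - destruct (G (Pos.to_nat n) (x + IZR (Z.neg n) * (2 * PI))) as [H1 H2].
    rewrite <- H1, <- H2. rewrite INR_IZR_INZ, positive_nat_Z.
    replace (IZR (Z.neg n)) with (- IZR (Z.pos n)) by (rewrite <- opp_IZR; reflexivity).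
    split; f_equal; ring.
Qed.

Lemma qf_Zperiod x z t : qf (x + IZR z * (2 * PI)) t = qf x t /\ rf (x + IZR z * (2 * PI)) t = rf x t.
Proof. unfold qf, rf. now destruct (cos_sin_Zperiod x z) as [-> ->]. Qed.

Lemma open_of_open2 D : open2 D -> open (fun p : pt => D (fst p) (snd p)).
Proof.
  intros H [x y] Hd. apply (proj1 (locally_2d_locally D x y)). now apply H.
Qed.

Lemma same_pt_cos_sin p q : cos (fst p) = cos (fst q) -> sin (fst p) = sin (fst q) ->
  snd p = snd q -> same_pt zoll_cyl p q.
Proof.
  intros Hc Hs Ht. destruct (cos_sin_eq_mod _ _ Hc Hs) as [z Hz].
  exists z. rewrite (surjective_pairing q). simpl. now rewrite Hz, Ht.
Qed.

Definition UA (e : R) (p : pt) : Prop := 0 < e * cos (fst p).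
Definition UB (e : R) (p : pt) : Prop := 0 < e * qf (fst p) (snd p).

Lemma full_chart_A e off : sheet e off -> full_chart zoll_cyl (UA e) (phiA e) (psiA e off).
Proof.
  intros Hsh. assert (He : e = 1 \/ e = - 1) by apply Hsh.
  assert (Ho : open2 (fun x y => 0 < e * cos x)).
  { apply (open2_gt (fun x _ => e * cos x)). intros x y.
    apply (Cn_on_continuity 0 (fun _ _ => True)); auto. smooth. }
  repeat split.
  - exact (open_of_open2 _ Ho).
  - intros p q [z ->]. unfold UA; simpl. now destruct (cos_sin_Zperiod (fst p) z) as [-> _].
  - intros n p Hp k.
    assert (Hq := Cn_on_qf n _ Ho).
    assert (Hy : Cn_on n (fun x y => 0 < e * cos x) (fun x y => 2 * cos x * qf x y)) by smooth.
    revert Hp. unfold UA. destruct k.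
    + apply (Hy (fst p) (snd p)).
    + apply (fun H : Cn_on n (fun x y => 0 < e * cos x) (fun x y => sin x / cos x - af e (2 * cos x * qf x y)) => H (fst p) (snd p)).
      apply Cn_on_minus; auto; [|now apply Cn_on_af].
      apply Cn_on_div; auto; [|smooth|smooth]. intros x y H E. rewrite E in H. lra.
  - intros p q Hp [z ->]. unfold phiA; simpl.
    destruct (cos_sin_Zperiod (fst p) z) as [-> ->]. now destruct (qf_Zperiod (fst p) z (snd p)) as [-> _].
  - intros n q k.
    assert (Hu : Cn_on n (fun _ _ => True) (fun x y => x + af e y)).
    { apply Cn_on_plus; [smooth|smooth|apply Cn_on_af; smooth]. }
    destruct k.
    + apply (fun H : Cn_on n (fun _ _ => True) (fun x y => y * (1 + (x + af e y) ^ 2) / 2 - (x + af e y)) => H (fst q) (snd q) I).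
      unfold Rdiv. smooth.
    + apply (fun H : Cn_on n (fun _ _ => True) (fun x y => off + atan (x + af e y)) => H (fst q) (snd q) I).
      apply Cn_on_plus; [smooth|smooth|apply Cn_on_atan; smooth].
  - intros q. destruct (psiA_values e off q Hsh) as [HD [HD2 [Ec _]]]. unfold UA. rewrite Ec.
    replace (e * (e / sqrt (1 + (fst q + af e (snd q)) ^ 2))) with
      (e ^ 2 / sqrt (1 + (fst q + af e (snd q)) ^ 2)) by (field; lra).
    apply Rdiv_lt_0_compat; auto. destruct He as [-> | ->]; lra.
  - intros q. destruct (psiA_values e off q Hsh) as [HD [HD2 [Ec [Es [Eq Er]]]]].
    unfold phiA. cbv zeta. rewrite Ec, Es, Eq.
    set (D := sqrt (1 + (fst q + af e (snd q)) ^ 2)) in *.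
    assert (Ey : 2 * (e / D) * (e * snd q * D / 2) = snd q).
    { destruct He as [-> | ->]; field; lra. }
    rewrite Ey. transitivity (fst q, snd q); [f_equal | now destruct q].
    destruct He as [-> | ->]; field; lra.
  - intros p Hp. unfold UA in Hp. set (q := phiA e p).
    destruct (psiA_values e off q Hsh) as [HD [HD2 [Ec [Es [Eq Er]]]]].
    assert (Hc : cos (fst p) <> 0) by (intros E; rewrite E in Hp; lra).
    assert (Hu : fst q + af e (snd q) = sin (fst p) / cos (fst p)).
    { unfold q, phiA; simpl. ring. }
    rewrite Hu in *.
    assert (H1 := sincos1 (fst p)).
    assert (ED : sqrt (1 + (sin (fst p) / cos (fst p)) ^ 2) = e / cos (fst p)).
    { apply sqrt_lem_1.
      - nra.
      - apply Rlt_le. replace (e / cos (fst p)) with (e * cos (fst p) / (cos (fst p)) ^ 2) by (field; auto).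
        apply Rdiv_lt_0_compat; auto. nra.
      - replace (1 + (sin (fst p) / cos (fst p)) ^ 2) with ((sin (fst p) ^ 2 + cos (fst p) ^ 2) / cos (fst p) ^ 2) by (field; auto).
        rewrite H1. destruct He as [-> | ->]; field; auto. }
    rewrite ED in *.
    apply same_pt_cos_sin.
    + rewrite Ec. destruct He as [-> | ->]; field; auto; lra.
    + rewrite Es. destruct He as [-> | ->]; field; auto; lra.
    + unfold psiA. cbn [snd fst]. rewrite Hu.
      replace (1 + (sin (fst p) / cos (fst p)) ^ 2) with ((sin (fst p) ^ 2 + cos (fst p) ^ 2) / cos (fst p) ^ 2) by (field; auto).
      rewrite H1. unfold q, phiA; cbn [snd fst]. unfold qf. field. auto.
Qed.

Lemma full_chart_B e off : sheet e off -> full_chart zoll_cyl (UB e) (phiB e) (psiB e off).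
Proof.
  intros Hsh. assert (He : e = 1 \/ e = - 1) by apply Hsh.
  assert (Ho : open2 (fun x y => 0 < e * qf x y)).
  { apply (open2_gt (fun x y => e * qf x y)). intros x y.
    apply (Cn_on_continuity 0 (fun _ _ => True)); auto. unfold qf. smooth. }
  repeat split.
  - exact (open_of_open2 _ Ho).
  - intros p q [z ->]. unfold UB; simpl. now destruct (qf_Zperiod (fst p) z (snd p)) as [-> _].
  - intros n p Hp k.
    assert (Hq := Cn_on_qf n _ Ho). assert (Hr := Cn_on_rf n _ Ho).
    assert (Hy : Cn_on n (fun x y => 0 < e * qf x y) (fun x y => 2 * cos x * qf x y)) by smooth.
    revert Hp. unfold UB. destruct k.
    + apply (Hy (fst p) (snd p)).
    + apply (fun H : Cn_on n (fun x y => 0 < e * qf x y) (fun x y => rf x y / qf x y + af e (2 * cos x * qf x y)) => H (fst p) (snd p)).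
      apply Cn_on_plus; auto; [|now apply Cn_on_af].
      apply Cn_on_div; auto. intros x y H E. rewrite E in H. lra.
  - intros p q Hp [z ->]. unfold phiB; simpl.
    destruct (cos_sin_Zperiod (fst p) z) as [-> _]. now destruct (qf_Zperiod (fst p) z (snd p)) as [-> ->].
  - intros n q k.
    assert (Hu : Cn_on n (fun _ _ => True) (fun x y => x - af e y)).
    { apply Cn_on_minus; [smooth|smooth|apply Cn_on_af; smooth]. }
    destruct k.
    + apply (fun H : Cn_on n (fun _ _ => True) (fun x y => y * (1 + (x - af e y) ^ 2) / 2 - (x - af e y)) => H (fst q) (snd q) I).
      unfold Rdiv. smooth.
    + apply (fun H : Cn_on n (fun _ _ => True) (fun x y => off + PI / 2 - harg (1 - (x - af e y) * y / 2) (y / 2)) => H (fst q) (snd q) I).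
      apply Cn_on_minus; [smooth|smooth|].
      apply Cn_on_harg; [smooth| |unfold Rdiv; smooth|unfold Rdiv; smooth].
      intros x y _ E. replace ((x - af e y) * y / 2) with ((x - af e y) * (y / 2)) by field. rewrite E. lra.
  - intros q. destruct (psiB_values e off q Hsh) as [HN [HN2 [Ec [Es [Eq Er]]]]]. unfold UB. rewrite Eq.
    destruct He as [-> | ->]; lra.
  - intros q. destruct (psiB_values e off q Hsh) as [HN [HN2 [Ec [Es [Eq Er]]]]].
    unfold phiB. cbv zeta. rewrite Ec, Eq, Er.
    match type of HN with 0 < ?n => set (N := n) in * end.
    assert (Ey : 2 * (e * (snd q / 2) / N) * (e * N) = snd q).
    { destruct He as [-> | ->]; field; lra. }
    rewrite Ey. transitivity (fst q, snd q); [f_equal | now destruct q].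
    destruct He as [-> | ->]; field; lra.
  - intros p Hp. unfold UB in Hp. set (q := phiB e p).
    destruct (psiB_values e off q Hsh) as [HN [HN2 [Ec [Es [Eq Er]]]]].
    assert (Hq : qf (fst p) (snd p) <> 0) by (intros E; rewrite E in Hp; lra).
    assert (Hom : fst q - af e (snd q) = rf (fst p) (snd p) / qf (fst p) (snd p)).
    { unfold q, phiB; simpl. ring. }
    rewrite Hom in *.
    assert (H1 := sincos1 (fst p)). assert (Hqr := qf_rf (fst p) (snd p)).
    assert (Ey : snd q / 2 = cos (fst p) * qf (fst p) (snd p)).
    { unfold q, phiB; simpl. field. }
    assert (Ev : 1 - rf (fst p) (snd p) / qf (fst p) (snd p) * snd q / 2 = qf (fst p) (snd p) * sin (fst p)).
    { replace (rf (fst p) (snd p) / qf (fst p) (snd p) * snd q / 2) with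
       (rf (fst p) (snd p) / qf (fst p) (snd p) * (snd q / 2)) by (field; auto).
      rewrite Ey. replace (rf (fst p) (snd p) / qf (fst p) (snd p) * (cos (fst p) * qf (fst p) (snd p)))
        with (rf (fst p) (snd p) * cos (fst p)) by (field; auto). lra. }
    rewrite Ev, Ey in *.
    assert (EN : sqrt ((qf (fst p) (snd p) * sin (fst p)) ^ 2 + (cos (fst p) * qf (fst p) (snd p)) ^ 2) = e * qf (fst p) (snd p)).
    { apply sqrt_lem_1.
      - nra.
      - lra.
      - replace ((qf (fst p) (snd p) * sin (fst p)) ^ 2 + (cos (fst p) * qf (fst p) (snd p)) ^ 2) with
          (qf (fst p) (snd p) ^ 2 * (sin (fst p) ^ 2 + cos (fst p) ^ 2)) by ring.
        rewrite H1. destruct He as [-> | ->]; ring. }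
    rewrite EN in *.
    apply same_pt_cos_sin.
    + rewrite Ec. destruct He as [-> | ->]; field; auto; lra.
    + rewrite Es. destruct He as [-> | ->]; field; auto; lra.
    + unfold psiB. cbn [snd fst]. rewrite Hom.
      set (om := rf (fst p) (snd p) / qf (fst p) (snd p)) in *.
      replace (snd q * (1 + om ^ 2) / 2 - om) with (snd q / 2 - om * (1 - om * snd q / 2)) by field.
      rewrite Ev, Ey. unfold om.
      replace (cos (fst p) * qf (fst p) (snd p) - rf (fst p) (snd p) / qf (fst p) (snd p) * (qf (fst p) (snd p) * sin (fst p)))
        with (cos (fst p) * qf (fst p) (snd p) - rf (fst p) (snd p) * sin (fst p)) by (field; auto).
      transitivity (snd p * (sin (fst p) ^ 2 + cos (fst p) ^ 2)); [unfold qf, rf; ring | rewrite H1; ring].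
Qed.

(** * The metric in the charts *)

Definition ff (e y : R) : R := - e * bump 2 (y - 1) / 2 - y ^ 2 * bump 2 (y - 1) ^ 2 / 16.

Lemma ex_derive_n_ff e n y : ex_derive_n (ff e) n y.
Proof.
  apply Cn_on_ex_derive_n. unfold ff.
  assert (Hb : Cn_on n (fun _ _ => True) (fun _ y => bump 2 (y - 1))) by (apply Cn_on_bump; smooth).
  unfold Rdiv. smooth.
Qed.

(** [1 - y^2 ff] is the square of [s = 1 + e y^2 bump 2 (y - 1) / 4]. Equivalently
    [ff = 2 af' - y^2 af'^2], which says that the curves [x + af e y = const] are null for the
    normal form. *)
Lemma ff_bound e y : e = 1 \/ e = - 1 -> 1 - y ^ 2 * ff e y > 0.
Proof.
  intros He. assert (H := sq_mul_bump2_bound y). unfold ff.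
  set (eta := y ^ 2 * bump 2 (y - 1)) in *.
  replace (1 - y ^ 2 * (- e * bump 2 (y - 1) / 2 - y ^ 2 * bump 2 (y - 1) ^ 2 / 16)) with
    (1 + e * eta / 2 + eta ^ 2 / 16) by (unfold eta; field).
  destruct He as [-> | ->]; nra.
Qed.

Lemma Kf_psiA e off z : sheet e off ->
  Kf (fst (psiA e off z)) (snd (psiA e off z)) = e * bump 2 (snd z - 1).
Proof.
  intros Hsh. destruct (psiA_values e off z Hsh) as [HD [HD2 [Ec [Es [Eq Er]]]]].
  assert (He : e = 1 \/ e = - 1) by apply Hsh.
  unfold Kf. rewrite Ec, Eq. match type of HD with 0 < ?d => set (D := d) in * end.
  replace (2 * (e / D) * (e * snd z * D / 2)) with (snd z) by (destruct He as [-> | ->]; field; lra).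
  unfold Rdiv. apply twist_sheet with off; auto. now apply Rinv_0_lt_compat.
Qed.

Lemma Kf_psiB e off z : sheet e off ->
  Kf (fst (psiB e off z)) (snd (psiB e off z)) = e * bump 2 (snd z - 1).
Proof.
  intros Hsh. destruct (psiB_values e off z Hsh) as [HD [HD2 [Ec [Es [Eq Er]]]]].
  assert (He : e = 1 \/ e = - 1) by apply Hsh.
  unfold Kf. rewrite Ec, Eq. match type of HD with 0 < ?d => set (D := d) in * end.
  replace (2 * (e * (snd z / 2) / D) * (e * D)) with (snd z) by (destruct He as [-> | ->]; field; lra).
  destruct (Rle_lt_dec (snd z) 1) as [L|L].
  - rewrite twist_small, bump_neg by lra. ring.
  - replace (e * (snd z / 2) / D) with (e * (snd z / 2 / D)) by (field; lra).
    apply twist_sheet with off; auto. apply Rdiv_lt_0_compat; lra.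
Qed.

Lemma pullback_zoll Phi i j x y : pullback zoll_cyl Phi i j x y =
  Ef (fst (Phi (x, y))) (snd (Phi (x, y)))
    * partial i (component Phi false) x y * partial j (component Phi false) x y
  + Ff (fst (Phi (x, y))) (snd (Phi (x, y)))
    * (partial i (component Phi false) x y * partial j (component Phi true) x y
       + partial i (component Phi true) x y * partial j (component Phi false) x y).
Proof. unfold pullback, sum2; simpl. ring. Qed.

Lemma psiA_partials e off x y : let u := x + af e y in let a' := - e * bump 2 (y - 1) / 4 in
  partial false (component (psiA e off) false) x y = / (1 + u ^ 2) /\
  partial true (component (psiA e off) false) x y = a' / (1 + u ^ 2) /\
  partial false (component (psiA e off) true) x y = y * u - 1 /\
  partial true (component (psiA e off) true) x y = (1 + u ^ 2) / 2 + (y * u - 1) * a'.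
Proof.
  intros u a'. assert (Ha := is_derive_af e y). fold a' in Ha.
  assert (Ea : Derive (fun z => af e z) y = a') by now apply is_derive_unique.
  assert (Hp : 0 < 1 + u ^ 2) by nra.
  unfold partial, component, psiA; simpl.
  refine (conj _ (conj _ (conj _ _))); apply is_derive_unique; auto_derive; try (repeat split; eexists; eassumption);
    try exact I; rewrite ?Ea; fold u; unfold Rsqr; try field; try lra.
Qed.

Lemma pullback_A e off x y : sheet e off ->
  pullback zoll_cyl (psiA e off) false false x y = y ^ 2 /\
  pullback zoll_cyl (psiA e off) false true x y = 1 /\
  pullback zoll_cyl (psiA e off) true true x y = ff e y.
Proof.
  intros Hsh. destruct (psiA_values e off (x, y) Hsh) as [HD [HD2 [Ec [Es [Eq Er]]]]].
  assert (He : e = 1 \/ e = - 1) by apply Hsh.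
  assert (EK := Kf_psiA e off (x, y) Hsh).
  assert (Et : snd (psiA e off (x, y)) = y * (1 + (x + af e y) ^ 2) / 2 - (x + af e y)) by reflexivity.
  destruct (psiA_partials e off x y) as [P1 [P2 [P3 P4]]].
  rewrite !pullback_zoll, P1, P2, P3, P4.
  unfold Ff, sf, Ef, kf. rewrite EK, Ec, Es, Eq, Er, Et. cbn [fst snd] in *.
  set (u := x + af e y) in *. set (b := bump 2 (y - 1)).
  match type of HD with 0 < ?d => set (D := d) in * end.
  assert (Hu : 0 < 1 + u ^ 2) by nra.
  assert (Ee : e ^ 2 = 1) by (destruct He as [-> | ->]; ring).
  assert (EE : 4 * ((y * (1 + u ^ 2) / 2 - u) ^ 2 + 1 +
     (e * y * D / 2) ^ 2 * (e * b) * (e / D * (e * D * (1 - y * u / 2)) - e * y * D / 2 * (e * u / D)))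
     = 4 * ((y * (1 + u ^ 2) / 2 - u) ^ 2 + 1 + y ^ 2 * (1 + u ^ 2) / 4 * (e * b) * (1 - y * u))).
  { rewrite <- HD2. destruct He as [-> | ->]; field; lra. }
  assert (EF : 2 * (1 + (e / D) ^ 2 * (e * y * D / 2) ^ 2 * (e * b)) = 2 * (1 + y ^ 2 / 4 * (e * b))).
  { destruct He as [-> | ->]; field; lra. }
  rewrite EE, EF. unfold ff. fold b.
  destruct He as [-> | ->]; refine (conj _ (conj _ _)); field; lra.
Qed.

Lemma psiB_partials e off x y : let om := x - af e y in let ka := e * bump 2 (y - 1) in
  let v := 1 - om * y / 2 in let N2 := v ^ 2 + (y / 2) ^ 2 in
  partial false (component (psiB e off) false) x y = - y ^ 2 / (4 * N2) /\
  partial true (component (psiB e off) false) x y = - (v / 2 - y / 2 * (- om / 2 - ka * y / 8)) / N2 /\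
  partial false (component (psiB e off) true) x y = y * om - 1 /\
  partial true (component (psiB e off) true) x y = (1 + om ^ 2) / 2 + (y * om - 1) * ka / 4.
Proof.
  intros om ka v N2. assert (Ha := is_derive_af e y).
  assert (Ea : Derive (fun z => af e z) y = - ka / 4).
  { transitivity (- e * bump 2 (y - 1) / 4); [now apply is_derive_unique | unfold ka; field]. }
  assert (Hv : y / 2 = 0 -> 0 < v).
  { intros E. unfold v. replace (om * y / 2) with (om * (y / 2)) by field. rewrite E. lra. }
  assert (HN := norm_sq_pos _ _ Hv). fold N2 in HN.
  unfold partial, component, psiB; simpl.
  assert (C0 : forall z : R, is_derive (fun _ : R => off + PI / 2) z 0).
  { intros z. apply is_derive_cst. }
  refine (conj _ (conj _ (conj _ _))); apply is_derive_unique.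
  - assert (H1 : is_derive (fun z => 1 - (z - af e y) * y / 2) x (- y / 2)) by (auto_derive; auto; field).
    assert (H2 : is_derive (fun _ : R => y / 2) x 0)
      by apply is_derive_cst.
    eapply is_derive_eq.
    { apply (is_derive_minus (fun _ => off + PI / 2)); [apply C0|].
      apply (is_derive_harg (fun z => 1 - (z - af e y) * y / 2) (fun _ => y / 2) x _ _ Hv H1 H2). }
    fold om v N2. unfold minus, plus, opp; simpl. field. lra.
  - assert (H1 : is_derive (fun z => 1 - (x - af e z) * z / 2) y (- om / 2 - ka * y / 8)).
    { auto_derive; [repeat split; eexists; eassumption|]. rewrite Ea. unfold om. field. }
    assert (H2 : is_derive (fun z : R => z / 2) y (/ 2)) by (auto_derive; auto; field).
    eapply is_derive_eq.
    { apply (is_derive_minus (fun _ => off + PI / 2)); [apply C0|].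
      apply (is_derive_harg (fun z => 1 - (x - af e z) * z / 2) (fun z => z / 2) y _ _ Hv H1 H2). }
    fold om v N2. unfold minus, plus, opp; simpl. field. lra.
  - auto_derive; auto. unfold om. field.
  - auto_derive; [repeat split; eexists; eassumption|]. rewrite Ea. unfold om. field.
Qed.

Lemma pullback_B e off x y : sheet e off ->
  pullback zoll_cyl (psiB e off) false false x y = y ^ 2 /\
  pullback zoll_cyl (psiB e off) false true x y = 1 /\
  pullback zoll_cyl (psiB e off) true true x y = ff e y.
Proof.
  intros Hsh. destruct (psiB_values e off (x, y) Hsh) as [HN [HN2 [Ec [Es [Eq Er]]]]].
  assert (He : e = 1 \/ e = - 1) by apply Hsh.
  assert (EK := Kf_psiB e off (x, y) Hsh).
  assert (Et : snd (psiB e off (x, y)) = y * (1 + (x - af e y) ^ 2) / 2 - (x - af e y)) by reflexivity.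
  destruct (psiB_partials e off x y) as [P1 [P2 [P3 P4]]].
  rewrite !pullback_zoll, P1, P2, P3, P4.
  unfold Ff, sf, Ef, kf. rewrite EK, Ec, Es, Eq, Er, Et. cbn [fst snd] in *.
  set (om := x - af e y) in *. set (b := bump 2 (y - 1)).
  match type of HN with 0 < ?d => set (N := d) in * end.
  set (v := 1 - om * y / 2) in *.
  assert (EE : 4 * ((y * (1 + om ^ 2) / 2 - om) ^ 2 + 1 +
     (e * N) ^ 2 * (e * b) * (e * (y / 2) / N * (e * om * N) - e * N * (e * v / N)))
     = 4 * ((y * (1 + om ^ 2) / 2 - om) ^ 2 + 1 + (v ^ 2 + (y / 2) ^ 2) * (e * b) * (y * om - 1))).
  { rewrite <- HN2. unfold v. destruct He as [-> | ->]; field; lra. }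
  assert (EF : 2 * (1 + (e * (y / 2) / N) ^ 2 * (e * N) ^ 2 * (e * b)) = 2 * (1 + y ^ 2 / 4 * (e * b))).
  { destruct He as [-> | ->]; field; lra. }
  assert (Hp : v ^ 2 + (y / 2) ^ 2 <> 0) by nra.
  rewrite EE, EF. unfold ff. fold b.
  assert (Hp' : (2 - om * y) * (2 - om * y) + y * y <> 0).
  { intros E; apply Hp. unfold v. nra. }
  unfold v in *. clear EE EF HN2.
  destruct He as [-> | ->]; refine (conj _ (conj _ _)); field;
    (intros E; apply Hp'; rewrite <- E; ring).
Qed.

(** * Transition maps of the four charts *)

Definition swap (q : pt) : pt := (- fst q + 2 / snd q, snd q).

Lemma phiB_psiA e off e' q : sheet e off -> snd q <> 0 -> phiB e' (psiA e off q) =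
  (- fst q + 2 / snd q - af e (snd q) + af e' (snd q), snd q).
Proof.
  intros Hsh Hy. destruct (psiA_values e off q Hsh) as [HD [HD2 [Ec [Es [Eq Er]]]]].
  assert (He : e = 1 \/ e = - 1) by apply Hsh.
  unfold phiB. cbv zeta. rewrite Ec, Eq, Er.
  match type of HD with 0 < ?d => set (D := d) in * end.
  replace (2 * (e / D) * (e * snd q * D / 2)) with (snd q) by (destruct He as [-> | ->]; field; lra).
  f_equal. f_equal. destruct He as [-> | ->]; field; split; auto; lra.
Qed.

Lemma phiA_psiB e off e' q : sheet e off -> snd q <> 0 -> phiA e' (psiB e off q) =
  (- fst q + 2 / snd q + af e (snd q) - af e' (snd q), snd q).
Proof.
  intros Hsh Hy. destruct (psiB_values e off q Hsh) as [HD [HD2 [Ec [Es [Eq Er]]]]].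
  assert (He : e = 1 \/ e = - 1) by apply Hsh.
  unfold phiA. cbv zeta. rewrite Ec, Eq, Es.
  match type of HD with 0 < ?d => set (D := d) in * end.
  replace (2 * (e * (snd q / 2) / D) * (e * D)) with (snd q) by (destruct He as [-> | ->]; field; lra).
  f_equal. f_equal. destruct He as [-> | ->]; field; split; auto; lra.
Qed.

Lemma UA_psiA e off e' q : sheet e off -> (UA e' (psiA e off q) <-> 0 < e' * e).
Proof.
  intros Hsh. destruct (psiA_values e off q Hsh) as [HD [HD2 [Ec [Es [Eq Er]]]]].
  unfold UA. rewrite Ec. match type of HD with 0 < ?d => set (D := d) in * end.
  replace (e' * (e / D)) with (e' * e * / D) by (field; lra).
  assert (0 < / D) by now apply Rinv_0_lt_compat. split; intros; nra.
Qed.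

Lemma UB_psiA e off e' q : sheet e off -> (UB e' (psiA e off q) <-> 0 < e' * e * snd q).
Proof.
  intros Hsh. destruct (psiA_values e off q Hsh) as [HD [HD2 [Ec [Es [Eq Er]]]]].
  unfold UB. rewrite Eq. match type of HD with 0 < ?d => set (D := d) in * end.
  replace (e' * (e * snd q * D / 2)) with (e' * e * snd q * (D / 2)) by field.
  assert (0 < D / 2) by lra. split; intros; nra.
Qed.

Lemma UB_psiB e off e' q : sheet e off -> (UB e' (psiB e off q) <-> 0 < e' * e).
Proof.
  intros Hsh. destruct (psiB_values e off q Hsh) as [HD [HD2 [Ec [Es [Eq Er]]]]].
  unfold UB. rewrite Eq. match type of HD with 0 < ?d => set (D := d) in * end.
  rewrite <- Rmult_assoc. split; intros; nra.
Qed.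

Lemma UA_psiB e off e' q : sheet e off -> (UA e' (psiB e off q) <-> 0 < e' * e * snd q).
Proof.
  intros Hsh. destruct (psiB_values e off q Hsh) as [HD [HD2 [Ec [Es [Eq Er]]]]].
  unfold UA. rewrite Ec. match type of HD with 0 < ?d => set (D := d) in * end.
  replace (e' * (e * (snd q / 2) / D)) with (e' * e * snd q * / (2 * D)) by (field; lra).
  assert (0 < / (2 * D)) by (apply Rinv_0_lt_compat; lra). split; intros; nra.
Qed.

Lemma glued_two i j q r : glued 2 0 i j q r <->
  r = swap q /\ ((0 < snd q /\ ((i = 0 /\ j = 1) \/ (i = 2 /\ j = 3))%nat) \/
                 (snd q < 0 /\ ((i = 1 /\ j = 2) \/ (i = 3 /\ j = 0))%nat)).
Proof.
  split.
  - intros H; inversion H as [i0 x y Hi Hy|i0 x y Hi Hy|x y Hy]; subst; unfold swap; cbn [fst snd].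
    + split; auto. left; split; auto. assert (Hi' : (i0 = 0 \/ i0 = 1)%nat) by lia.
      destruct Hi' as [-> | ->]; auto.
    + split; auto. right; split; auto. assert (Hi' : (i0 = 1)%nat) by lia. subst; auto.
    + split; [f_equal; ring|]. right; auto.
  - intros [-> [[Hy [[-> ->]|[-> ->]]]|[Hy [[-> ->]|[-> ->]]]]]; destruct q as [x y]; unfold swap; cbn [fst snd] in *.
    + apply (glued_pos 2 0 0 x y); auto.
    + apply (glued_pos 2 0 1 x y); auto.
    + apply (glued_neg 2 0 1 x y); auto.
    + replace (- x + 2 / y) with (- x + 2 / y + 0) by ring. apply (glued_last 2 0 x y); auto.
Qed.

Lemma swap_swap q : snd q <> 0 -> swap (swap q) = q.
Proof. intros H. unfold swap; cbn [fst snd]. destruct q; cbn [fst snd] in *. f_equal; field; auto. Qed.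

(** Charts of the same sheet overlap where [y > 0], and there the two shifts by [af] cancel; charts
    of different sheets overlap where [y < 0], and there both shifts vanish. Hence [tau = 0]. *)
Lemma transition_AB e off e' q r : sheet e off -> e' = 1 \/ e' = - 1 ->
  (UB e' (psiA e off q) /\ phiB e' (psiA e off q) = r <-> 0 < e' * e * snd q /\ r = swap q).
Proof.
  intros Hsh He'. assert (He : e = 1 \/ e = - 1) by apply Hsh.
  rewrite (UB_psiA e off e' q Hsh).
  assert (G : 0 < e' * e * snd q -> phiB e' (psiA e off q) = swap q).
  { intros H. assert (Hy : snd q <> 0) by (intros E; rewrite E in H; lra).
    rewrite phiB_psiA by auto. unfold swap. f_equal.
    destruct He as [-> | ->], He' as [-> | ->]; try (field; lra);
      rewrite !af_small by lra; field; lra. }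
  split; intros [H1 H2]; split; auto.
  - rewrite <- H2; auto.
  - rewrite H2; auto.
Qed.

Lemma transition_BA e off e' q r : sheet e off -> e' = 1 \/ e' = - 1 ->
  (UA e' (psiB e off q) /\ phiA e' (psiB e off q) = r <-> 0 < e' * e * snd q /\ r = swap q).
Proof.
  intros Hsh He'. assert (He : e = 1 \/ e = - 1) by apply Hsh.
  rewrite (UA_psiB e off e' q Hsh).
  assert (G : 0 < e' * e * snd q -> phiA e' (psiB e off q) = swap q).
  { intros H. assert (Hy : snd q <> 0) by (intros E; rewrite E in H; lra).
    rewrite phiA_psiB by auto. unfold swap. f_equal.
    destruct He as [-> | ->], He' as [-> | ->]; try (field; lra);
      rewrite !af_small by lra; field; lra. }
  split; intros [H1 H2]; split; auto.
  - rewrite <- H2; auto.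
  - rewrite H2; auto.
Qed.

Lemma transition_self U phi psi q r : full_chart zoll_cyl U phi psi ->
  (U (psi q) /\ phi (psi q) = r <-> q = r).
Proof.
  intros [_ [_ [_ [_ [_ [HU [Hr _]]]]]]]. rewrite Hr. split; [tauto|auto].
Qed.

(** The cyclic order around the cylinder: consecutive charts are of different kinds and share one
    half-plane, with [y > 0] inside a sheet and [y < 0] between the sheets. *)
Definition chart_dom (i : nat) : pt -> Prop :=
  match i with 0 => UA 1 | 1 => UB 1 | 2 => UA (- 1) | _ => UB (- 1) end.
Definition chart_map (i : nat) : pt -> pt :=
  match i with 0 => phiA 1 | 1 => phiB 1 | 2 => phiA (- 1) | _ => phiB (- 1) end.
Definition chart_inv (i : nat) : pt -> pt :=
  match i with 0 => psiA 1 0 | 1 => psiB 1 0 | 2 => psiA (- 1) PI | _ => psiB (- 1) PI end.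
Definition chart_coef (i : nat) : R -> R :=
  match i with 0 => ff 1 | 1 => ff 1 | _ => ff (- 1) end.

Lemma chart_full i : full_chart zoll_cyl (chart_dom i) (chart_map i) (chart_inv i).
Proof.
  destruct i as [|[|[|i]]]; simpl;
    first [apply full_chart_A | apply full_chart_B]; first [apply sheet_pos | apply sheet_neg].
Qed.

Lemma snd_swap q : snd (swap q) = snd q.
Proof. reflexivity. Qed.

Lemma zoll_transition i j : (i < 4)%nat -> (j < 4)%nat -> forall q r,
  (chart_dom j (chart_inv i q) /\ chart_map j (chart_inv i q) = r) <-> transition 2 0 i j q r.
Proof.
  intros Hi Hj q r. unfold transition. rewrite !glued_two.
  assert (Hp := sheet_pos). assert (Hm := sheet_neg).
  assert (S1 : 1 = 1 \/ 1 = - 1) by auto. assert (S2 : - 1 = 1 \/ - 1 = - 1) by auto.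
  destruct (Nat.eq_dec i j) as [<-|Hij].
  - rewrite (transition_self _ _ _ q r (chart_full i)).
    split; [tauto|]. intros [H|[H|H]]; [tauto| |]; exfalso; destruct H as [_ H]; lia.
  - assert (E : chart_dom j (chart_inv i q) /\ chart_map j (chart_inv i q) = r <->
      r = swap q /\ ((0 < snd q /\ ((i = 0 /\ j = 1) \/ (i = 1 /\ j = 0) \/ (i = 2 /\ j = 3) \/ (i = 3 /\ j = 2))%nat)
       \/ (snd q < 0 /\ ((i = 1 /\ j = 2) \/ (i = 2 /\ j = 1) \/ (i = 3 /\ j = 0) \/ (i = 0 /\ j = 3))%nat))).
    { destruct i as [|[|[|[|i]]]], j as [|[|[|[|j]]]]; try lia;
        cbn [chart_dom chart_map chart_inv];
        rewrite ?(transition_AB _ _ _ q r Hp S1), ?(transition_AB _ _ _ q r Hm S1),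
          ?(transition_AB _ _ _ q r Hp S2), ?(transition_AB _ _ _ q r Hm S2),
          ?(transition_BA _ _ _ q r Hp S1), ?(transition_BA _ _ _ q r Hm S1),
          ?(transition_BA _ _ _ q r Hp S2), ?(transition_BA _ _ _ q r Hm S2),
          ?(UA_psiA _ _ _ q Hp), ?(UA_psiA _ _ _ q Hm), ?(UB_psiB _ _ _ q Hp), ?(UB_psiB _ _ _ q Hm);
        (split;
         [ intros [H1 H2]; try (exfalso; lra); split; auto;
           first [left; split; [lra|lia] | right; split; [lra|lia]]
         | intros [H1 [[H2 H3]|[H2 H3]]]; try lia; split; auto; lra ]). }
    rewrite E. split.
    + intros [-> H]. right. rewrite snd_swap.
      assert (Hy : snd q <> 0) by (destruct H as [[H _]|[H _]]; lra).
      destruct H as [[H1 H2]|[H1 H2]].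
      * assert (H3 : ((i = 0 /\ j = 1 \/ i = 2 /\ j = 3) \/ (j = 0 /\ i = 1 \/ j = 2 /\ i = 3))%nat) by lia.
        destruct H3; [left|right]; (split; [now rewrite ?swap_swap|auto]).
      * assert (H3 : ((i = 1 /\ j = 2 \/ i = 3 /\ j = 0) \/ (j = 1 /\ i = 2 \/ j = 3 /\ i = 0))%nat) by lia.
        destruct H3; [left|right]; (split; [now rewrite ?swap_swap|auto]).
    + intros [[H _]|[[Hr H]|[Hq H]]]; [contradiction| |].
      * split; auto. destruct H as [[H1 H2]|[H1 H2]]; [left|right]; (split; [auto|lia]).
      * assert (Hy : snd r <> 0) by (destruct H as [[H _]|[H _]]; lra).
        split; [rewrite Hq; now rewrite swap_swap|].
        replace (snd q) with (snd r) by (rewrite Hq; reflexivity).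
        destruct H as [[H1 H2]|[H1 H2]]; [left|right]; (split; [auto|lia]).
Qed.

Lemma zoll_cyl_parabolic : parabolic_atlas zoll_cyl 2 0.
Proof.
  split; [lia|]. exists chart_dom, chart_map, chart_inv, chart_coef.
  refine (conj _ (conj _ (conj _ _))).
  - intros i _. apply chart_full.
  - intros p. destruct (Rtotal_order (cos (fst p)) 0) as [H|[H|H]].
    + exists 2%nat. split; [lia|]. unfold chart_dom, UA. lra.
    + assert (H1 := sincos1 (fst p)). rewrite H in H1.
      destruct (Rtotal_order (sin (fst p)) 0) as [L|[L|L]].
      * exists 3%nat. split; [lia|]. unfold chart_dom, UB, qf. rewrite H. lra.
      * exfalso. rewrite L in H1. lra.
      * exists 1%nat. split; [lia|]. unfold chart_dom, UB, qf. rewrite H. lra.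
    + exists 0%nat. split; [lia|]. unfold chart_dom, UA. lra.
  - intros i j Hi Hj. apply zoll_transition; lia.
  - intros i _. split; [|split].
    + intros n y. destruct i as [|[|i]]; apply ex_derive_n_ff.
    + intros y. destruct i as [|[|i]]; apply ff_bound; auto.
    + intros x y. destruct i as [|[|[|i]]]; simpl chart_inv; simpl chart_coef;
        first [apply pullback_A | apply pullback_B]; first [apply sheet_pos | apply sheet_neg].
Qed.

(** * Null geodesics *)

(* The null geodesics transverse to [x = const]. *)
Definition leaf (e off u y : R) : pt := psiB e off (u - af e y, y).

(** The value of [rf / qf] on the leaf. The label [u = rf / qf + 2 af e y] is constant on it and
    plays the role of [- tan be] in the perturbed metric. *)
Definition leafom (e u y : R) : R := u - 2 * af e y.
Definition leafv (e u y : R) : R := 1 - leafom e u y * y / 2.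
Definition leafN2 (e u y : R) : R := leafv e u y ^ 2 + (y / 2) ^ 2.
Definition leafs (e y : R) : R := 1 + y ^ 2 / 4 * (e * bump 2 (y - 1)).

Lemma leaf_om e u y : u - af e y - af e y = leafom e u y.
Proof. unfold leafom. ring. Qed.

Lemma leafv_pos e u y : y / 2 = 0 -> 0 < leafv e u y.
Proof.
  intros E. unfold leafv. replace (leafom e u y * y / 2) with (leafom e u y * (y / 2)) by field.
  rewrite E. lra.
Qed.

Lemma leafN2_pos e u y : 0 < leafN2 e u y.
Proof. apply norm_sq_pos. apply leafv_pos. Qed.

Lemma leafs_lower e y : e = 1 \/ e = - 1 -> / 2 <= leafs e y.
Proof.
  intros He. assert (H := sq_mul_bump2_bound y). unfold leafs. destruct He as [-> | ->]; nra.
Qed.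

Lemma leaf_values e off u y : sheet e off ->
  let N := sqrt (leafN2 e u y) in let p := leaf e off u y in
  0 < N /\ N ^ 2 = leafN2 e u y /\
  cos (fst p) = e * (y / 2) / N /\ sin (fst p) = e * leafv e u y / N /\
  snd p = y * (1 + leafom e u y ^ 2) / 2 - leafom e u y /\
  qf (fst p) (snd p) = e * N /\ rf (fst p) (snd p) = e * leafom e u y * N /\
  Kf (fst p) (snd p) = e * bump 2 (y - 1) /\ sf (fst p) (snd p) = leafs e y.
Proof.
  intros Hsh N p. assert (He : e = 1 \/ e = - 1) by apply Hsh.
  assert (H := psiB_values e off (u - af e y, y) Hsh). cbv zeta in H. cbn [fst snd] in H.
  assert (HK := Kf_psiB e off (u - af e y, y) Hsh). cbn [fst snd] in HK.
  rewrite leaf_om in H. fold (leafv e u y) in H. fold (leafN2 e u y) in H. fold N in H.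
  fold (leaf e off u y) in H, HK. fold p in H, HK. destruct H as [H1 [H2 [H3 [H4 [H5 H6]]]]].
  refine (conj H1 (conj H2 (conj H3 (conj H4 (conj _ (conj H5 (conj H6 (conj HK _)))))))).
  - unfold p, leaf, psiB; cbn [fst snd]. now rewrite leaf_om.
  - unfold sf. rewrite H3, H5, HK. unfold leafs. destruct He as [-> | ->]; field; lra.
Qed.

Lemma leaf_Ef e off u y : sheet e off -> let p := leaf e off u y in
  Ef (fst p) (snd p) = 4 * leafN2 e u y * (1 + leafom e u y ^ 2 + e * bump 2 (y - 1) * (leafom e u y * y - 1)).
Proof.
  intros Hsh p. destruct (leaf_values e off u y Hsh) as [HN [HN2 [Ec [Es [Et [Eq [Er [EK _]]]]]]]].
  fold p in Ec, Es, Et, Eq, Er, EK. assert (He : e = 1 \/ e = - 1) by apply Hsh.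
  unfold Ef, kf. rewrite EK, Ec, Es, Eq, Er, Et.
  set (N := sqrt (leafN2 e u y)) in *. clearbody N.
  assert (E1 : (y * (1 + leafom e u y ^ 2) / 2 - leafom e u y) ^ 2 + 1 = N ^ 2 * (1 + leafom e u y ^ 2)).
  { rewrite HN2. unfold leafN2, leafv. field. }
  rewrite E1, <- HN2. unfold leafv. destruct He as [-> | ->]; field; lra.
Qed.

Lemma is_derive_leafom e u y : is_derive (leafom e u) y (e * bump 2 (y - 1) / 2).
Proof.
  assert (Ha := is_derive_af e y). unfold leafom. auto_derive.
  - repeat split; eexists; eassumption.
  - derive_value Ha. field.
Qed.

Lemma is_derive_leafv e u y :
  is_derive (leafv e u) y (- leafom e u y / 2 - e * bump 2 (y - 1) * y / 4).
Proof.
  assert (Ha := is_derive_leafom e u y). unfold leafv. auto_derive.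
  - repeat split; eexists; eassumption.
  - derive_value Ha. field.
Qed.

Lemma is_derive_leaf_fst e off u y :
  is_derive (fun y => fst (leaf e off u y)) y (- leafs e y / (2 * leafN2 e u y)).
Proof.
  assert (HN := leafN2_pos e u y).
  assert (H1 := is_derive_leafv e u y).
  assert (H2 : is_derive (fun z : R => z / 2) y (/ 2)) by (auto_derive; auto; field).
  apply is_derive_ext with (fun y => off + PI / 2 - harg (leafv e u y) (y / 2)).
  { intros t. unfold leaf, psiB; cbn [fst snd]. now rewrite leaf_om. }
  eapply is_derive_eq.
  { apply (is_derive_minus (fun _ => off + PI / 2)).
    - apply is_derive_cst.
    - apply (is_derive_harg (leafv e u) (fun z => z / 2) y _ _ (leafv_pos e u y) H1 H2). }
  fold (leafN2 e u y). unfold minus, plus, opp, zero; simpl. unfold leafs, leafv. field. lra.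
Qed.

Lemma is_derive_leaf_snd e off u y : is_derive (fun y => snd (leaf e off u y)) y
  ((1 + leafom e u y ^ 2 + e * bump 2 (y - 1) * (leafom e u y * y - 1)) / 2).
Proof.
  assert (Ha := is_derive_leafom e u y).
  apply is_derive_ext with (fun y => y * (1 + leafom e u y ^ 2) / 2 - leafom e u y).
  { intros t. unfold leaf, psiB; cbn [fst snd]. now rewrite leaf_om. }
  auto_derive.
  - repeat split; eexists; eassumption.
  - derive_value Ha. field.
Qed.

Lemma is_derive_leafN2 e u y : is_derive (leafN2 e u) y
  (leafv e u y * (- leafom e u y - e * bump 2 (y - 1) * y / 2) + y / 2).
Proof.
  assert (Ha := is_derive_leafv e u y). unfold leafN2. auto_derive.
  - repeat split; eexists; eassumption.
  - derive_value Ha. field.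
Qed.

Lemma harg_bound X Y : - PI < harg X Y < PI.
Proof. unfold harg. generalize (atan_bound (Y / (sqrt (X ^ 2 + Y ^ 2) + X))). lra. Qed.

(** Up to a deck translation this is the inversion formula of the chart. The bounds on [fst p]
    describe the open interval of length [2 PI] in which [psiB e off] takes its first coordinate, so
    the translation is trivial. *)
Lemma leaf_param e off p : sheet e off -> 0 < e * qf (fst p) (snd p) ->
  off - PI / 2 < fst p < off + 3 * PI / 2 ->
  let y := 2 * cos (fst p) * qf (fst p) (snd p) in
  leaf e off (rf (fst p) (snd p) / qf (fst p) (snd p) + 2 * af e y) y = p.
Proof.
  intros Hsh Hq Hb y. assert (Hpi := PI_RGT_0).
  destruct (full_chart_B e off Hsh) as [_ [_ [_ [_ [_ [_ [_ H]]]]]]].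
  specialize (H p Hq). destruct H as [z Hz].
  assert (E : psiB e off (phiB e p) =
    leaf e off (rf (fst p) (snd p) / qf (fst p) (snd p) + 2 * af e y) y).
  { unfold leaf, phiB. fold y. cbv zeta. f_equal. f_equal. ring. }
  rewrite E in Hz.
  set (l := leaf e off (rf (fst p) (snd p) / qf (fst p) (snd p) + 2 * af e y) y) in *.
  assert (Hl : off - PI / 2 < fst l < off + 3 * PI / 2).
  { unfold l, leaf, psiB; cbn [fst snd].
    match goal with |- context [harg ?a ?b] => generalize (harg_bound a b) end. lra. }
  assert (Hz1 : fst p = fst l + IZR z * (2 * PI)) by (rewrite Hz at 1; reflexivity).
  assert (Hz2 : snd p = snd l) by (rewrite Hz at 1; reflexivity).
  assert (z0 : z = 0%Z).
  { apply IZR_eq_0_of_small. apply Rabs_def1; nra. }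
  subst z. rewrite (surjective_pairing p), (surjective_pairing l). f_equal; auto.
  rewrite Hz1. ring.
Qed.

(* Limit of the heights on the transversal [x = PI] of the null geodesics through
   [(x, t)] as [t] goes to infinity: the upper boundary.  It is [C^1] but not [C^2]
   across [PI / 2], where [e] changes sign. *)
Definition Xb (e x : R) : R := - cos x / (sin x + e * cos x / 2).

(** Doubled, this is the value [- e / 2] of [tan al - tan be] on the boundary, since that difference
    is [2 / y + 2 af e y]. *)
Lemma is_lim_af e : is_lim (af e) p_infty (- e / 4).
Proof.
  assert (Hb : is_lim (fun y => bump 0 (y - 1)) p_infty 1).
  { apply is_lim_le_le_loc with (fun y => 1 - / (y - 1)) (fun _ => 1).
    - exists 2. intros y Hy. split; [apply bump0_lower; lra | apply bump0_le1].
    - assert (Hi : is_lim (fun y => / (y - 1)) p_infty (Rbar_inv p_infty)).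
      { apply is_lim_inv; [|easy].
        eapply is_lim_minus; [apply is_lim_id|apply is_lim_const|]. easy. }
      replace (Finite 1) with (Finite (1 - 0)) by (f_equal; ring).
      apply (is_lim_minus' (fun _ => 1) (fun y => / (y - 1))); [apply is_lim_const|exact Hi].
    - apply is_lim_const. }
  unfold af. apply is_lim_ext with (fun y => (- e / 4) * bump 0 (y - 1)).
  { intros; field. }
  replace (Finite (- e / 4)) with (Rbar_mult (- e / 4) 1) by (simpl; f_equal; ring).
  apply is_lim_scal_l. exact Hb.
Qed.

(** * The conformal boundary *)

(* The two null coordinates of a conformal map to a flat cylinder. *)
Definition null_pair (f g : R -> R -> R) : Prop :=
  Cn_on 2 (fun _ _ => True) f /\ Cn_on 2 (fun _ _ => True) g /\
  (forall x t t', f x t = f x t') /\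
  (forall x t, Derive (fun z => f z t) x <> 0) /\
  (forall x t, Derive (fun z => g x z) t <> 0) /\
  (forall e off u y y', sheet e off ->
     g (fst (leaf e off u y)) (snd (leaf e off u y)) =
     g (fst (leaf e off u y')) (snd (leaf e off u y'))).

(* The null geodesic through [(x, t)] meets the transversal [x = PI] at height
   [iota e x t]. *)
Definition iota (e x t : R) : R :=
  qf x t / (rf x t + 2 * af e (2 * cos x * qf x t) * qf x t).

Lemma is_lim_mult_finite (f g : R -> R) (x : Rbar) (lf lg : R) :
  is_lim f x lf -> is_lim g x lg -> is_lim (fun y => f y * g y) x (lf * lg).
Proof. intros Hf Hg. now apply (is_lim_mult f g x lf lg). Qed.

Lemma is_lim_inv_infty : is_lim (fun t => / t) p_infty 0.
Proof. apply (is_lim_inv (fun t => t) p_infty p_infty); [apply is_lim_id | easy]. Qed.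

Lemma is_lim_shift_inv a b : is_lim (fun t => a + b / t) p_infty a.
Proof.
  replace (Finite a) with (Finite (a + b * 0)) by (f_equal; ring).
  apply (is_lim_plus' (fun _ => a) (fun t => b / t)); [apply is_lim_const|].
  apply (is_lim_mult_finite (fun _ => b) (fun t => / t)); [apply is_lim_const|apply is_lim_inv_infty].
Qed.

Lemma is_lim_iota e x : e = 1 \/ e = - 1 -> 0 <= e * cos x ->
  0 < sin x ->
  is_lim (fun t => (rf x t + 2 * af e (2 * cos x * qf x t) * qf x t) / t) p_infty
    (- sin x - e * cos x / 2) /\
  is_lim (iota e x) p_infty (Xb e x).
Proof.
  intros He Hc Hs.
  assert (Hq := is_lim_shift_inv (cos x) (sin x)).
  assert (Hr := is_lim_shift_inv (- sin x) (cos x)).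
  assert (Ha : is_lim (fun t => 2 * af e (2 * cos x * qf x t) * (cos x + sin x / t)) p_infty (- e * cos x / 2)).
  { destruct (Req_dec (cos x) 0) as [E|E].
    - rewrite E. apply is_lim_ext with (fun _ => 0).
      + intros t. rewrite Rmult_0_r, Rmult_0_l, af_small by lra. ring.
      + replace (- e * 0 / 2) with 0 by field. apply is_lim_const.
    - replace (Finite (- e * cos x / 2)) with (Finite (2 * (- e / 4) * cos x)) by (f_equal; field).
      apply (is_lim_mult_finite (fun t => 2 * af e (2 * cos x * qf x t)) (fun t => cos x + sin x / t)); auto.
      apply (is_lim_mult_finite (fun _ => 2) (fun t => af e (2 * cos x * qf x t))); [apply is_lim_const|].
      apply (is_lim_comp (af e) (fun t => 2 * cos x * qf x t) p_infty (- e / 4) p_infty).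
      + apply is_lim_af.
      + apply is_lim_ext with (fun t => 2 * cos x ^ 2 * t + 2 * cos x * sin x).
        { intros; unfold qf; ring. }
        eapply is_lim_plus; [apply is_lim_scal_l, is_lim_id|apply is_lim_const|].
        assert (0 < 2 * cos x ^ 2) by nra.
        unfold Rbar_mult, Rbar_mult'. destruct (Rle_dec 0 (2 * cos x ^ 2)) as [L|L]; [|lra].
        destruct (Rle_lt_or_eq_dec 0 (2 * cos x ^ 2) L); [easy|lra].
      + exists 0. intros; easy. }
  assert (Hd : is_lim (fun t => (rf x t + 2 * af e (2 * cos x * qf x t) * qf x t) / t) p_infty
    (- sin x - e * cos x / 2)).
  { apply is_lim_ext_loc with (fun t => (- sin x + cos x / t) + 2 * af e (2 * cos x * qf x t) * (cos x + sin x / t)).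
    - exists 0. intros t Ht. unfold rf.
      replace (qf x t) with (t * (cos x + sin x / t)) at 3 by (unfold qf; field; lra). field. lra.
    - replace (Finite (- sin x - e * cos x / 2)) with (Finite (- sin x + (- e * cos x / 2))) by (f_equal; field).
      now apply (is_lim_plus' (fun t => - sin x + cos x / t)). }
  split; auto.
  assert (Hne : - sin x - e * cos x / 2 <> 0) by lra.
  apply is_lim_ext_loc with (fun t => (cos x + sin x / t) *
    / ((rf x t + 2 * af e (2 * cos x * qf x t) * qf x t) / t)).
  - assert (L : Rbar_locally p_infty (fun t => (rf x t + 2 * af e (2 * cos x * qf x t) * qf x t) / t < 0)).
    { apply (Hd (fun z => z < 0)). apply (open_lt 0). lra. }
    assert (L0 : Rbar_locally p_infty (fun t => 0 < t)) by (exists 0; auto).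
    generalize (filter_and _ _ L L0). apply filter_imp. intros t [Ht Ht0].
    unfold iota. replace (cos x + sin x / t) with (qf x t / t) by (unfold qf; field; lra).
    field. split; [|lra]. intros E. rewrite E in Ht. unfold Rdiv in Ht. lra.
  - replace (Finite (Xb e x)) with (Finite (cos x * / (- sin x - e * cos x / 2))).
    2:{ f_equal. unfold Xb. field. lra. }
    apply (is_lim_mult_finite (fun t => cos x + sin x / t)); auto.
    apply (is_lim_inv _ p_infty (Finite (- sin x - e * cos x / 2))); auto.
    intros E; injection E; auto.
Qed.

(* The angles near [PI / 2] at which the upper boundary is reached inside the
   sheet [e]; [PI] is the transversal on which [g] is read off. *)
Definition boundary_angle (e off x : R) : Prop :=
  sheet e off /\ off - PI / 2 < x < off + 3 * PI / 2 /\
  off - PI / 2 < PI < off + 3 * PI / 2 /\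
  0 <= e * cos x /\ (cos x = 0 -> e = 1) /\ 2 * (e * cos x) < sin x.

(** The points [(x, t)] and [(PI, iota e x t)] lie on the same transverse null leaf, so
    [g x t = g PI (iota e x t)], and [iota] converges to [Xb]. *)
Lemma null_pair_limit f g e off x : null_pair f g -> boundary_angle e off x ->
  is_lim (g x) p_infty (g PI (Xb e x)).
Proof.
  intros [_ [Hg [_ [_ [_ Hleaf]]]]] [Hsh [Hx [Hpi [Hc [Hc0 Hs]]]]].
  assert (He : e = 1 \/ e = - 1) by apply Hsh.
  assert (Hs0 : 0 < sin x) by lra.
  destruct (is_lim_iota e x He Hc Hs0) as [Hd Hi].
  apply is_lim_ext_loc with (fun t => g PI (iota e x t)).
  2:{ apply (is_lim_comp_continuous (iota e x) (g PI)); auto.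
      apply (ex_derive_continuous (K := R_AbsRing) (V := R_NormedModule)).
      eexists. apply (Cn_on_is_derive2 1 _ g PI _ Hg I). }
  assert (L1 : Rbar_locally p_infty (fun t => (rf x t + 2 * af e (2 * cos x * qf x t) * qf x t) / t < 0)).
  { apply (Hd (fun z => z < 0)). apply (open_lt 0). lra. }
  (* At height [w] on the transversal [x = PI] one has [y = 2 w]; below height 1/2 the perturbation
     is absent and [iota] is the height at which the leaf crosses. *)
  assert (L2 : Rbar_locally p_infty (fun t => iota e x t < / 2)).
  { apply (Hi (fun z => z < / 2)). apply (open_lt (/ 2)). unfold Xb.
    assert (Hp : 0 < sin x + e * cos x / 2) by lra.
    apply Rmult_lt_reg_r with (sin x + e * cos x / 2); auto.
    unfold Rdiv. rewrite Rmult_assoc, Rinv_l, Rmult_1_r by lra.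
    destruct He as [-> | ->]; lra. }
  assert (L3 : Rbar_locally p_infty (fun t => 0 < e * qf x t)).
  { destruct (Req_dec (cos x) 0) as [E|E].
    - exists 0. intros t _. unfold qf. rewrite E, (Hc0 E). lra.
    - assert (Hec : 0 < e * cos x) by (destruct He as [-> | ->]; lra).
      exists (/ (e * cos x)). intros t Ht. unfold qf.
      assert (1 < e * cos x * t).
      { apply Rmult_lt_reg_r with (/ (e * cos x)); [now apply Rinv_0_lt_compat|].
        replace (e * cos x * t * / (e * cos x)) with t by (field; split; destruct He; lra). lra. }
      generalize (SIN_bound x). destruct He as [-> | ->]; lra. }
  assert (L0 : Rbar_locally p_infty (fun t => 0 < t)) by (exists 0; auto).
  generalize (filter_and _ _ L0 (filter_and _ _ L1 (filter_and _ _ L2 L3))).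
  apply filter_imp. intros t [H0 [H1 [H2 H3]]].
  set (a := af e (2 * cos x * qf x t)) in *.
  assert (Hneg : rf x t + 2 * a * qf x t < 0).
  { apply Rmult_lt_reg_r with (/ t); [now apply Rinv_0_lt_compat|]. rewrite Rmult_0_l. exact H1. }
  assert (Hq0 : qf x t <> 0) by (intros E; rewrite E in H3; lra).
  set (w := iota e x t) in *.
  assert (Hw : w = qf x t / (rf x t + 2 * a * qf x t)) by reflexivity.
  (* As [qf PI w = - w], this sign places [(PI, w)] in the domain [UB e], where the leaves of the
     sheet [e] are parametrized. *)
  assert (Hew : e * w < 0).
  { rewrite Hw. replace (e * (qf x t / (rf x t + 2 * a * qf x t))) with
      (- (e * qf x t / (- (rf x t + 2 * a * qf x t)))) by (field; lra).
    assert (0 < e * qf x t / - (rf x t + 2 * a * qf x t)) by (apply Rdiv_lt_0_compat; lra). lra. }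
  assert (Hw0 : w <> 0) by (intros E; rewrite E in Hew; lra).
  assert (P1 := leaf_param e off (x, t) Hsh H3 Hx). cbn [fst snd] in P1. fold a in P1.
  assert (Hq1 : qf PI w = - w) by (unfold qf; rewrite cos_PI, sin_PI; ring).
  assert (Hr1 : rf PI w = - 1) by (unfold rf; rewrite cos_PI, sin_PI; ring).
  assert (P2 := leaf_param e off (PI, w) Hsh). cbn [fst snd] in P2.
  rewrite Hq1, Hr1, cos_PI in P2.
  specialize (P2 ltac:(lra) Hpi). cbv zeta in P2. rewrite (af_small e (2 * -1 * - w)) in P2 by lra.
  replace (-1 / - w + 2 * 0) with (rf x t / qf x t + 2 * a) in P2.
  2:{ rewrite Hw. field. repeat split; auto; lra. }
  assert (HL := Hleaf e off (rf x t / qf x t + 2 * a) (2 * cos x * qf x t) (2 * -1 * - w) Hsh).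
  rewrite P1, P2 in HL. cbn [fst snd] in HL. now symmetry.
Qed.

(** Consequence of injectivity modulo deck translations. Both null coordinates move by the same
    multiple of [P] because a translation affects only the space coordinate of the target. *)
Definition separates (f g : R -> R -> R) (P : R) : Prop :=
  forall x1 t1 x2 t2 z, f x2 t2 = f x1 t1 + IZR z * P ->
    g x2 t2 = g x1 t1 + IZR z * P -> t1 = t2.

(* A preimage of a limit of [g x] along a null leaf would have neighbours with the
   same image as points far out on that leaf, against injectivity. *)
Lemma boundary_not_hit (f g : R -> R -> R) (P L x : R) :
  (forall x t t', f x t = f x t') ->
  (forall x, continuity (g x)) ->
  (forall x, (forall t t', t < t' -> g x t < g x t') \/ (forall t t', t < t' -> g x t' < g x t)) ->
  separates f g P -> is_lim (g x) p_infty L ->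
  forall x' t' z, f x' t' = f x 0 + IZR z * P -> g x' t' = L + IZR z * P -> False.
Proof.
  intros Hf Hc Hm Hinj HL x' t' z Ef Eg.
  assert (Hmid : (g x' (t' - 1) < g x' t' < g x' (t' + 1)) \/ (g x' (t' + 1) < g x' t' < g x' (t' - 1))).
  { destruct (Hm x') as [H|H]; [left|right]; split; apply H; lra. }
  set (d := Rmin (Rabs (g x' (t' + 1) - g x' t')) (Rabs (g x' t' - g x' (t' - 1)))).
  assert (Hd : 0 < d).
  { apply Rmin_glb_lt; apply Rabs_pos_lt; lra. }
  apply is_lim_spec in HL. unfold is_lim', Rbar_locally' in HL. destruct (HL (mkposreal d Hd)) as [T HT]. simpl in HT.
  set (t := Rmax (T + 1) (t' + 2)).
  assert (Ht1 : T < t) by (generalize (Rmax_l (T + 1) (t' + 2)); unfold t; lra).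
  assert (Ht2 : t' + 2 <= t) by apply Rmax_r.
  specialize (HT t Ht1).
  set (v := g x t + IZR z * P).
  assert (Hv1 : Rabs (v - g x' t') < Rabs (g x' (t' + 1) - g x' t')).
  { apply Rlt_le_trans with d; [|apply Rmin_l]. unfold v. rewrite Eg.
    replace (g x t + IZR z * P - (L + IZR z * P)) with (g x t - L) by ring. exact HT. }
  assert (Hv2 : Rabs (v - g x' t') < Rabs (g x' t' - g x' (t' - 1))).
  { apply Rlt_le_trans with d; [|apply Rmin_r]. unfold v. rewrite Eg.
    replace (g x t + IZR z * P - (L + IZR z * P)) with (g x t - L) by ring. exact HT. }
  assert (Hex : exists t'', t' - 1 <= t'' <= t' + 1 /\ g x' t'' = v).
  { assert (Hcont : forall s, continuity_pt (fun s => g x' s - v) s).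
    { intros s. apply continuity_pt_minus; [apply Hc|]. apply continuity_pt_const. now intros a b. }
    apply Rabs_def2 in Hv1 as Hv1'. apply Rabs_def2 in Hv2 as Hv2'.
    destruct Hmid as [[M1 M2]|[M1 M2]].
    - rewrite Rabs_pos_eq in Hv1', Hv2' by lra.
      destruct (Ranalysis5.IVT_interv (fun s => g x' s - v) (t' - 1) (t' + 1)) as [s [Hs1 Hs2]];
        try lra; auto.
      exists s. split; lra.
    - rewrite Rabs_left in Hv1', Hv2' by lra.
      destruct (Ranalysis5.IVT_interv (fun s => - (g x' s - v)) (t' - 1) (t' + 1)) as [s [Hs1 Hs2]];
        try lra.
      + intros a _. now apply continuity_pt_opp.
      + exists s. split; lra. }
  destruct Hex as [t'' [Ht'' Hg'']].
  assert (E := Hinj x t x' t'' z). rewrite (Hf x' t'' t'), (Hf x t 0) in E.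
  specialize (E Ef Hg''). lra.
Qed.

Lemma null_pair_monotone f g : null_pair f g -> forall x,
  (forall t t', t < t' -> g x t < g x t') \/ (forall t t', t < t' -> g x t' < g x t).
Proof.
  intros [_ [Hg [_ [_ [Hn _]]]]] x.
  assert (Hd : forall t, is_derive (g x) t (Derive (g x) t)).
  { intros t. apply (Cn_on_is_derive2 1 _ g x t Hg I). }
  assert (Hc : forall t, continuity_pt (Derive (g x)) t).
  { intros t. eapply is_derive_continuity_pt.
    apply (Cn_on_is_derive2 0 _ _ x t (Cn_on_partial2 _ _ _ Hg) I). }
  assert (Hs := nonvanishing_sign (Derive (g x)) m_infty p_infty (fun t _ => Hc t) (fun t _ => Hn x t)).
  destruct (Rtotal_order (Derive (g x) 0) 0) as [L|[L|L]].
  - right. intros t t' Htt.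
    assert (H : - g x t < - g x t').
    { apply (strictly_increasing_of_derive (fun t => - g x t) (fun t => - Derive (g x) t)); auto.
      - intros s. now apply (is_derive_opp (g x)).
      - intros s. assert (H := Hs 0 s). assert (0 < Derive (g x) 0 * Derive (g x) s) by (apply H; now split). nra. }
    lra.
  - now elim (Hn x 0).
  - left. apply (strictly_increasing_of_derive (g x) (Derive (g x))); auto.
    intros s. assert (H := Hs 0 s). assert (0 < Derive (g x) 0 * Derive (g x) s) by (apply H; now split). nra.
Qed.

Lemma null_pair_not_hit f g P e off x : null_pair f g ->
  boundary_angle e off x -> separates f g P ->
  forall x' t' z, f x' t' = f x 0 + IZR z * P -> g x' t' = g PI (Xb e x) + IZR z * P -> False.
Proof.
  intros Hfg Hx Hinj.
  apply boundary_not_hit; auto.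
  - apply Hfg.
  - intros x0 t. destruct Hfg as [_ [Hg _]]. eapply is_derive_continuity_pt.
    apply (Cn_on_is_derive2 1 _ g x0 t Hg I).
  - now apply (null_pair_monotone f).
  - now apply (null_pair_limit f g e off x).
Qed.

(** * Second-order conditions at a corner *)

Lemma one_sided_zero (N : R -> R) (x0 d sg del : R) : sg = 1 \/ sg = - 1 -> 0 < del ->
  is_derive N x0 d -> (forall k, 0 < k < del -> N (x0 + sg * k) = 0) -> N x0 = 0 /\ d = 0.
Proof.
  intros Hsg Hdel HN H0. apply is_derive_Reals in HN.
  assert (Hk : forall eps, 0 < eps -> exists del', 0 < del' /\ forall k, 0 < k < del' ->
    Rabs (- N x0 / (sg * k) - d) < eps).
  { intros eps He. destruct (HN eps He) as [d1 Hd1].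
    exists (Rmin del d1). split; [apply Rmin_glb_lt; [auto|apply cond_pos]|].
    intros k [Hk1 Hk2].
    assert (k < del) by (apply Rlt_le_trans with (1 := Hk2), Rmin_l).
    assert (k < d1) by (apply Rlt_le_trans with (1 := Hk2), Rmin_r).
    assert (Hsk : sg * k <> 0) by (destruct Hsg as [-> | ->]; lra).
    assert (Hab : Rabs (sg * k) < d1).
    { destruct Hsg as [-> | ->]; [rewrite Rabs_pos_eq|rewrite Rabs_left]; lra. }
    specialize (Hd1 _ Hsk Hab). rewrite H0 in Hd1 by lra.
    replace (- N x0 / (sg * k)) with ((0 - N x0) / (sg * k)) by (field; destruct Hsg; lra). exact Hd1. }
  assert (E0 : N x0 = 0).
  { destruct (Req_dec (N x0) 0) as [E|E]; auto. exfalso.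
    destruct (Hk 1 Rlt_0_1) as [d1 [Hd1 H1]].
    assert (Hp : 0 < Rabs (N x0)) by now apply Rabs_pos_lt.
    assert (Hq : 0 < Rabs d + 1) by (generalize (Rabs_pos d); lra).
    set (k := Rmin (d1 / 2) (Rabs (N x0) / (Rabs d + 1))).
    assert (Hk0 : 0 < k).
    { apply Rmin_glb_lt; [lra|now apply Rdiv_lt_0_compat]. }
    assert (Hk1 : k < d1) by (apply Rle_lt_trans with (1 := Rmin_l _ _); lra).
    assert (Hk2 : k * (Rabs d + 1) <= Rabs (N x0)).
    { apply Rmult_le_reg_r with (/ (Rabs d + 1)); [now apply Rinv_0_lt_compat|].
      rewrite Rmult_assoc, Rinv_r, Rmult_1_r by lra. apply Rmin_r. }
    specialize (H1 k (conj Hk0 Hk1)).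
    assert (Ha : Rabs (N x0) / k < Rabs d + 1).
    { replace (Rabs (N x0) / k) with (Rabs (- N x0 / (sg * k))).
      - replace (- N x0 / (sg * k)) with ((- N x0 / (sg * k) - d) + d) by ring.
        apply Rle_lt_trans with (1 := Rabs_triang _ _). lra.
      - unfold Rdiv. rewrite Rabs_mult, Rabs_Ropp, Rabs_inv, Rabs_mult.
        rewrite (Rabs_pos_eq k) by lra.
        replace (Rabs sg) with 1; [now rewrite Rmult_1_l|].
        destruct Hsg as [-> | ->]; [rewrite Rabs_pos_eq|rewrite Rabs_left]; lra. }
    assert (Rabs (N x0) < (Rabs d + 1) * k).
    { apply Rmult_lt_reg_r with (/ k); [now apply Rinv_0_lt_compat|].
      rewrite Rmult_assoc, Rinv_r, Rmult_1_r by lra. exact Ha. }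
    lra. }
  split; auto.
  destruct (Req_dec d 0) as [E|E]; auto. exfalso.
  destruct (Hk (Rabs d) (Rabs_pos_lt _ E)) as [d1 [Hd1 H1]].
  specialize (H1 (d1 / 2) ltac:(lra)). rewrite E0 in H1.
  replace (- 0 / (sg * (d1 / 2)) - d) with (- d) in H1 by (field; destruct Hsg as [-> | ->]; lra).
  rewrite Rabs_Ropp in H1. lra.
Qed.

Lemma locally_delta (P : R -> Prop) (x0 : R) : locally x0 P ->
  exists d, 0 < d /\ forall x, Rabs (x - x0) < d -> P x.
Proof.
  intros [d Hd]. exists d. split; [apply cond_pos|]. intros x Hx. now apply Hd.
Qed.

Lemma open2_along_curve D (u v : R -> R) (x0 : R) : open2 D -> continuous u x0 -> continuous v x0 ->
  D (u x0) (v x0) -> locally x0 (fun x => D (u x) (v x)).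
Proof.
  intros Ho Hu Hv Hd. destruct (Ho _ _ Hd) as [d H].
  assert (L1 : locally x0 (fun x => Rabs (u x - u x0) < d)).
  { apply (Hu (fun z => Rabs (z - u x0) < d)). exists d. intros z Hz. exact Hz. }
  assert (L2 : locally x0 (fun x => Rabs (v x - v x0) < d)).
  { apply (Hv (fun z => Rabs (z - v x0) < d)). exists d. intros z Hz. exact Hz. }
  generalize (filter_and _ _ L1 L2). apply filter_imp. intros x [H1 H2]. now apply H.
Qed.

(** Each half of the boundary is a restriction of a curve that is smooth enough on both sides of
    [x0]. The derivative [N] of [h] along that curve vanishes on one side only, yet this determines
    [N] and [N'] at [x0]: they are the first and second order conditions. *)
Lemma level_curve_one_side D h (u v u' v' : R -> R) (x0 u2 v2 sg del : R) :
  open2 D -> Cn_on 2 D h -> D (u x0) (v x0) ->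
  locally x0 (fun x => is_derive u x (u' x)) -> locally x0 (fun x => is_derive v x (v' x)) ->
  is_derive u' x0 u2 -> is_derive v' x0 v2 ->
  sg = 1 \/ sg = - 1 -> 0 < del ->
  (forall k, 0 < k < del -> h (u (x0 + sg * k)) (v (x0 + sg * k)) = 0) ->
  let h1 := fun a b => Derive (fun z => h z b) a in
  let h2 := fun a b => Derive (fun z => h a z) b in
  let a := u x0 in let b := v x0 in let p := u' x0 in let q := v' x0 in
  h1 a b * p + h2 a b * q = 0 /\
  (Derive (fun z => h1 z b) a * p + Derive (fun z => h1 a z) b * q) * p
  + (Derive (fun z => h2 z b) a * p + Derive (fun z => h2 a z) b * q) * q
  + h1 a b * u2 + h2 a b * v2 = 0.
Proof.
  intros Ho Hh Hd Hu Hv Hu2 Hv2 Hsg Hdel H0 h1 h2 a b p q.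
  assert (C1 := Cn_on_partial1 1 D h Hh). assert (C2 := Cn_on_partial2 1 D h Hh).
  fold h1 in C1. fold h2 in C2.
  assert (Du := locally_singleton _ _ Hu). assert (Dv := locally_singleton _ _ Hv). simpl in Du, Dv.
  assert (N1 := Cn_on_curve 0 D h1 u v x0 _ _ Ho C1 Hd Du Dv).
  assert (N2 := Cn_on_curve 0 D h2 u v x0 _ _ Ho C2 Hd Du Dv).
  set (n1 := fun x => h1 (u x) (v x)) in *. set (n2 := fun x => h2 (u x) (v x)) in *.
  set (N := fun x => n1 x * u' x + n2 x * v' x).
  assert (HN : is_derive N x0
    ((Derive (fun z => h1 z b) a * p + Derive (fun z => h1 a z) b * q) * p
     + (Derive (fun z => h2 z b) a * p + Derive (fun z => h2 a z) b * q) * q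
     + h1 a b * u2 + h2 a b * v2)).
  { unfold N. auto_derive.
    - repeat split; eexists; eassumption.
    - replace (Derive (fun x : R => n1 x) x0) with (Derive n1 x0) by reflexivity.
      replace (Derive (fun x : R => n2 x) x0) with (Derive n2 x0) by reflexivity.
      rewrite (is_derive_unique n1 x0 _ N1), (is_derive_unique n2 x0 _ N2).
      replace (Derive (fun x : R => u' x) x0) with u2 by (symmetry; now apply is_derive_unique).
      replace (Derive (fun x : R => v' x) x0) with v2 by (symmetry; now apply is_derive_unique).
      unfold n1, n2, p, q, a, b. ring. }
  assert (HD := open2_along_curve D u v x0 Ho (is_derive_continuous _ _ _ Du) (is_derive_continuous _ _ _ Dv) Hd).
  destruct (locally_delta _ _ (filter_and _ _ HD (filter_and _ _ Hu Hv))) as [d1 [Hd1 H1]].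
  apply (one_sided_zero N x0 _ sg (Rmin del d1)); auto.
  - apply Rmin_glb_lt; auto.
  - intros k [Hk1 Hk2]. set (x := x0 + sg * k).
    assert (k < del) by (apply Rlt_le_trans with (1 := Hk2), Rmin_l).
    assert (k < d1) by (apply Rlt_le_trans with (1 := Hk2), Rmin_r).
    assert (Hx : Rabs (x - x0) < d1).
    { unfold x. destruct Hsg as [-> | ->]; [rewrite Rabs_pos_eq|rewrite Rabs_left]; lra. }
    destruct (H1 x Hx) as [Dx [Ux Vx]].
    assert (HNx := Cn_on_curve 1 D h u v x _ _ Ho Hh Dx Ux Vx).
    assert (Hz : is_derive (fun s => h (u s) (v s)) x 0).
    { apply is_derive_ext_loc with (fun _ => 0).
      - exists (mkposreal (Rmin k (del - k)) ltac:(apply Rmin_glb_lt; lra)). intros y Hy.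
        unfold ball in Hy; simpl in Hy; unfold AbsRing_ball, abs, minus, plus, opp in Hy; simpl in Hy.
        assert (Hy1 : Rabs (y + - x) < k) by (apply Rlt_le_trans with (1 := Hy), Rmin_l).
        assert (Hy2 : Rabs (y + - x) < del - k) by (apply Rlt_le_trans with (1 := Hy), Rmin_r).
        apply Rabs_def2 in Hy1. apply Rabs_def2 in Hy2. unfold x in Hy1, Hy2.
        symmetry. replace y with (x0 + sg * (sg * (y - x0))).
        + apply H0. destruct Hsg as [-> | ->]; lra.
        + destruct Hsg as [-> | ->]; ring.
      - apply is_derive_cst. }
    apply is_derive_unique in HNx. apply is_derive_unique in Hz. rewrite Hz in HNx.
    unfold N, n1, n2. symmetry. exact HNx.
Qed.

Definition dXb (e x : R) : R := / (sin x + e * cos x / 2) ^ 2.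

Lemma Xb_half_pi e : Xb e (PI / 2) = 0 /\ dXb e (PI / 2) = 1.
Proof. unfold Xb, dXb. rewrite cos_PI2, sin_PI2. split; field. Qed.

Lemma is_derive_Xb e x : sin x + e * cos x / 2 <> 0 -> is_derive (Xb e) x (dXb e x).
Proof.
  intros H.
  replace (dXb e x) with ((sin x ^ 2 + cos x ^ 2) / (sin x + e * cos x / 2) ^ 2)
    by (unfold dXb; rewrite sincos1; unfold Rdiv; ring).
  unfold Xb. auto_derive; auto. field. intros E; apply H; lra.
Qed.

(** The source of the jump: value and slope of [Xb] at [PI / 2] do not depend on [e], the second
    derivative does. *)
Lemma is_derive_dXb_half_pi e : is_derive (dXb e) (PI / 2) e.
Proof.
  assert (H : sin (PI / 2) + e * cos (PI / 2) / 2 <> 0) by (rewrite cos_PI2, sin_PI2; lra).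
  unfold dXb. auto_derive.
  - intros E; apply H. apply Rmult_integral in E. destruct E as [E|E]; [exact E|]. lra.
  - rewrite cos_PI2, sin_PI2. field.
Qed.

Definition boundary_coord (f g : R -> R -> R) (A B e x : R) : R := A * f x 0 + B * g PI (Xb e x).

Definition dboundary_coord (f g : R -> R -> R) (A B e x : R) : R :=
  A * Derive (fun z => f z 0) x + B * (Derive (g PI) (Xb e x) * dXb e x).

Lemma locally_Xb_denominator e : locally (PI / 2) (fun x => sin x + e * cos x / 2 <> 0).
Proof.
  assert (C0 : continuous (fun x => sin x + e * cos x / 2) (PI / 2)).
  { apply is_derive_continuous with (cos (PI / 2) - e * sin (PI / 2) / 2). auto_derive; auto. field. }
  apply (C0 (fun z => z <> 0)). apply open_neq. rewrite sin_PI2, cos_PI2. lra.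
Qed.

Lemma is_derive_boundary_coord f g A B e : null_pair f g ->
  locally (PI / 2) (fun x => is_derive (boundary_coord f g A B e) x (dboundary_coord f g A B e x)).
Proof.
  intros [Hf [Hg _]]. generalize (locally_Xb_denominator e). apply filter_imp. intros x Hx.
  assert (F1 := Cn_on_is_derive1 1 _ f x 0 Hf I).
  assert (G1 := Cn_on_is_derive2 1 _ g PI (Xb e x) Hg I).
  assert (GX := is_derive_comp (g PI) (Xb e) x _ _ G1 (is_derive_Xb e x Hx)).
  set (F := fun z => f z 0) in *. set (G := fun x => g PI (Xb e x)) in *.
  change (is_derive (fun x => A * F x + B * G x) x (dboundary_coord f g A B e x)).
  unfold scal in GX; simpl in GX; unfold mult in GX; simpl in GX.
  auto_derive.
  - repeat split; eexists; eassumption.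
  - replace (Derive (fun x : R => G x) x) with (dXb e x * Derive (fun z => g PI z) (Xb e x))
      by (symmetry; now apply is_derive_unique).
    unfold dboundary_coord. fold F. change (Derive (fun x : R => F x) x) with (Derive F x).
    change (Derive (fun z => g PI z) (Xb e x)) with (Derive (g PI) (Xb e x)). ring.
Qed.

Lemma is_derive_dboundary_coord f g A B e : null_pair f g -> is_derive (dboundary_coord f g A B e) (PI / 2)
  (A * Derive (Derive (fun z => f z 0)) (PI / 2)
   + B * (Derive (Derive (g PI)) 0 + Derive (g PI) 0 * e)).
Proof.
  intros [Hf [Hg _]].
  assert (F2 := Cn_on_is_derive1 0 _ _ (PI / 2) 0 (Cn_on_partial1 _ _ _ Hf) I). cbv beta in F2.
  assert (G2 := Cn_on_is_derive2 0 _ _ PI 0 (Cn_on_partial2 _ _ _ Hg) I). cbv beta in G2.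
  destruct (Xb_half_pi e) as [X0 X1].
  assert (Hx : sin (PI / 2) + e * cos (PI / 2) / 2 <> 0) by (rewrite cos_PI2, sin_PI2; lra).
  assert (HX := is_derive_Xb e _ Hx). assert (HdX := is_derive_dXb_half_pi e).
  assert (GX : is_derive (fun x => Derive (g PI) (Xb e x)) (PI / 2) (1 * Derive (Derive (g PI)) 0)).
  { apply (is_derive_comp (Derive (g PI)) (Xb e)); [rewrite X0; exact G2 | rewrite X1 in HX; exact HX]. }
  set (F := Derive (fun z => f z 0)). change (is_derive F (PI / 2) (Derive F (PI / 2))) in F2.
  set (G := fun x => Derive (g PI) (Xb e x)) in *.
  change (is_derive (fun x => A * F x + B * (G x * dXb e x)) (PI / 2)
    (A * Derive F (PI / 2) + B * (Derive (Derive (g PI)) 0 + Derive (g PI) 0 * e))).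
  auto_derive.
  - repeat split; eexists; eassumption.
  - replace (Derive (fun x : R => G x) (PI / 2)) with (1 * Derive (Derive (g PI)) 0)
      by (symmetry; now apply is_derive_unique).
    replace (Derive (fun x : R => dXb e x) (PI / 2)) with e
      by (symmetry; now apply is_derive_unique).
    change (Derive (fun x : R => F x) (PI / 2)) with (Derive F (PI / 2)).
    rewrite X1. unfold G. rewrite X0. ring.
Qed.

(** The two arcs have the same point and velocity at the corner, and their second-order conditions
    agree except for the term with [Xb'']. So [h] has zero derivative in the [g] direction; the
    first-order condition then gives the [f] direction, because [f] has nonzero slope. *)
Lemma null_pair_corner f g D h A1 B1 A2 B2 del : null_pair f g -> open2 D -> Cn_on 2 D h ->
  let a := A1 * f (PI / 2) 0 + B1 * g PI 0 in let b := A2 * f (PI / 2) 0 + B2 * g PI 0 in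
  D a b -> 0 < del ->
  (forall k, 0 < k < del ->
     h (boundary_coord f g A1 B1 1 (PI / 2 - k)) (boundary_coord f g A2 B2 1 (PI / 2 - k)) = 0) ->
  (forall k, 0 < k < del ->
     h (boundary_coord f g A1 B1 (- 1) (PI / 2 + k)) (boundary_coord f g A2 B2 (- 1) (PI / 2 + k)) = 0) ->
  let h1 := Derive (fun z => h z b) a in let h2 := Derive (fun z => h a z) b in
  h1 * A1 + h2 * A2 = 0 /\ h1 * B1 + h2 * B2 = 0.
Proof.
  intros Hfg Ho Hh a b Hd Hdel Hl Hr h1 h2.
  assert (Ea : forall e, boundary_coord f g A1 B1 e (PI / 2) = a).
  { intros e. unfold boundary_coord. now rewrite (proj1 (Xb_half_pi e)). }
  assert (Eb : forall e, boundary_coord f g A2 B2 e (PI / 2) = b).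
  { intros e. unfold boundary_coord. now rewrite (proj1 (Xb_half_pi e)). }
  assert (Edb : forall A B e, dboundary_coord f g A B e (PI / 2) = A * Derive (fun z => f z 0) (PI / 2) + B * Derive (g PI) 0).
  { intros A B e. unfold dboundary_coord. destruct (Xb_half_pi e) as [-> ->]. ring. }
  assert (S1 := fun H => level_curve_one_side D h (boundary_coord f g A1 B1 1) (boundary_coord f g A2 B2 1)
    (dboundary_coord f g A1 B1 1) (dboundary_coord f g A2 B2 1) (PI / 2) _ _ (- 1) del Ho Hh H
    (is_derive_boundary_coord f g A1 B1 1 Hfg) (is_derive_boundary_coord f g A2 B2 1 Hfg)
    (is_derive_dboundary_coord f g A1 B1 1 Hfg) (is_derive_dboundary_coord f g A2 B2 1 Hfg) (or_intror eq_refl) Hdel).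
  assert (S2 := fun H => level_curve_one_side D h (boundary_coord f g A1 B1 (- 1)) (boundary_coord f g A2 B2 (- 1))
    (dboundary_coord f g A1 B1 (- 1)) (dboundary_coord f g A2 B2 (- 1)) (PI / 2) _ _ 1 del Ho Hh H
    (is_derive_boundary_coord f g A1 B1 (- 1) Hfg) (is_derive_boundary_coord f g A2 B2 (- 1) Hfg)
    (is_derive_dboundary_coord f g A1 B1 (- 1) Hfg) (is_derive_dboundary_coord f g A2 B2 (- 1) Hfg) (or_introl eq_refl) Hdel).
  rewrite !Ea, !Eb, !Edb in S1, S2. cbv zeta in S1, S2.
  destruct (S1 Hd) as [S11 S12].
  { intros k Hk. replace (PI / 2 + -1 * k) with (PI / 2 - k) by ring. auto. }
  destruct (S2 Hd) as [_ S22].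
  { intros k Hk. replace (PI / 2 + 1 * k) with (PI / 2 + k) by ring. auto. }
  fold h1 h2 in S11, S12, S22.
  destruct Hfg as [_ [_ [_ [Hf [Hg _]]]]].
  assert (Hf0 := Hf (PI / 2) 0). assert (Hg0 : Derive (g PI) 0 <> 0) by apply (Hg PI 0).
  (* The difference of [S12] and [S22]; the factor 2 is [1 - (- 1)], the jump of the second
     derivative of [Xb]. *)
  assert (E2 : h1 * B1 + h2 * B2 = 0).
  { apply Rmult_eq_reg_l with (2 * Derive (g PI) 0); [|lra]. lra. }
  split; auto.
  apply Rmult_eq_reg_l with (Derive (fun z => f z 0) (PI / 2)); auto.
  replace (Derive (fun z => f z 0) (PI / 2) * (h1 * A1 + h2 * A2)) with
    ((h1 * (A1 * Derive (fun z => f z 0) (PI / 2) + B1 * Derive (g PI) 0)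
      + h2 * (A2 * Derive (fun z => f z 0) (PI / 2) + B2 * Derive (g PI) 0))
     - Derive (g PI) 0 * (h1 * B1 + h2 * B2)) by ring.
  rewrite S11, E2. ring.
Qed.

(** The boundary near the corner belongs to the sheet [e = 1] for smaller angles and to [e = - 1]
    for larger ones; [2 sin k < cos k] is the smallness needed in [boundary_angle]. *)
Lemma near_half_pi : exists del, 0 < del /\ boundary_angle 1 0 (PI / 2) /\
  forall k, 0 < k < del ->
    boundary_angle 1 0 (PI / 2 - k) /\ boundary_angle (- 1) PI (PI / 2 + k).
Proof.
  assert (C0 : continuous (fun k => cos k - 2 * sin k) 0).
  { apply is_derive_continuous with (- sin 0 - 2 * cos 0). auto_derive; auto. ring. }
  assert (L : locally 0 (fun k => 0 < cos k - 2 * sin k)).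
  { apply (C0 (fun z => 0 < z)). apply open_gt. rewrite cos_0, sin_0. lra. }
  destruct (locally_delta _ _ L) as [d [Hd H]].
  assert (Hpi := PI_RGT_0). assert (H0 := sheet_pos). assert (H1 := sheet_neg).
  exists (Rmin d (PI / 2)). split; [apply Rmin_glb_lt; lra|].
  split.
  { split; [exact H0|]. rewrite cos_PI2, sin_PI2. repeat split; lra. }
  intros k [Hk1 Hk2].
  assert (k < d) by (apply Rlt_le_trans with (1 := Hk2), Rmin_l).
  assert (k < PI / 2) by (apply Rlt_le_trans with (1 := Hk2), Rmin_r).
  specialize (H k ltac:(rewrite Rminus_0_r, Rabs_pos_eq; lra)).
  assert (Hs : 0 < sin k) by (apply sin_gt_0; lra).
  unfold boundary_angle.
  rewrite cos_minus, sin_minus, cos_plus, sin_plus, cos_PI2, sin_PI2.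
  split; (split; [assumption|repeat split; lra]).
Qed.

(** * A conformal embedding *)

(** The function [af] with the sign of the sheet built in, hence globally smooth. *)
Definition ah (x t : R) : R := - twist 0 (cos x) (2 * cos x * qf x t) / 4.
(** The null direction satisfies [tan be = - (rf / qf + 2 ah)]; [(betaX, betaY)] is the vector
    [(qf, - rf - 2 ah qf)] rotated by [PI / 2 - x]. *)
Definition betaX (x t : R) : R := 1 + 2 * cos x * qf x t * ah x t.
Definition betaY (x t : R) : R := t - 2 * ah x t * qf x t * sin x.

(* [x] and [beta] are the arguments of the two null directions. *)
Definition beta (x t : R) : R := x - PI / 2 + harg (betaX x t) (betaY x t).

Lemma ah_bound x t : Rabs (ah x t) <= / 4.
Proof.
  unfold ah. assert (H := twist0_bound (cos x) (2 * cos x * qf x t)).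
  apply Rabs_le_between in H. apply Rabs_le. lra.
Qed.

(** If [betaY = 0], then [betaX (1 - w) = 1] with [w = 2 cos x sin x ah], and [|ah| <= 1/4] makes
    [1 - w] positive. So [beta] is smooth on the whole plane. *)
Lemma betaX_pos x t : betaY x t = 0 -> 0 < betaX x t.
Proof.
  intros H. assert (H1 := sincos1 x).
  assert (Hq : qf x t = betaX x t * sin x + betaY x t * cos x).
  { unfold betaX, betaY, qf. ring. }
  rewrite H, Rmult_0_l, Rplus_0_r in Hq.
  assert (E : betaX x t = 1 + 2 * (cos x * sin x) * ah x t * betaX x t).
  { unfold betaX at 1. rewrite Hq. ring. }
  assert (Ha := ah_bound x t). apply Rabs_le_between in Ha.
  assert (Hcs : - 1 <= 2 * (cos x * sin x) <= 1).
  { generalize (pow2_ge_0 (cos x - sin x)) (pow2_ge_0 (cos x + sin x)). nra. }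
  set (w := 2 * (cos x * sin x) * ah x t) in *.
  assert (Hw : - / 2 <= w <= / 2) by (unfold w; nra).
  nra.
Qed.

Definition betaN2 (x t : R) : R := betaX x t ^ 2 + betaY x t ^ 2.

Lemma betaN2_pos x t : 0 < betaN2 x t.
Proof. apply norm_sq_pos. apply betaX_pos. Qed.

(** The differential of [beta] is the second null form [Ef dx + 2 Ff dt] divided by [4 betaN2]. Thus
    the metric is [4 betaN2 dx dbeta], conformal to the flat metric with null coordinates [x] and
    [beta]. *)
Lemma is_derive_beta (u v : R -> R) s u' v' : is_derive u s u' -> is_derive v s v' ->
  is_derive (fun s => beta (u s) (v s)) s
    ((Ef (u s) (v s) * u' + 2 * Ff (u s) (v s) * v') / (4 * betaN2 (u s) (v s))).
Proof.
  intros Hu Hv.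
  assert (Eu : Derive (fun x : R => u x) s = u') by now apply is_derive_unique.
  assert (Ev : Derive (fun x : R => v x) s = v') by now apply is_derive_unique.
  assert (Hy : is_derive (fun s => 2 * cos (u s) * qf (u s) (v s)) s
    (2 * (kf (u s) (v s) * u' + cos (u s) ^ 2 * v'))).
  { unfold qf, kf, rf, qf. auto_derive.
    - repeat split; first [eexists; eassumption | exact I].
    - rewrite Eu, Ev. ring. }
  assert (Ha : is_derive (fun s => ah (u s) (v s)) s
    (- (kf (u s) (v s) * u' + cos (u s) ^ 2 * v') * Kf (u s) (v s) / 2)).
  { assert (Hc : continuous (fun s => cos (u s)) s).
    { apply continuous_comp; [|apply continuous_cos]. now apply is_derive_continuous with u'. }
    assert (H := is_derive_twist 0 (fun s => cos (u s)) (fun s => 2 * cos (u s) * qf (u s) (v s)) s _ Hc Hy).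
    assert (H1 : cos (u s) = 0 -> 2 * cos (u s) * qf (u s) (v s) < 1) by (intros E; rewrite E; lra).
    specialize (H H1). simpl in H. unfold ah.
    set (T := fun s => twist 0 (cos (u s)) (2 * cos (u s) * qf (u s) (v s))) in *.
    change (is_derive (fun s => - T s / 4) s (- (kf (u s) (v s) * u' + cos (u s) ^ 2 * v') * Kf (u s) (v s) / 2)).
    auto_derive.
    - repeat split; eexists; eassumption.
    - derive_value H.
      unfold Kf. field. }
  assert (HX : is_derive (fun s => betaX (u s) (v s)) s
    (2 * (kf (u s) (v s) * u' + cos (u s) ^ 2 * v') * ah (u s) (v s)
     - cos (u s) * qf (u s) (v s) * (kf (u s) (v s) * u' + cos (u s) ^ 2 * v') * Kf (u s) (v s))).
  { unfold betaX. set (a := fun s => ah (u s) (v s)) in *.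
    set (Y := fun s => 2 * cos (u s) * qf (u s) (v s)) in *.
    change (is_derive (fun s => 1 + Y s * a s) s (2 * (kf (u s) (v s) * u' + cos (u s) ^ 2 * v') * a s
     - cos (u s) * qf (u s) (v s) * (kf (u s) (v s) * u' + cos (u s) ^ 2 * v') * Kf (u s) (v s))).
    assert (EY := is_derive_unique Y s _ Hy). assert (Ea := is_derive_unique a s _ Ha).
    auto_derive.
    - repeat split; eexists; eassumption.
    - change (Derive (fun x : R => a x) s) with (Derive a s). change (Derive (fun x : R => Y x) s) with (Derive Y s).
      rewrite Ea, EY. unfold Y. field. }
  assert (HY : is_derive (fun s => betaY (u s) (v s)) s
    (v' + (kf (u s) (v s) * u' + cos (u s) ^ 2 * v') * Kf (u s) (v s) * qf (u s) (v s) * sin (u s)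
     - 2 * ah (u s) (v s) * ((cos (u s) * v' + rf (u s) (v s) * u') * sin (u s) + qf (u s) (v s) * cos (u s) * u'))).
  { unfold betaY. set (a := fun s => ah (u s) (v s)) in *.
    assert (Hq : is_derive (fun s => qf (u s) (v s)) s (cos (u s) * v' + rf (u s) (v s) * u')).
    { unfold qf, rf. auto_derive; [repeat split; first [eexists; eassumption | exact I]|].
      rewrite Eu, Ev. ring. }
    set (Q := fun s => qf (u s) (v s)) in *.
    assert (Eq := is_derive_unique Q s _ Hq). assert (Ea := is_derive_unique a s _ Ha).
    change (is_derive (fun s => v s - 2 * a s * Q s * sin (u s)) s
      (v' + (kf (u s) (v s) * u' + cos (u s) ^ 2 * v') * Kf (u s) (v s) * Q s * sin (u s)
     - 2 * a s * ((cos (u s) * v' + rf (u s) (v s) * u') * sin (u s) + Q s * cos (u s) * u'))).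
    auto_derive.
    - repeat split; eexists; eassumption.
    - change (Derive (fun x : R => a x) s) with (Derive a s). change (Derive (fun x : R => Q x) s) with (Derive Q s).
      rewrite Ea, Eq, Eu, Ev. field. }
  eapply is_derive_eq.
  { unfold beta. apply (is_derive_plus (fun s => u s - PI / 2) (fun s => harg (betaX (u s) (v s)) (betaY (u s) (v s)))).
    - apply (is_derive_minus u (fun _ => PI / 2)); [exact Hu|].
      apply is_derive_cst.
    - apply (is_derive_harg (fun s => betaX (u s) (v s)) (fun s => betaY (u s) (v s)) s _ _
        (betaX_pos (u s) (v s)) HX HY). }
  assert (HN := betaN2_pos (u s) (v s)).
  fold (betaN2 (u s) (v s)). unfold minus, plus, opp, zero; simpl.
  apply Rmult_eq_reg_r with (betaN2 (u s) (v s)); [|lra].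
  field_simplify; [|lra|lra].
  unfold betaN2, betaX, betaY, Ff, sf, Ef, kf, rf, qf.
  assert (H1 := sincos1 (u s)). assert (H2 : sin (u s) ^ 2 = 1 - cos (u s) ^ 2) by lra.
  set (a := ah (u s) (v s)). set (K := Kf (u s) (v s)).
  field_simplify_eq. ring [H2].
Qed.

Lemma Cn_on_beta n : Cn_on n (fun _ _ => True) beta.
Proof.
  assert (Ho := open2_total).
  assert (Hq := Cn_on_qf n _ Ho).
  assert (Ht : Cn_on n (fun _ _ => True) ah).
  { unfold ah. assert (H := Cn_on_twist_pq 0 n). unfold Rdiv. smooth. }
  assert (HX : Cn_on n (fun _ _ => True) betaX) by (unfold betaX; smooth).
  assert (HY : Cn_on n (fun _ _ => True) betaY) by (unfold betaY; smooth).
  unfold beta. apply Cn_on_plus; [smooth|smooth|].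
  apply Cn_on_harg; auto. intros x y _. apply betaX_pos.
Qed.

Lemma beta_Zperiod x z t : beta (x + IZR z * (2 * PI)) t = beta x t + IZR z * (2 * PI).
Proof.
  unfold beta, betaX, betaY, ah. destruct (cos_sin_Zperiod x z) as [-> ->].
  destruct (qf_Zperiod x z t) as [-> _]. ring.
Qed.

Lemma is_derive_beta_t x t : is_derive (beta x) t (2 * Ff x t / (4 * betaN2 x t)).
Proof.
  eapply is_derive_eq.
  { apply (is_derive_beta (fun _ => x) (fun t => t) t 0 1).
    - apply is_derive_cst.
    - auto_derive; auto. }
  f_equal. ring.
Qed.

Lemma is_derive_beta_x x t : is_derive (fun z => beta z t) x (Ef x t / (4 * betaN2 x t)).
Proof.
  eapply is_derive_eq.
  { apply (is_derive_beta (fun x => x) (fun _ => t) x 1 0).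
    - auto_derive; auto.
    - apply is_derive_cst. }
  f_equal. ring.
Qed.

Definition emb (p : pt) : pt :=
  ((fst p + beta (fst p) (snd p)) / 2, (fst p - beta (fst p) (snd p)) / 2).

Lemma pullback_flat F i j x y : pullback flat_cylinder F i j x y =
  partial i (component F false) x y * partial j (component F false) x y
  - partial i (component F true) x y * partial j (component F true) x y.
Proof. unfold pullback, sum2; simpl. ring. Qed.

Lemma zoll_cyl_embedding : conformal_embedding zoll_cyl flat_cylinder emb.
Proof.
  split; [|split].
  - intros n. split.
    + intros p k. assert (Hb := Cn_on_beta n). destruct k.
      * apply (fun H : Cn_on n (fun _ _ => True) (fun x y => (x - beta x y) / 2) => H (fst p) (snd p) I).
        unfold Rdiv. smooth.
      * apply (fun H : Cn_on n (fun _ _ => True) (fun x y => (x + beta x y) / 2) => H (fst p) (snd p) I).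
        unfold Rdiv. smooth.
    + intros p q [z ->]. exists z. unfold emb; simpl. rewrite beta_Zperiod. f_equal; field.
  - intros p q [z Hz]. unfold emb in Hz; simpl in Hz. injection Hz as H1 H2.
    exists z. simpl.
    assert (E1 : fst q = fst p + IZR z * (2 * PI)) by lra.
    rewrite (surjective_pairing q). rewrite E1. f_equal.
    assert (E2 : beta (fst p) (snd q) = beta (fst p) (snd p)).
    { assert (E3 := beta_Zperiod (fst p) z (snd q)). rewrite <- E1 in E3. lra. }
    assert (Hinc := strictly_increasing_of_derive (beta (fst p)) _ (is_derive_beta_t (fst p))).
    assert (Hp : forall t, 0 < 2 * Ff (fst p) t / (4 * betaN2 (fst p) t)).
    { intros t. apply Rdiv_lt_0_compat; [generalize (Ff_pos (fst p) t); lra | generalize (betaN2_pos (fst p) t); lra]. }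
    destruct (Rtotal_order (snd p) (snd q)) as [L|[L|L]]; auto; apply (Hinc Hp) in L; lra.
  - intros x y. assert (HN := betaN2_pos x y).
    exists (/ (4 * betaN2 x y)). split; [apply Rinv_0_lt_compat; lra|].
    assert (Bx := is_derive_beta_x x y). assert (Bt := is_derive_beta_t x y).
    assert (P1 : partial false (component emb false) x y = (1 + Ef x y / (4 * betaN2 x y)) / 2).
    { unfold partial, component, emb; simpl. apply is_derive_unique.
      set (b := fun z => beta z y) in *. change (is_derive (fun z => (z + b z) / 2) x ((1 + Ef x y / (4 * betaN2 x y)) / 2)).
      assert (Eb := is_derive_unique b x _ Bx).
      auto_derive; [repeat split; eexists; eassumption|].
      change (Derive (fun x : R => b x) x) with (Derive b x). rewrite Eb. field. lra. }
    assert (P2 : partial false (component emb true) x y = (1 - Ef x y / (4 * betaN2 x y)) / 2).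
    { unfold partial, component, emb; simpl. apply is_derive_unique.
      set (b := fun z => beta z y) in *. change (is_derive (fun z => (z - b z) / 2) x ((1 - Ef x y / (4 * betaN2 x y)) / 2)).
      assert (Eb := is_derive_unique b x _ Bx).
      auto_derive; [repeat split; eexists; eassumption|].
      change (Derive (fun x : R => b x) x) with (Derive b x). rewrite Eb. field. lra. }
    assert (P3 : partial true (component emb false) x y = Ff x y / (4 * betaN2 x y)).
    { unfold partial, component, emb; simpl. apply is_derive_unique.
      set (b := beta x) in *. change (is_derive (fun z => (x + b z) / 2) y (Ff x y / (4 * betaN2 x y))).
      assert (Eb := is_derive_unique b y _ Bt).
      auto_derive; [repeat split; eexists; eassumption|].
      change (Derive (fun x : R => b x) y) with (Derive b y). rewrite Eb. field. lra. }
    assert (P4 : partial true (component emb true) x y = - Ff x y / (4 * betaN2 x y)).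
    { unfold partial, component, emb; simpl. apply is_derive_unique.
      set (b := beta x) in *. change (is_derive (fun z => (x - b z) / 2) y (- Ff x y / (4 * betaN2 x y))).
      assert (Eb := is_derive_unique b y _ Bt).
      auto_derive; [repeat split; eexists; eassumption|].
      change (Derive (fun x : R => b x) y) with (Derive b y). rewrite Eb. field. lra. }
    intros [] []; rewrite pullback_flat, ?P1, ?P2, ?P3, ?P4; simpl; field; lra.
Qed.

(** Each point is compared with the origin along the segment between them. *)
Lemma nonvanishing_sign_2d (w : R -> R -> R) :
  (forall x y, continuity_2d_pt w x y) -> (forall x y, w x y <> 0) ->
  (forall x y, 0 < w x y) \/ (forall x y, w x y < 0).
Proof.
  intros Hc Hn.
  assert (G : forall x y, 0 < w 0 0 * w x y).
  { intros x y.
    assert (H := nonvanishing_sign (fun s => w (s * x) (s * y)) m_infty p_infty).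
    replace (w 0 0) with (w (0 * x) (0 * y)) by (f_equal; ring).
    replace (w x y) with (w (1 * x) (1 * y)) by (f_equal; ring).
    apply H; try easy.
    - intros s _. intros eps Heps.
      assert (Hw := proj1 (continuity_2d_pt_filterlim w (s * x) (s * y)) (Hc (s * x) (s * y))).
      assert (Hs : continuous (fun s => w (s * x) (s * y)) s).
      { apply (continuous_comp_2 (fun s => s * x) (fun s => s * y) w); auto.
        - apply (continuous_scal_l (K := R_AbsRing) (V := R_NormedModule) (fun s => s) x). apply continuous_id.
        - apply (continuous_scal_l (K := R_AbsRing) (V := R_NormedModule) (fun s => s) y). apply continuous_id. }
      apply continuity_pt_filterlim in Hs. now apply Hs.
  }
  destruct (Rtotal_order (w 0 0) 0) as [L|[L|L]].
  - right. intros x y. specialize (G x y). nra.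
  - now elim (Hn 0 0).
  - left. intros x y. specialize (G x y). nra.
Qed.

Lemma leaf_null e off u y : sheet e off -> let p := leaf e off u y in
  Ef (fst p) (snd p) * (- leafs e y / (2 * leafN2 e u y))
  + 2 * Ff (fst p) (snd p) *
    ((1 + leafom e u y ^ 2 + e * bump 2 (y - 1) * (leafom e u y * y - 1)) / 2) = 0.
Proof.
  intros Hsh p. unfold p. rewrite leaf_Ef by auto. unfold Ff.
  destruct (leaf_values e off u y Hsh) as [_ [_ [_ [_ [_ [_ [_ [_ ->]]]]]]]].
  assert (HN := leafN2_pos e u y). field. lra.
Qed.

(** The hypothesis says that [dg] is proportional to [Ef dx + 2 Ff dt], and [leaf_null] says that
    this form vanishes on the leaves. *)
Lemma constant_on_leaves g e off u y y' : Cn_on 1 (fun _ _ => True) g ->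
  (forall x t, Ef x t * Derive (g x) t = 2 * Ff x t * Derive (fun z => g z t) x) ->
  sheet e off ->
  g (fst (leaf e off u y)) (snd (leaf e off u y)) = g (fst (leaf e off u y')) (snd (leaf e off u y')).
Proof.
  intros Hg Hn Hsh.
  apply (derivative_zero_const (fun y => g (fst (leaf e off u y)) (snd (leaf e off u y)))).
  clear y y'. intros y. eapply is_derive_eq.
  { apply (Cn_on_curve 0 _ g (fun y => fst (leaf e off u y)) (fun y => snd (leaf e off u y)) y _ _
      open2_total Hg I (is_derive_leaf_fst e off u y) (is_derive_leaf_snd e off u y)). }
  assert (H0 := leaf_null e off u y Hsh). cbv zeta in H0.
  set (p := leaf e off u y) in *.
  specialize (Hn (fst p) (snd p)). assert (HF := Ff_pos (fst p) (snd p)).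
  apply Rmult_eq_reg_l with (2 * Ff (fst p) (snd p)); [|lra].
  rewrite Rmult_plus_distr_l, <- Rmult_assoc, <- Hn.
  match goal with |- ?E * ?D * ?a + 2 * ?F * (?D' * ?b) = _ =>
    transitivity (D * (E * a + 2 * F * b)); [change D' with D; ring | rewrite H0; ring] end.
Qed.

(** * The boundary of an arbitrary conformal embedding *)

Definition fnull (F : pt -> pt) (e x y : R) : R := component F false x y + e * component F true x y.

Lemma is_derive_fnull_x F e x y : (forall k, Cn_on 1 (fun _ _ => True) (component F k)) ->
  is_derive (fun z => fnull F e z y) x
    (partial false (component F false) x y + e * partial false (component F true) x y).
Proof.
  intros H. assert (D1 := Cn_on_is_derive1 0 _ _ x y (H false) I).
  assert (D2 := Cn_on_is_derive1 0 _ _ x y (H true) I).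
  apply (is_derive_plus (fun z => component F false z y) (fun z => e * component F true z y)); auto.
  apply (is_derive_scal (fun z => component F true z y)). exact D2.
Qed.

Lemma is_derive_fnull_t F e x y : (forall k, Cn_on 1 (fun _ _ => True) (component F k)) ->
  is_derive (fun z => fnull F e x z) y
    (partial true (component F false) x y + e * partial true (component F true) x y).
Proof.
  intros H. assert (D1 := Cn_on_is_derive2 0 _ _ x y (H false) I).
  assert (D2 := Cn_on_is_derive2 0 _ _ x y (H true) I).
  apply (is_derive_plus (fun z => component F false x z) (fun z => e * component F true x z)); auto.
  apply (is_derive_scal (fun z => component F true x z)). exact D2.
Qed.

(** The field [d/dt] is null, so its image is null and nonzero: its two components agree up to a
    sign, constant by connectedness. That sign decides which null coordinate of the cylinder is
    [f]. *)
Lemma flat_null_pair F : conformal_embedding zoll_cyl flat_cylinder F ->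
  exists e, (e = 1 \/ e = - 1) /\ null_pair (fnull F e) (fnull F (- e)).
Proof.
  intros [Hs [Hinj Hconf]].
  assert (HC : forall n k, Cn_on n (fun _ _ => True) (component F k)).
  { intros n k x y _. apply (proj1 (Hs n) (x, y) k). }
  set (px := partial false (component F false)). set (pt' := partial true (component F false)).
  set (tx := partial false (component F true)). set (tt := partial true (component F true)).
  assert (Hl : forall x y, exists l, 0 < l /\ px x y ^ 2 - tx x y ^ 2 = l * Ef x y /\
    px x y * pt' x y - tx x y * tt x y = l * Ff x y /\ pt' x y ^ 2 - tt x y ^ 2 = 0).
  { intros x y. destruct (Hconf x y) as [l [Hl H]]. exists l. split; auto.
    assert (H1 := H false false). assert (H2 := H false true). assert (H3 := H true true).
    rewrite pullback_flat in H1, H2, H3. simpl coef in H1, H2, H3.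
    unfold px, pt', tx, tt. lra. }
  assert (Hne : forall x y, pt' x y * tt x y <> 0).
  { intros x y E. destruct (Hl x y) as [l [L [_ [H2 H3]]]]. assert (HF := Ff_pos x y).
    assert (E1 : pt' x y = 0) by (apply Rmult_integral in E; destruct E as [E|E]; [auto|rewrite E in H3; nra]).
    assert (E2 : tt x y = 0) by (rewrite E1 in H3; nra).
    rewrite E1, E2 in H2. nra. }
  assert (Hsgn : exists e, (e = 1 \/ e = - 1) /\ forall x y, pt' x y + e * tt x y = 0).
  { destruct (nonvanishing_sign_2d (fun x y => pt' x y * tt x y)) as [P|P]; auto.
    - intros x y. apply continuity_2d_pt_mult.
      + apply (Cn_on_continuity 0 _ _ x y (Cn_on_partial2 0 _ _ (HC 1%nat false)) I).
      + apply (Cn_on_continuity 0 _ _ x y (Cn_on_partial2 0 _ _ (HC 1%nat true)) I).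
    - exists (- 1). split; auto. intros x y. specialize (P x y). destruct (Hl x y) as [l [_ [_ [_ H3]]]].
      assert (E : (pt' x y - tt x y) * (pt' x y + tt x y) = 0) by lra.
      apply Rmult_integral in E. destruct E; nra.
    - exists 1. split; auto. intros x y. specialize (P x y). destruct (Hl x y) as [l [_ [_ [_ H3]]]].
      assert (E : (pt' x y - tt x y) * (pt' x y + tt x y) = 0) by lra.
      apply Rmult_integral in E. destruct E; nra. }
  destruct Hsgn as [e [He Hz]]. exists e. split; auto.
  assert (Hfx : forall x y, Derive (fun z => fnull F e z y) x = px x y + e * tx x y).
  { intros x y. apply is_derive_unique. now apply is_derive_fnull_x. }
  assert (Hgx : forall x y, Derive (fun z => fnull F (- e) z y) x = px x y - e * tx x y).
  { intros x y. transitivity (px x y + (- e) * tx x y); [|ring].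
    apply is_derive_unique. now apply is_derive_fnull_x. }
  assert (Hgt : forall x y, Derive (fun z => fnull F (- e) x z) y = 2 * pt' x y).
  { intros x y. transitivity (pt' x y + (- e) * tt x y); [|specialize (Hz x y); lra].
    apply is_derive_unique. now apply is_derive_fnull_t. }
  assert (Hfg : forall x y, exists l, 0 < l /\
    (px x y + e * tx x y) * (2 * pt' x y) = 2 * l * Ff x y /\
    (px x y + e * tx x y) * (px x y - e * tx x y) = l * Ef x y).
  { intros x y. destruct (Hl x y) as [l [L [H1 [H2 _]]]]. exists l. split; auto.
    assert (E : tt x y = - e * pt' x y).
    { specialize (Hz x y). destruct He as [-> | ->]; lra. }
    rewrite E in H2. split; [lra|]. destruct He as [-> | ->]; lra. }
  assert (Cf : forall e n, Cn_on n (fun _ _ => True) (fnull F e)).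
  { intros e0 n. unfold fnull. assert (H1 := HC n false). assert (H2 := HC n true).
    apply Cn_on_plus; [apply open2_total|exact H1|].
    apply Cn_on_mult; [apply open2_total|smooth|exact H2]. }
  refine (conj (Cf _ _) (conj (Cf _ _) (conj _ (conj _ (conj _ _))))).
  - intros x. apply derivative_zero_const. intros y.
    eapply is_derive_eq; [now apply is_derive_fnull_t|]. apply Hz.
  - intros x t. rewrite Hfx. intros E. destruct (Hfg x t) as [l [L [H1 _]]].
    rewrite E in H1. assert (HF := Ff_pos x t). nra.
  - intros x t. rewrite Hgt. intros E. apply (Hne x t). replace (pt' x t) with 0 by lra. ring.
  - intros e0 off u y y' Hsh. apply constant_on_leaves; auto. intros x t.
    rewrite Hgx. change (Derive (fnull F (- e) x) t) with (Derive (fun z => fnull F (- e) x z) t).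
    rewrite Hgt. destruct (Hfg x t) as [l [L [H1 H2]]]. assert (HF := Ff_pos x t).
    assert (Hn : px x t + e * tx x t <> 0) by (intros E; rewrite E in H1; nra).
    apply Rmult_eq_reg_l with (px x t + e * tx x t); auto.
    replace ((px x t + e * tx x t) * (Ef x t * (2 * pt' x t))) with
      (Ef x t * ((px x t + e * tx x t) * (2 * pt' x t))) by ring.
    rewrite H1. replace ((px x t + e * tx x t) * (2 * Ff x t * (px x t - e * tx x t))) with
      (2 * Ff x t * ((px x t + e * tx x t) * (px x t - e * tx x t))) by ring.
    rewrite H2. ring.
Qed.

(** The point is a limit of images along the leaf [x = const], but by [null_pair_not_hit] not an
    image itself. The coefficients invert the passage from the two components to [f] and [g]. *)
Lemma flat_boundary_point F s e off x : conformal_embedding zoll_cyl flat_cylinder F ->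
  s = 1 \/ s = - 1 -> null_pair (fnull F s) (fnull F (- s)) ->
  boundary_angle e off x ->
  conformal_boundary F (boundary_coord (fnull F s) (fnull F (- s)) (/ 2) (/ 2) e x,
                        boundary_coord (fnull F s) (fnull F (- s)) (s / 2) (- s / 2) e x).
Proof.
  intros HF Hs Hnp Hx.
  set (f := fnull F s) in *. set (g := fnull F (- s)) in *.
  assert (Hfst : forall p, fst (F p) = (f (fst p) (snd p) + g (fst p) (snd p)) / 2).
  { intros p. unfold f, g, fnull, component. rewrite <- surjective_pairing. simpl. field. }
  assert (Hsnd : forall p, snd (F p) = s * (f (fst p) (snd p) - g (fst p) (snd p)) / 2).
  { intros p. unfold f, g, fnull, component. rewrite <- surjective_pairing. simpl.
    destruct Hs as [-> | ->]; field. }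
  split.
  - intros L. apply locally_singleton in L. destruct L as [p [z Hz]].
    injection Hz as E1 E2. rewrite Hfst in E1. rewrite Hsnd in E2. simpl in E1. unfold boundary_coord in E1, E2.
    apply (null_pair_not_hit f g (2 * PI) e off x Hnp Hx) with (fst p) (snd p) (- z)%Z.
    + intros x1 t1 x2 t2 z' Ef' Eg'. destruct HF as [_ [Hinj _]].
      destruct (Hinj (x1, t1) (x2, t2)) as [z2 Hz2].
      * exists z'. rewrite (surjective_pairing (F (x2, t2))). rewrite !Hfst, !Hsnd. simpl.
        rewrite Ef', Eg'. f_equal; field.
      * simpl in Hz2. injection Hz2; auto.
    + rewrite opp_IZR. destruct Hs as [Hs|Hs]; rewrite Hs in E2; lra.
    + rewrite opp_IZR. destruct Hs as [Hs|Hs]; rewrite Hs in E2; lra.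
  - intros [d Hd].
    assert (HL := null_pair_limit f g e off x Hnp Hx).
    apply is_lim_spec in HL. unfold is_lim', Rbar_locally' in HL. destruct (HL d) as [T HT].
    specialize (HT (T + 1) ltac:(lra)). set (t := T + 1) in *.
    destruct Hnp as [_ [_ [Hft _]]].
    assert (Hft0 : f x t = f x 0) by apply Hft.
    apply (Hd (F (x, t))).
    + split; unfold ball; simpl; unfold AbsRing_ball, abs, minus, plus, opp; simpl.
      * rewrite Hfst; simpl. unfold boundary_coord. rewrite Hft0.
        replace ((f x 0 + g x t) / 2 + - (/ 2 * f x 0 + / 2 * g PI (Xb e x))) with
          (/ 2 * (g x t - g PI (Xb e x))) by field.
        rewrite Rabs_mult, (Rabs_pos_eq (/ 2)) by lra. generalize (Rabs_pos (g x t - g PI (Xb e x))). lra.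
      * rewrite Hsnd; simpl. unfold boundary_coord. rewrite Hft0.
        replace (s * (f x 0 - g x t) / 2 + - (s / 2 * f x 0 + - s / 2 * g PI (Xb e x))) with
          (- s / 2 * (g x t - g PI (Xb e x))) by field.
        rewrite Rabs_mult. replace (Rabs (- s / 2)) with (/ 2).
        2:{ destruct Hs as [-> | ->]; [rewrite Rabs_left|rewrite Rabs_pos_eq]; lra. }
        generalize (Rabs_pos (g x t - g PI (Xb e x))). lra.
    + exists (x, t), 0%Z. rewrite Rmult_0_l, Rplus_0_r. apply surjective_pairing.
Qed.

Lemma continuous_boundary_coord f g A B e : null_pair f g -> continuous (boundary_coord f g A B e) (PI / 2).
Proof.
  intros H. apply is_derive_continuous with (dboundary_coord f g A B e (PI / 2)).
  apply (locally_singleton _ _ (is_derive_boundary_coord f g A B e H)).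
Qed.

Lemma zoll_boundary_not_C2 F : conformal_embedding zoll_cyl flat_cylinder F ->
  ~ Cn_curve 2 (conformal_boundary F).
Proof.
  intros HF HS. destruct (flat_null_pair F HF) as [s [Hs Hnp]].
  set (f := fnull F s) in *. set (g := fnull F (- s)) in *.
  set (U := boundary_coord f g (/ 2) (/ 2)). set (V := boundary_coord f g (s / 2) (- s / 2)).
  set (S := conformal_boundary F) in *.
  assert (Hpi := PI_RGT_0).
  destruct near_half_pi as [d0 [Hd0 [H0 Hnear]]].
  assert (S0 : S (U 1 (PI / 2), V 1 (PI / 2))).
  { now apply flat_boundary_point with 0. }
  assert (Sl : forall k, 0 < k < d0 -> S (U 1 (PI / 2 - k), V 1 (PI / 2 - k))).
  { intros k Hk. apply flat_boundary_point with 0; auto. now apply Hnear. }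
  assert (Sr : forall k, 0 < k < d0 -> S (U (- 1) (PI / 2 + k), V (- 1) (PI / 2 + k))).
  { intros k Hk. apply flat_boundary_point with PI; auto. now apply Hnear. }
  destruct (HS _ S0) as [h [[i Hi] Hloc]]. cbn [fst snd] in Hi.
  (* Requiring both properties of [h] on a neighbourhood, not just at the point, makes [D] open. *)
  set (D := fun a b : R => locally (a, b) (fun q : pt => ex_diff_n h 2 (fst q) (snd q) /\ (S q <-> h (fst q) (snd q) = 0))).
  assert (HD : open2 D).
  { intros a b Hab. apply locally_2d_locally.
    assert (L := locally_locally (a, b) _ Hab). revert L. apply filter_imp. intros [a' b'] H. exact H. }
  assert (HC : Cn_on 2 D h).
  { intros a b Hab. exact (proj1 (locally_singleton _ _ Hab)). }
  assert (HDS : forall a b, D a b -> S (a, b) -> h a b = 0).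
  { intros a b Hab Hsab. apply (proj2 (locally_singleton _ _ Hab)). exact Hsab. }
  assert (E0 : forall A B e, boundary_coord f g A B e (PI / 2) = A * f (PI / 2) 0 + B * g PI 0).
  { intros A B e. unfold boundary_coord. now rewrite (proj1 (Xb_half_pi e)). }
  assert (HD0 : forall e, D (U e (PI / 2)) (V e (PI / 2))).
  { intros e. unfold U, V. rewrite !E0. unfold U, V in Hloc. rewrite !E0 in Hloc. exact Hloc. }
  assert (HDn : forall e, locally (PI / 2) (fun x => D (U e x) (V e x))).
  { intros e. apply open2_along_curve; auto; now apply continuous_boundary_coord. }
  destruct (locally_delta _ _ (HDn 1)) as [d1 [Hd1 L1]].
  destruct (locally_delta _ _ (HDn (- 1))) as [d2 [Hd2 L2]].
  destruct (null_pair_corner f g D h (/ 2) (/ 2) (s / 2) (- s / 2) (Rmin d0 (Rmin d1 d2)) Hnp HD HC) as [C1 C2].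
  - rewrite <- !(E0 _ _ 1). apply HD0.
  - repeat apply Rmin_glb_lt; auto.
  - intros k [Hk1 Hk2].
    assert (k < d0) by (apply Rlt_le_trans with (1 := Hk2), Rmin_l).
    assert (k < d1).
    { apply Rlt_le_trans with (1 := Hk2). apply Rle_trans with (1 := Rmin_r _ _). apply Rmin_l. }
    apply HDS; [|now apply Sl]. apply L1.
    replace (PI / 2 - k - PI / 2) with (- k) by ring. rewrite Rabs_Ropp, Rabs_pos_eq; lra.
  - intros k [Hk1 Hk2].
    assert (k < d0) by (apply Rlt_le_trans with (1 := Hk2), Rmin_l).
    assert (k < d2).
    { apply Rlt_le_trans with (1 := Hk2). apply Rle_trans with (1 := Rmin_r _ _). apply Rmin_r. }
    apply HDS; [|now apply Sr]. apply L2.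
    replace (PI / 2 + k - PI / 2) with k by ring. rewrite Rabs_pos_eq; lra.
  (* The differential of [h] kills both null directions, hence is zero, against regularity of the
     level set. *)
  - rewrite <- !(E0 _ _ 1) in C1, C2. fold U V in C1, C2.
    apply Hi. destruct i; simpl; destruct Hs as [Hs|Hs]; rewrite Hs in C1, C2; lra.
Qed.

(** * Maps to coverings of de Sitter space *)

(** The Gudermannian function, which is conformal time: the metric is [cosh^2 (dphi^2 - dgd^2)]. So
    [phi + gd] and [phi - gd] are null coordinates and the boundary is at [gd = PI / 2] and
    [gd = - PI / 2]. *)
Definition gd (t : R) : R := atan (sinh t).

Lemma cosh_pos t : 0 < cosh t.
Proof. unfold cosh. generalize (exp_pos t) (exp_pos (- t)). lra. Qed.

Lemma cosh_sq t : cosh t ^ 2 = 1 + sinh t ^ 2.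
Proof.
  unfold cosh, sinh. assert (H : exp t * exp (- t) = 1).
  { rewrite <- exp_plus. replace (t + - t) with 0 by ring. apply exp_0. }
  replace (1 + ((exp t - exp (- t)) / 2) ^ 2) with (exp t * exp (- t) + ((exp t - exp (- t)) / 2) ^ 2)
    by (rewrite H; reflexivity). field.
Qed.

Lemma is_derive_gd t : is_derive gd t (/ cosh t).
Proof.
  assert (Hs : is_derive sinh t (cosh t)).
  { unfold sinh, cosh. auto_derive; auto. field. }
  eapply is_derive_eq.
  { apply (is_derive_comp atan sinh t); [apply is_derive_atan|exact Hs]. }
  unfold scal; simpl; unfold mult; simpl. unfold Rsqr.
  replace (1 + sinh t * sinh t) with (cosh t ^ 2) by (rewrite cosh_sq; ring).
  generalize (cosh_pos t); intros; field; lra.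
Qed.

Lemma gd_bound t : - PI < 2 * gd t < PI.
Proof. unfold gd. generalize (atan_bound (sinh t)). lra. Qed.

Lemma gd_inj t t' : gd t = gd t' -> t = t'.
Proof.
  intros E. assert (H := strictly_increasing_of_derive gd _ is_derive_gd).
  assert (Hp : forall x, 0 < / cosh x) by (intros; apply Rinv_0_lt_compat, cosh_pos).
  destruct (Rtotal_order t t') as [L|[L|L]]; auto; apply (H Hp) in L; lra.
Qed.

Lemma gd_surj d : - PI < d < PI -> exists t, 2 * gd t = d.
Proof.
  intros H. exists (arcsinh (tan (d / 2))). unfold gd. rewrite sinh_arcsinh, atan_tan; lra.
Qed.

Lemma Cn_on_gd n D f : open2 D -> Cn_on n D f -> Cn_on n D (fun x y => gd (f x y)).
Proof.
  intros Ho Hf. unfold gd, sinh. apply Cn_on_atan; auto.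
  assert (H1 : Cn_on n D (fun x y => exp (f x y))) by now apply Cn_on_exp.
  assert (H2 : Cn_on n D (fun x y => exp (- f x y))) by (apply Cn_on_exp; auto; now apply Cn_on_opp).
  unfold Rdiv. smooth.
Qed.

(** A lightlike velocity has [cosh t phi' = t'] or [cosh t phi' = - t'] at each time. Both
    components are continuous and never zero, so the sign cannot change along the curve. *)
Lemma de_sitter_null_constant m a b c : lightlike_geodesic (de_sitter_cover m) a b c ->
  exists e, (e = 1 \/ e = - 1) /\ forall s r, in_itv a b s -> in_itv a b r ->
    fst (c s) + e * gd (snd (c s)) = fst (c r) + e * gd (snd (c r)).
Proof.
  intros [[Hab Hg] Hl].
  assert (HD : forall s, in_itv a b s -> is_derive (coord c false) s (Derive (coord c false) s) /\
    is_derive (coord c true) s (Derive (coord c true) s) /\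
    continuity_pt (Derive (coord c false)) s /\ continuity_pt (Derive (coord c true)) s).
  { intros s Hs. destruct (Hg s Hs false) as [A1 [A2 _]]. destruct (Hg s Hs true) as [T1 [T2 _]].
    apply Derive_correct in A1. apply Derive_correct in T1.
    apply Derive_correct in A2. apply Derive_correct in T2.
    refine (conj A1 (conj T1 (conj _ _))); eapply is_derive_continuity_pt; eassumption. }
  set (p := Derive (coord c false)) in *. set (q := Derive (coord c true)) in *.
  assert (Hsq : forall s, in_itv a b s ->
    (cosh (snd (c s)) * p s - q s) * (cosh (snd (c s)) * p s + q s) = 0).
  { intros s Hs. destruct (Hl s Hs) as [H _]. unfold speed2, sum2 in H. simpl coef in H.
    fold p q in H. rewrite <- H. ring. }
  assert (Hne : forall s, in_itv a b s -> p s * q s <> 0).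
  { intros s Hs E. destruct (Hl s Hs) as [_ [k Hk]]. assert (H := Hsq s Hs).
    assert (Hc := cosh_pos (snd (c s))).
    apply Rmult_integral in E. destruct E as [E|E]; rewrite E in H.
    - assert (E2 : q s = 0) by nra. destruct k; [now apply Hk|now apply Hk].
    - assert (E2 : p s = 0).
      { replace ((cosh (snd (c s)) * p s - 0) * (cosh (snd (c s)) * p s + 0)) with
          ((cosh (snd (c s)) * p s) ^ 2) in H by ring.
        assert (E3 : cosh (snd (c s)) * p s = 0) by nra. apply Rmult_integral in E3. lra. }
      destruct k; [now apply Hk|now apply Hk]. }
  assert (Hsg := nonvanishing_sign (fun s => p s * q s) a b).
  destruct (in_itv_nonempty a b Hab) as [s0 Hs0].
  assert (Hsg' : forall s, in_itv a b s -> 0 < (p s0 * q s0) * (p s * q s)).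
  { intros s Hs. apply Hsg; auto. intros r Hr. apply continuity_pt_mult; apply HD; auto. }
  assert (He : exists e, (e = 1 \/ e = - 1) /\ forall s, in_itv a b s -> cosh (snd (c s)) * p s + e * q s = 0).
  { assert (N0 := Hne s0 Hs0).
    destruct (Rtotal_order (p s0 * q s0) 0) as [L|[L|L]]; [|contradiction|].
    - exists 1. split; auto. intros s Hs. assert (H1 := Hsg' s Hs). assert (H2 := Hsq s Hs).
      assert (Hc := cosh_pos (snd (c s))). assert (Hpq : p s * q s < 0) by nra.
      apply Rmult_integral in H2. destruct H2 as [H2|H2]; [|lra].
      exfalso. assert (Eq : q s = cosh (snd (c s)) * p s) by lra. rewrite Eq in Hpq. nra.
    - exists (- 1). split; auto. intros s Hs. assert (H1 := Hsg' s Hs). assert (H2 := Hsq s Hs).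
      assert (Hc := cosh_pos (snd (c s))). assert (Hpq : 0 < p s * q s) by nra.
      apply Rmult_integral in H2. destruct H2 as [H2|H2]; [lra|].
      exfalso. assert (Eq : q s = - cosh (snd (c s)) * p s) by lra. rewrite Eq in Hpq. nra. }
  destruct He as [e [He Hz]]. exists e. split; auto.
  apply (is_derive_zero_const (fun s => fst (c s) + e * gd (snd (c s))) a b).
  intros s Hs. destruct (HD s Hs) as [D1 [D2 _]]. assert (Hc := cosh_pos (snd (c s))).
  eapply is_derive_eq.
  { apply (is_derive_plus (coord c false) (fun s => e * gd (coord c true s))); [exact D1|].
    apply (is_derive_scal (fun s => gd (coord c true s))).
    apply (is_derive_comp gd (coord c true)); [apply is_derive_gd|exact D2]. }
  unfold plus, scal; simpl; unfold mult; simpl. fold (p s) (q s).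
  change (coord c true s) with (snd (c s)).
  apply Rmult_eq_reg_l with (cosh (snd (c s))); [|lra].
  rewrite Rmult_0_r, <- (Hz s Hs). field. lra.
Qed.

(** Along the leaf the geodesic equation says that [Ff T'] is constant; [Ff >= 1] makes the solution
    complete. *)
Lemma vertical_geodesic x t0 : exists (T : R -> R) (s0 : R), T s0 = t0 /\
  (forall s, is_derive T s (/ Ff x (T s))) /\
  lightlike_geodesic zoll_cyl m_infty p_infty (fun s => (x, T s)).
Proof.
  assert (HFd : forall t, is_derive (Ff x) t (Derive (Ff x) t)).
  { intros t. apply (Cn_on_is_derive2 0 _ Ff x t (Cn_on_Ff 1) I). }
  destruct (inverse_primitive (Ff x) 1) as [Sig [T [HS [_ [HTS HT]]]]].
  { lra. }
  { intros t. apply is_derive_continuous with (Derive (Ff x) t). apply HFd. }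
  { intros t. unfold Ff. generalize (sf_lower x t). lra. }
  exists T, (Sig t0). split; [apply HTS|]. split; [exact HT|].
  set (c := fun s => (x, T s)).
  assert (Ca : forall s, is_derive (coord c false) s 0).
  { intros s. change (is_derive (fun _ : R => x) s 0). apply is_derive_cst. }
  assert (Da : forall s, Derive (coord c false) s = 0) by (intros; now apply is_derive_unique).
  assert (Dt : forall s, Derive (coord c true) s = / Ff x (T s)) by (intros; now apply is_derive_unique).
  assert (D2t : forall s, is_derive (Derive (coord c true)) s
    (- (Derive (Ff x) (T s) * / Ff x (T s)) / Ff x (T s) ^ 2)).
  { intros s. apply is_derive_ext with (fun s => / Ff x (T s)); [intros; now rewrite Dt|].
    apply (is_derive_inv (fun s => Ff x (T s))).
    - eapply is_derive_eq; [apply (is_derive_comp (Ff x) T); [apply HFd|apply HT]|].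
      unfold scal; simpl; unfold mult; simpl. ring.
    - generalize (Ff_pos x (T s)); lra. }
  split; [split; [exact I|]|].
  - intros s _ k. assert (HF := Ff_pos x (T s)). destruct k.
    + split; [eexists; apply HT|]. split; [eexists; apply D2t|].
      rewrite (christoffel_snd (fun i => Derive (coord c i) s)), Da, Dt.
      rewrite (is_derive_unique _ _ _ (D2t s)). cbn [c fst snd].
      change (Derive (fun z => Ff x z) (T s)) with (Derive (Ff x) (T s)). field. lra.
    + split; [eexists; apply Ca|]. split.
      * apply ex_derive_ext with (fun _ => 0); [intros; now rewrite Da|]. apply ex_derive_const.
      * rewrite (christoffel_fst (fun i => Derive (coord c i) s)), Da.
        rewrite (Derive_ext _ (fun _ => 0)) by (intros; apply Da). rewrite Derive_const. ring.
  - intros s _. split.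
    + rewrite zoll_speed2, Da. ring.
    + exists true. rewrite Dt. apply Rinv_neq_0_compat. generalize (Ff_pos x (T s)); lra.
Qed.

(** The case of zero energy in [geodesic_of_energy]. In the chart the affine parameter is determined
    by [Y' = 1 / s], and [s >= 1/2] makes the geodesic run through the whole leaf. *)
Lemma transverse_geodesic e off u : sheet e off -> exists Y : R -> R,
  (forall y, exists s, Y s = y) /\ (forall s, is_derive Y s (/ leafs e (Y s))) /\
  lightlike_geodesic zoll_cyl m_infty p_infty
    (fun s => (fst (leaf e off u (Y s)), snd (leaf e off u (Y s)))).
Proof.
  intros Hsh. assert (He : e = 1 \/ e = - 1) by apply Hsh.
  destruct (inverse_primitive (leafs e) (/ 2)) as [Sig [Y [HS [_ [HYS HY]]]]].
  { lra. }
  { intros y. unfold leafs. apply (continuous_plus (V := R_NormedModule) (fun _ => 1) (fun y => y ^ 2 / 4 * (e * bump 2 (y - 1)))).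
    - apply continuous_const.
    - assert (Hb : is_derive (fun y => bump 2 (y - 1)) y (1 * (- INR 2 * bump (2 + 1) (y - 1) + bump (2 + 2) (y - 1)))).
      { apply (is_derive_comp (bump 2) (fun y => y - 1)); [apply is_derive_bump|]. auto_derive; auto. }
      set (b := fun y => bump 2 (y - 1)) in *.
      change (continuous (fun y => y ^ 2 / 4 * (e * b y)) y).
      apply (ex_derive_continuous (K := R_AbsRing) (V := R_NormedModule)).
      auto_derive. repeat split; eexists; eassumption. }
  { intros y. now apply leafs_lower. }
  exists Y. split; [intros y; exists (Sig y); apply HYS|]. split; [exact HY|].
  set (al := fun s => fst (leaf e off u (Y s))). set (tt := fun s => snd (leaf e off u (Y s))).
  set (be := fun s => - / (2 * leafN2 e u (Y s))).
  assert (Hbe : forall s, be s < 0).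
  { intros s. unfold be. generalize (leafN2_pos e u (Y s)); intros H.
    assert (0 < / (2 * leafN2 e u (Y s))) by (apply Rinv_0_lt_compat; lra). lra. }
  destruct (geodesic_of_energy al tt be 0) as [Hgeo Hsp].
  - intros s. specialize (Hbe s). lra.
  - intros s. generalize (leafN2_pos e u (Y s)) (leafs_lower e (Y s) He); intros HN Hl.
    eapply is_derive_eq.
    { apply (is_derive_comp (fun y => fst (leaf e off u y)) Y); [apply is_derive_leaf_fst|apply HY]. }
    unfold scal; simpl; unfold mult; simpl. unfold be. field. lra.
  - intros s. generalize (leafN2_pos e u (Y s)) (leafs_lower e (Y s) He); intros HN Hl.
    destruct (leaf_values e off u (Y s) Hsh) as [W0 [W2 [Ec [Es [Et [Eq [Er [EK ES]]]]]]]].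
    assert (HNd := is_derive_comp (leafN2 e u) Y s _ _ (is_derive_leafN2 e u (Y s)) (HY s)).
    unfold scal in HNd; simpl in HNd; unfold mult in HNd; simpl in HNd.
    set (N := fun s => leafN2 e u (Y s)) in *.
    assert (EN := is_derive_unique N s _ HNd).
    unfold al, tt. rewrite ES, EK, Ec, Es, Eq, Et.
    change (is_derive (fun s => - / (2 * N s)) s
      (2 * (- / (2 * N s)) ^ 2 / leafs e (Y s) *
      (Y s * (1 + leafom e u (Y s) ^ 2) / 2 - leafom e u (Y s) -
       (e * sqrt (leafN2 e u (Y s))) ^ 2 * (e * bump 2 (Y s - 1)) *
       (e * (Y s / 2) / sqrt (leafN2 e u (Y s))) * (e * leafv e u (Y s) / sqrt (leafN2 e u (Y s)))))).
    change (0 < N s) in HN. set (w := sqrt (leafN2 e u (Y s))) in *. clearbody w.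
    auto_derive.
    + repeat split; [eexists; eassumption|lra].
    + change (Derive (fun x : R => N x) s) with (Derive N s). rewrite EN.
      unfold leafv. clear EN HNd. clearbody N.
      destruct He as [-> | ->]; field; lra.
  - intros s. generalize (leafN2_pos e u (Y s)) (leafs_lower e (Y s) He); intros HN Hl.
    assert (H0 := leaf_null e off u (Y s) Hsh). cbv zeta in H0.
    assert (HF := Ff_pos (al s) (tt s)).
    eapply is_derive_eq.
    { apply (is_derive_comp (fun y => snd (leaf e off u y)) Y); [apply is_derive_leaf_snd|apply HY]. }
    unfold scal; simpl; unfold mult; simpl.
    change (fst (leaf e off u (Y s))) with (al s) in H0. change (snd (leaf e off u (Y s))) with (tt s) in H0.
    match type of H0 with _ + 2 * _ * ?b = 0 => set (B := b) in * end.
    assert (HFl : 0 < 2 * Ff (al s) (tt s) * leafs e (Y s)) by (apply Rmult_lt_0_compat; lra).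
    apply Rmult_eq_reg_l with (2 * Ff (al s) (tt s) * leafs e (Y s)); [|lra].
    transitivity (2 * Ff (al s) (tt s) * B); [unfold B; field; lra|].
    replace (2 * Ff (al s) (tt s) * B) with
      (- (Ef (al s) (tt s) * (- leafs e (Y s) / (2 * leafN2 e u (Y s))))) by lra.
    unfold be. field. lra.
  - split; auto. intros s _. split; [apply Hsp|]. exists false.
    generalize (leafN2_pos e u (Y s)) (leafs_lower e (Y s) He); intros HN Hl.
    intros E. apply (Rlt_not_eq _ _ (Hbe s)). rewrite <- E.
    symmetry. apply is_derive_unique. eapply is_derive_eq.
    { apply (is_derive_comp (fun y => fst (leaf e off u y)) Y); [apply is_derive_leaf_fst|apply HY]. }
    unfold scal; simpl; unfold mult; simpl. unfold be. field. lra.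
Qed.

(** * Null coordinates of a conformal map to de Sitter space *)

Definition dnull (Phi : pt -> pt) (e x y : R) : R :=
  component Phi false x y + e * gd (component Phi true x y).

Lemma is_derive_dnull (Phi : pt -> pt) e (u v : R -> R) s u' v' :
  (forall k, Cn_on 1 (fun _ _ => True) (component Phi k)) ->
  is_derive u s u' -> is_derive v s v' ->
  let D := fun i k => partial i (component Phi k) (u s) (v s) in
  is_derive (fun s => dnull Phi e (u s) (v s)) s
    ((D false false * u' + D true false * v')
     + e * ((D false true * u' + D true true * v') / cosh (component Phi true (u s) (v s)))).
Proof.
  intros HC Hu Hv D.
  assert (H1 := Cn_on_curve 0 _ _ u v s _ _ open2_total (HC false) I Hu Hv).
  assert (H2 := Cn_on_curve 0 _ _ u v s _ _ open2_total (HC true) I Hu Hv).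
  unfold dnull.
  apply (is_derive_plus (fun s => component Phi false (u s) (v s))
    (fun s => e * gd (component Phi true (u s) (v s)))); [exact H1|].
  apply (is_derive_scal (fun s => gd (component Phi true (u s) (v s)))).
  apply (is_derive_comp gd (fun s => component Phi true (u s) (v s)) s _ _ (is_derive_gd _) H2).
Qed.

Lemma same_pt_cos_sin_eq p q : same_pt zoll_cyl p q ->
  cos (fst p) = cos (fst q) /\ sin (fst p) = sin (fst q) /\ snd p = snd q.
Proof.
  intros [z ->]. simpl. destruct (cos_sin_Zperiod (fst p) z) as [-> ->]. auto.
Qed.

(* Replaces lifting the deck transformations, which are only known pointwise. *)
Lemma derivative_of_angle_lift (k : R -> R) (a : R -> R) (s k' a' : R) :
  is_derive k s k' -> is_derive a s a' ->
  (forall s, cos (k s) = cos (a s) /\ sin (k s) = sin (a s)) -> k' = a'.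
Proof.
  intros Hk Ha Hcs.
  assert (S1 : is_derive (fun s => sin (k s)) s (k' * cos (k s))).
  { apply (is_derive_comp sin k); [|exact Hk]. auto_derive; auto. ring. }
  assert (S2 : is_derive (fun s => sin (k s)) s (a' * cos (a s))).
  { apply is_derive_ext with (fun s => sin (a s)); [intros; symmetry; apply Hcs|].
    apply (is_derive_comp sin a); [|exact Ha]. auto_derive; auto. ring. }
  assert (C1 : is_derive (fun s => cos (k s)) s (k' * - sin (k s))).
  { apply (is_derive_comp cos k); [|exact Hk]. auto_derive; auto. ring. }
  assert (C2 : is_derive (fun s => cos (k s)) s (a' * - sin (a s))).
  { apply is_derive_ext with (fun s => cos (a s)); [intros; symmetry; apply Hcs|].
    apply (is_derive_comp cos a); [|exact Ha]. auto_derive; auto. ring. }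
  apply is_derive_unique in S1. apply is_derive_unique in S2.
  apply is_derive_unique in C1. apply is_derive_unique in C2.
  rewrite S1 in S2. rewrite C1 in C2. destruct (Hcs s) as [Ec Es]. rewrite Ec, Es in *.
  generalize (sincos1 (a s)). intros H1.
  transitivity (k' * cos (a s) * cos (a s) - k' * - sin (a s) * sin (a s)).
  - transitivity (k' * (sin (a s) ^ 2 + cos (a s) ^ 2)); [rewrite H1; ring|ring].
  - rewrite S2, C2. transitivity (a' * (sin (a s) ^ 2 + cos (a s) ^ 2)); [ring|rewrite H1; ring].
Qed.

(** Chain rule for [Psi] after [Phi], which is the identity up to deck translations; the angle is
    compared through its cosine and sine. *)
Lemma diffeo_jacobian D Phi : cyl_diffeo 1 zoll_cyl D Phi -> forall x y,
  partial false (component Phi false) x y * partial true (component Phi true) x y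
  - partial true (component Phi false) x y * partial false (component Phi true) x y <> 0.
Proof.
  intros [[HP _] [Psi [[HQ _] [Hinv _]]]] x y.
  assert (CP : forall k, Cn_on 1 (fun _ _ => True) (component Phi k)).
  { intros k a b _. apply (HP (a, b) k). }
  assert (CQ : forall k, Cn_on 1 (fun _ _ => True) (component Psi k)).
  { intros k a b _. apply (HQ (a, b) k). }
  set (f := component Phi false) in *. set (g := component Phi true) in *.
  assert (EP : forall a b, Phi (a, b) = (f a b, g a b)).
  { intros. unfold f, g, component. simpl. apply surjective_pairing. }
  assert (Hcs : forall a b, cos (component Psi false (f a b) (g a b)) = cos a /\
     sin (component Psi false (f a b) (g a b)) = sin a /\ component Psi true (f a b) (g a b) = b).
  { intros a b. unfold component. rewrite <- EP. apply (same_pt_cos_sin_eq _ _ (Hinv (a, b))). }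
  assert (Fx := Cn_on_is_derive1 0 _ f x y (CP false) I). assert (Gx := Cn_on_is_derive1 0 _ g x y (CP true) I).
  assert (Fy := Cn_on_is_derive2 0 _ f x y (CP false) I). assert (Gy := Cn_on_is_derive2 0 _ g x y (CP true) I).
  assert (K1 := Cn_on_curve 0 _ _ (fun z => f z y) (fun z => g z y) x _ _ open2_total (CQ false) I Fx Gx).
  assert (K2 := Cn_on_curve 0 _ _ (fun z => f z y) (fun z => g z y) x _ _ open2_total (CQ true) I Fx Gx).
  assert (K3 := Cn_on_curve 0 _ _ (fun z => f x z) (fun z => g x z) y _ _ open2_total (CQ false) I Fy Gy).
  assert (K4 := Cn_on_curve 0 _ _ (fun z => f x z) (fun z => g x z) y _ _ open2_total (CQ true) I Fy Gy).
  assert (Ix : forall s : R, is_derive (fun z : R => z) s 1) by (intros; auto_derive; auto).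
  assert (Ic : forall c s : R, is_derive (fun _ : R => c) s 0)
    by (intros; apply is_derive_cst).
  assert (E1 := derivative_of_angle_lift _ (fun z => z) _ _ _ K1 (Ix x)
    (fun a => conj (proj1 (Hcs a y)) (proj1 (proj2 (Hcs a y))))).
  assert (E3 := derivative_of_angle_lift _ (fun _ => x) _ _ _ K3 (Ic x y)
    (fun b => conj (proj1 (Hcs x b)) (proj1 (proj2 (Hcs x b))))).
  assert (E2 : is_derive (fun z => component Psi true (f z y) (g z y)) x 0).
  { apply is_derive_ext with (fun _ => y); [intros; symmetry; apply Hcs|apply Ic]. }
  assert (E4 : is_derive (fun z => component Psi true (f x z) (g x z)) y 1).
  { apply is_derive_ext with (fun z => z); [intros; symmetry; apply Hcs|apply Ix]. }
  apply is_derive_unique in K2. apply is_derive_unique in E2. rewrite K2 in E2. clear K2.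
  apply is_derive_unique in K4. apply is_derive_unique in E4. rewrite K4 in E4. clear K4 K1 K3.
  unfold partial. cbv beta in *.
  set (fx := Derive (fun z => f z y) x) in *. set (gx := Derive (fun z => g z y) x) in *.
  set (fy := Derive (fun z => f x z) y) in *. set (gy := Derive (fun z => g x z) y) in *.
  set (a := Derive (fun z => component Psi false z (g x y)) (f x y)) in *.
  set (b := Derive (fun z => component Psi false (f x y) z) (g x y)) in *.
  set (c := Derive (fun z => component Psi true z (g x y)) (f x y)) in *.
  set (d := Derive (fun z => component Psi true (f x y) z) (g x y)) in *.
  intros E.
  assert (H : (a * d - b * c) * (fx * gy - fy * gx) = 1).
  { transitivity ((a * fx + b * gx) * (c * fy + d * gy) - (a * fy + b * gy) * (c * fx + d * gx)); [ring|].
    rewrite E1, E3, E4. ring. }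
  rewrite E in H. lra.
Qed.

Lemma cyl_diffeo_le n n' C D Phi : (n' <= n)%nat -> cyl_diffeo n C D Phi -> cyl_diffeo n' C D Phi.
Proof.
  intros Hn [[H1 H2] [Psi [[H3 H4] H5]]]. split.
  - split; auto. intros p k. apply (ex_diff_n_m n n' Hn). apply H1.
  - exists Psi. split; auto. split; auto. intros p k. apply (ex_diff_n_m n n' Hn). apply H3.
Qed.

(** Conformality is available only through images of null geodesics. Each image keeps one null
    coordinate of de Sitter space constant; it remains to see that the choice is uniform over all
    vertical leaves and opposite on the transverse ones. *)
Lemma de_sitter_null_pair m Phi : cyl_diffeo 2 zoll_cyl (de_sitter_cover m) Phi ->
  (forall (a b : Rbar) (c : R -> pt), lightlike_geodesic zoll_cyl a b c ->
      exists (a' b' : Rbar) (c' : R -> pt) (h : R -> R),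
        lightlike_geodesic (de_sitter_cover m) a' b' c' /\
        reparametrization a b a' b' h /\
        (forall s, in_itv a b s -> Phi (c s) = c' (h s))) ->
  exists e, (e = 1 \/ e = - 1) /\ null_pair (dnull Phi e) (dnull Phi (- e)).
Proof.
  intros Hd Hgeo.
  assert (HJ := diffeo_jacobian _ Phi (cyl_diffeo_le 2 1 _ _ _ ltac:(lia) Hd)).
  destruct Hd as [[HP _] _].
  assert (C2 : forall k, Cn_on 2 (fun _ _ => True) (component Phi k)).
  { intros k a b _. apply (HP (a, b) k). }
  assert (C1 : forall k, Cn_on 1 (fun _ _ => True) (component Phi k)).
  { intros k. now apply Cn_on_S. }
  assert (Hnull : forall c, lightlike_geodesic zoll_cyl m_infty p_infty c ->
    exists e, (e = 1 \/ e = - 1) /\ forall s r,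
      dnull Phi e (fst (c s)) (snd (c s)) = dnull Phi e (fst (c r)) (snd (c r))).
  { intros c Hc. destruct (Hgeo _ _ c Hc) as [a' [b' [c' [h [Hc' [[Hh _] Heq]]]]]].
    destruct (de_sitter_null_constant m a' b' c' Hc') as [e [He Hk]]. exists e. split; auto.
    intros s r. unfold dnull, component. rewrite <- !surjective_pairing.
    rewrite (Heq s), (Heq r) by easy. unfold comp. apply Hk; now apply Hh. }
  set (px := partial false (component Phi false)) in *. set (py := partial true (component Phi false)) in *.
  set (tx := partial false (component Phi true)) in *. set (ty := partial true (component Phi true)) in *.
  set (ch := fun x y => cosh (component Phi true x y)).
  assert (Hch : forall x y, 0 < ch x y) by (intros; apply cosh_pos).
  assert (Ix : forall s : R, is_derive (fun z : R => z) s 1) by (intros; auto_derive; auto).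
  assert (Ic : forall c s : R, is_derive (fun _ : R => c) s 0)
    by (intros; apply is_derive_cst).
  assert (Dx : forall e x y, is_derive (fun z => dnull Phi e z y) x (px x y + e * (tx x y / ch x y))).
  { intros e x y. eapply is_derive_eq; [apply (is_derive_dnull Phi e _ _ x _ _ C1 (Ix x) (Ic y x))|].
    unfold px, tx, ch. field. generalize (cosh_pos (component Phi true x y)); lra. }
  assert (Dy : forall e x y, is_derive (fun z => dnull Phi e x z) y (py x y + e * (ty x y / ch x y))).
  { intros e x y. eapply is_derive_eq; [apply (is_derive_dnull Phi e _ _ y _ _ C1 (Ic x y) (Ix y))|].
    unfold py, ty, ch. field. generalize (cosh_pos (component Phi true x y)); lra. }
  assert (Hv : forall x y, exists e, (e = 1 \/ e = - 1) /\ py x y + e * (ty x y / ch x y) = 0).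
  { intros x y. destruct (vertical_geodesic x y) as [T [s0 [HT0 [HT HTg]]]].
    destruct (Hnull _ HTg) as [e [He Hk]]. exists e. split; auto. simpl in Hk.
    assert (H1 : is_derive (fun s => dnull Phi e x (T s)) s0 (/ Ff x (T s0) * (py x (T s0) + e * (ty x (T s0) / ch x (T s0))))).
    { apply (is_derive_comp (fun z => dnull Phi e x z) T); [apply Dy|apply HT]. }
    assert (H2 : is_derive (fun s => dnull Phi e x (T s)) s0 0).
    { apply is_derive_ext with (fun _ => dnull Phi e x (T s0)); [intros t; apply Hk|apply Ic]. }
    apply is_derive_unique in H1. apply is_derive_unique in H2. rewrite H1, HT0 in H2.
    apply Rmult_integral in H2. destruct H2 as [H2|H2]; auto.
    exfalso. revert H2. apply Rinv_neq_0_compat. generalize (Ff_pos x y); lra. }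
  (* If one component of the image of [d/dt] vanished, so would the other, and the Jacobian would be
     zero. Hence the sign in [Hv] is locally, and so globally, constant. *)
  assert (Hw : forall x y, py x y * (ty x y / ch x y) <> 0).
  { intros x y E. destruct (Hv x y) as [e [He H]]. specialize (Hch x y). specialize (HJ x y).
    assert (Q : ty x y = (ty x y / ch x y) * ch x y) by (field; lra).
    apply Rmult_integral in E. destruct E as [E|E].
    - assert (E2 : ty x y / ch x y = 0) by (rewrite E in H; destruct He as [-> | ->]; lra).
      apply HJ. rewrite Q, E2, E. ring.
    - rewrite E in H. apply HJ. rewrite Q, E. replace (py x y) with 0 by lra. ring. }
  assert (He : exists e, (e = 1 \/ e = - 1) /\ forall x y, py x y + e * (ty x y / ch x y) = 0).
  { destruct (nonvanishing_sign_2d (fun x y => py x y * (ty x y / ch x y))) as [P|P]; auto.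
    - intros x y. apply continuity_2d_pt_mult; [|apply continuity_2d_pt_mult; [|apply continuity_2d_pt_inv]].
      + apply (Cn_on_continuity 0 _ _ x y (Cn_on_partial2 0 _ _ (C1 false)) I).
      + apply (Cn_on_continuity 0 _ _ x y (Cn_on_partial2 0 _ _ (C1 true)) I).
      + unfold ch. apply (continuity_1d_2d_pt_comp cosh (component Phi true)).
        * apply is_derive_continuity_pt with (sinh (component Phi true x y)).
          unfold cosh, sinh. auto_derive; auto. field.
        * apply (Cn_on_continuity 1 _ _ x y (C1 true) I).
      + generalize (Hch x y); unfold ch; lra.
    - exists (- 1). split; auto. intros x y. destruct (Hv x y) as [e [[-> | ->] H]]; auto.
      exfalso. specialize (P x y). set (q := ty x y / ch x y) in *. nra.
    - exists 1. split; auto. intros x y. destruct (Hv x y) as [e [[-> | ->] H]]; auto.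
      exfalso. specialize (P x y). set (q := ty x y / ch x y) in *. nra. }
  destruct He as [e [He Hz]]. exists e. split; auto.
  assert (Cd : forall e, Cn_on 2 (fun _ _ => True) (dnull Phi e)).
  { intros e0. unfold dnull. apply Cn_on_plus; [apply open2_total|apply (C2 false)|].
    apply Cn_on_mult; [apply open2_total|smooth|]. apply Cn_on_gd; [apply open2_total|apply (C2 true)]. }
  assert (Hfx : forall x y, px x y + e * (tx x y / ch x y) <> 0).
  { intros x y E. specialize (Hch x y). apply (HJ x y). specialize (Hz x y).
    replace (px x y) with (- e * (tx x y / ch x y)) by lra.
    replace (py x y) with (- e * (ty x y / ch x y)) by lra. field. lra. }
  refine (conj (Cd _) (conj (Cd _) (conj _ (conj _ (conj _ _))))).
  - intros x. apply derivative_zero_const. intros y.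
    eapply is_derive_eq; [apply Dy|]. apply Hz.
  - intros x t E. apply (Hfx x t). rewrite <- E. symmetry. apply is_derive_unique, Dx.
  - intros x t. intros E.
    assert (E1 : Derive (fun z : R => dnull Phi (- e) x z) t = py x t + - e * (ty x t / ch x t))
      by apply is_derive_unique, Dy.
    rewrite E in E1. specialize (Hz x t). apply (Hw x t). replace (py x t) with 0 by lra. ring.
  - intros e0 off u y y' Hsh. destruct (transverse_geodesic e0 off u Hsh) as [Y [HYs [HY HYg]]].
    destruct (Hnull _ HYg) as [e1 [He1 Hk]]. cbn [fst snd] in Hk.
    assert (Hcase : e1 = - e \/ e1 = e).
    { destruct He as [-> | ->], He1 as [-> | ->]; lra. }
    destruct (HYs y) as [s Hs]. destruct (HYs y') as [s' Hs'].
    destruct Hcase as [-> | ->].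
    + rewrite <- Hs, <- Hs'. apply Hk.
    (* If the same null coordinate were constant on a transverse leaf too, its differential would
       vanish in two independent directions, against [Hfx]. *)
    + exfalso.
      assert (He0 : e0 = 1 \/ e0 = - 1) by apply Hsh.
      set (al := fun s => fst (leaf e0 off u (Y s))). set (tt := fun s => snd (leaf e0 off u (Y s))).
      assert (Dal : is_derive al s (/ leafs e0 (Y s) * (- leafs e0 (Y s) / (2 * leafN2 e0 u (Y s))))).
      { apply (is_derive_comp (fun y => fst (leaf e0 off u y)) Y); [apply is_derive_leaf_fst|apply HY]. }
      assert (Dtt : exists l, is_derive tt s l).
      { eexists. apply (is_derive_comp (fun y => snd (leaf e0 off u y)) Y); [apply is_derive_leaf_snd|apply HY]. }
      destruct Dtt as [l Dtt].
      assert (H1 := is_derive_dnull Phi e al tt s _ _ C1 Dal Dtt). cbv zeta in H1.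
      assert (H2 : is_derive (fun s => dnull Phi e (al s) (tt s)) s 0).
      { apply is_derive_ext with (fun _ => dnull Phi e (al s) (tt s)); [intros t; apply Hk|apply Ic]. }
      apply is_derive_unique in H1. apply is_derive_unique in H2. rewrite H1 in H2.
      fold px py tx ty in H2. change (cosh (component Phi true (al s) (tt s))) with (ch (al s) (tt s)) in H2.
      specialize (Hz (al s) (tt s)). specialize (Hfx (al s) (tt s)). specialize (Hch (al s) (tt s)).
      assert (HN := leafN2_pos e0 u (Y s)). assert (Hl := leafs_lower e0 (Y s) He0).
      set (w := / leafs e0 (Y s) * (- leafs e0 (Y s) / (2 * leafN2 e0 u (Y s)))) in *.
      assert (Ew : w = - / (2 * leafN2 e0 u (Y s))) by (unfold w; field; lra).
      assert (Hw0 : w <> 0).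
      { rewrite Ew. apply Ropp_neq_0_compat, Rinv_neq_0_compat. lra. }
      apply Hfx. apply Rmult_eq_reg_r with w; auto. rewrite Rmult_0_l.
      rewrite <- H2.
      transitivity ((px (al s) (tt s) + e * (tx (al s) (tt s) / ch (al s) (tt s))) * w
        + (py (al s) (tt s) + e * (ty (al s) (tt s) / ch (al s) (tt s))) * l); [rewrite Hz; ring|].
      field. lra.
Qed.

(** In null coordinates the target is the strip [|f - g| < PI], whose boundary is straight; [m]
    enters only through the period [P]. A straight boundary contradicts the corner. *)
Lemma zoll_cyl_not_conformal m : (1 <= m)%nat -> ~ conformal 2 zoll_cyl (de_sitter_cover m).
Proof.
  intros Hm [Phi [Hd Hgeo]].
  destruct (de_sitter_null_pair m Phi Hd Hgeo) as [s [Hs Hnp]].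
  set (f := dnull Phi s) in *. set (g := dnull Phi (- s)) in *.
  destruct Hd as [_ [Psi [[_ HPsi] [Hinv1 Hinv2]]]].
  set (P := 2 * PI * INR m) in *.
  assert (Hfst : forall p, fst (Phi p) = (f (fst p) (snd p) + g (fst p) (snd p)) / 2).
  { intros p. unfold f, g, dnull, component. rewrite <- surjective_pairing. simpl. field. }
  assert (Hsnd : forall p, 2 * gd (snd (Phi p)) = s * (f (fst p) (snd p) - g (fst p) (snd p))).
  { intros p. unfold f, g, dnull, component. rewrite <- surjective_pairing. simpl.
    destruct Hs as [-> | ->]; ring. }
  assert (Hpi := PI_RGT_0).
  assert (Hb : forall e off x, boundary_angle e off x -> Rabs (boundary_coord f g 1 (- 1) e x) = PI).
  { intros e off x Hx.
    replace (boundary_coord f g 1 (- 1) e x) with (f x 0 - g PI (Xb e x)) by (unfold boundary_coord; ring).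
    set (G := g PI (Xb e x)).
    assert (HL := null_pair_limit f g e off x Hnp Hx). fold G in HL.
    assert (Hle : Rabs (f x 0 - G) <= PI).
    { apply le_epsilon. intros eps Heps.
      apply is_lim_spec in HL. unfold is_lim', Rbar_locally' in HL.
      destruct (HL (mkposreal eps Heps)) as [T HT].
      specialize (HT (T + 1) ltac:(lra)). simpl in HT. set (t := T + 1) in *.
      assert (Hft : f x t = f x 0) by (destruct Hnp as [_ [_ [H _]]]; apply H).
      assert (E := Hsnd (x, t)). simpl in E. rewrite Hft in E.
      assert (B := gd_bound (snd (Phi (x, t)))). rewrite E in B.
      apply Rabs_def2 in HT. apply Rabs_le. destruct Hs as [Hs|Hs]; rewrite Hs in B; lra. }
    (* A limit strictly inside the strip would be a point of the target, hence attained by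
       surjectivity, which [null_pair_not_hit] forbids. *)
    destruct Hle as [Hlt|Heq]; auto. exfalso. apply Rabs_def2 in Hlt.
    destruct (gd_surj (s * (f x 0 - G))) as [t0 Ht0].
    { destruct Hs as [-> | ->]; lra. }
    set (Q := ((f x 0 + G) / 2, t0)).
    destruct (Hinv2 Q) as [z Hz]. set (p := Psi Q) in *.
    unfold Q in Hz. injection Hz as E1 E2.
    rewrite Hfst in E1. simpl in E1. fold P in E1.
    assert (E3 := Hsnd p). rewrite <- E2, Ht0 in E3.
    apply (null_pair_not_hit f g P e off x Hnp Hx) with (fst p) (snd p) (- z)%Z.
    - intros x1 t1 x2 t2 z' Ef' Eg'.
      assert (HS : same_pt (de_sitter_cover m) (Phi (x1, t1)) (Phi (x2, t2))).
      { exists z'. rewrite (surjective_pairing (Phi (x2, t2))). f_equal.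
        - rewrite !Hfst. simpl. fold P. rewrite Ef', Eg'. field.
        - apply gd_inj. assert (S1 := Hsnd (x1, t1)). assert (S2 := Hsnd (x2, t2)).
          simpl in S1, S2. rewrite Ef', Eg' in S2. lra. }
      apply HPsi in HS.
      destruct (same_pt_cos_sin_eq _ _ HS) as [_ [_ HSS]].
      destruct (same_pt_cos_sin_eq _ _ (Hinv1 (x1, t1))) as [_ [_ I1]].
      destruct (same_pt_cos_sin_eq _ _ (Hinv1 (x2, t2))) as [_ [_ I2]].
      simpl in I1, I2. congruence.
    - rewrite opp_IZR. destruct Hs as [Hs|Hs]; rewrite Hs in E3; lra.
    - rewrite opp_IZR. fold G. destruct Hs as [Hs|Hs]; rewrite Hs in E3; lra. }
  destruct near_half_pi as [d0 [Hd0 [H0 Hnear]]].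
  assert (E0 : forall e, boundary_coord f g 1 (- 1) e (PI / 2) = 1 * f (PI / 2) 0 + - 1 * g PI 0).
  { intros e. unfold boundary_coord. now rewrite (proj1 (Xb_half_pi e)). }
  set (v0 := 1 * f (PI / 2) 0 + - 1 * g PI 0) in *.
  assert (Hv0 : Rabs v0 = PI).
  { rewrite <- (E0 1). now apply Hb with 0. }
  assert (Hloc : forall e, locally (PI / 2) (fun x => Rabs (boundary_coord f g 1 (- 1) e x - v0) < PI)).
  { intros e. apply (continuous_boundary_coord f g 1 (- 1) e Hnp (fun z => Rabs (z - v0) < PI)).
    exists (mkposreal PI Hpi). intros z Hz. rewrite E0 in Hz. exact Hz. }
  (* The values [PI] and [- PI] are [2 PI] apart, so near the corner the boundary value keeps one
     sign. *)
  assert (Hval : forall w, Rabs w = PI -> Rabs (w - v0) < PI -> w = v0).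
  { intros w H1 H2. apply Rabs_def2 in H2.
    destruct (Rle_dec 0 w) as [L|L]; [rewrite Rabs_pos_eq in H1|rewrite Rabs_left in H1];
    (destruct (Rle_dec 0 v0) as [L'|L']; [rewrite Rabs_pos_eq in Hv0|rewrite Rabs_left in Hv0]); lra. }
  destruct (locally_delta _ _ (Hloc 1)) as [d1 [Hd1 L1]].
  destruct (locally_delta _ _ (Hloc (- 1))) as [d2 [Hd2 L2]].
  (* The single equation [f - g = v0] is put in the required form with a dummy second coordinate;
     its derivative in the [f] direction is 1, while the corner demands 0. *)
  destruct (null_pair_corner f g (fun _ _ => True) (fun a _ => a - v0) 1 (- 1) 0 0
    (Rmin d0 (Rmin d1 d2)) Hnp open2_total) as [K _]; auto.
  - smooth.
  - repeat apply Rmin_glb_lt; auto.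
  - intros k [Hk1 Hk2].
    assert (k < d0) by (apply Rlt_le_trans with (1 := Hk2), Rmin_l).
    assert (k < d1).
    { apply Rlt_le_trans with (1 := Hk2). apply Rle_trans with (1 := Rmin_r _ _). apply Rmin_l. }
    rewrite (Hval (boundary_coord f g 1 (- 1) 1 (PI / 2 - k))); [ring| |].
    + apply Hb with 0. apply Hnear; lra.
    + apply L1. replace (PI / 2 - k - PI / 2) with (- k) by ring. rewrite Rabs_Ropp, Rabs_pos_eq; lra.
  - intros k [Hk1 Hk2].
    assert (k < d0) by (apply Rlt_le_trans with (1 := Hk2), Rmin_l).
    assert (k < d2).
    { apply Rlt_le_trans with (1 := Hk2). apply Rle_trans with (1 := Rmin_r _ _). apply Rmin_r. }
    rewrite (Hval (boundary_coord f g 1 (- 1) (- 1) (PI / 2 + k))); [ring| |].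
    + apply Hb with PI. apply Hnear; lra.
    + apply L2. replace (PI / 2 + k - PI / 2) with k by ring. rewrite Rabs_pos_eq; lra.
  - fold v0 in K.
    assert (E1 : Derive (fun z : R => z - v0) v0 = 1)
      by (apply is_derive_unique; auto_derive; auto; ring).
    rewrite E1, Derive_const in K. lra.
Qed.

Theorem theorem5p11 :
  exists C : cyl,
    spacelike_zoll_cylinder C /\
    (exists (k : nat) (tau : R), (1 < k)%nat /\ parabolic_atlas C k tau) /\
    (forall m : nat, (1 <= m)%nat -> ~ conformal 2 C (de_sitter_cover m)) /\
    (exists F : pt -> pt, conformal_embedding C flat_cylinder F) /\
    (forall F : pt -> pt, conformal_embedding C flat_cylinder F ->
       ~ Cn_curve 2 (conformal_boundary F)).
Proof.
  exists zoll_cyl. refine (conj zoll_cyl_zoll (conj _ (conj zoll_cyl_not_conformal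
    (conj _ zoll_boundary_not_C2)))).
  - exists 2%nat, 0. split; [lia | apply zoll_cyl_parabolic].
  - exists emb. apply zoll_cyl_embedding.
Qed.
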